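(* Let $f\in\mathcal A$ be univalent in $\mathbb D$, with $\dfrac{z}{f(z)}=1+\sum_{n=1}^\infty b_nz^n$ in $\mathbb D$, and define $F$ by $\dfrac{z}{F(z)}=1+\sum_{n=1}^\infty b_{2n}z^n$. Let $r_0\in(0,1)$ be the root of $$\frac{r(1-r^2)^2}{2}\log\left(\frac{1+r}{1-r}\right)-(4+r^4-7r^2)=0,$$ so $r_0\approx0.778387$. Then $F$ belongs to $\mathcal U(1)$ in the disk $|z|<r_0$, i.e. for every $0<r\le r_0$ the function $r^{-1}F(rz)$ belongs to $\mathcal U(1)$; in particular $F$ is univalent in $|z|<r_0$.
   Context: $\mathbb D=\{z\in\mathbb C:|z|<1\}$. $\mathcal A$ is the class of functions $f$ analytic in $\mathbb D$ with $f(z)=z+\sum_{k\ge2}a_kz^k$. For $f\in\mathcal A$ with $f(z)\ne0$ for $z\in\mathbb D\setminus\{0\}$, set $U_f(z)=\left(\frac{z}{f(z)}\right)^2f'(z)-1$. $\mathcal U(1)$ is the class of such $f\in\mathcal A$ with $|U_f(z)|<1$ for all $z\in\mathbb D$. *)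

(* Defs.v *)
From Stdlib Require Import Reals.
From Coquelicot Require Export Coquelicot.
Open Scope R_scope.

Definition analytic_on_disk (rho : R) (f : C -> C) : Prop :=
  forall z : C, Cmod z < rho -> ex_derive f z.

Definition univalent_on_disk (rho : R) (f : C -> C) : Prop :=
  forall z w : C, Cmod z < rho -> Cmod w < rho -> f z = f w -> z = w.

Definition classA (f : C -> C) : Prop :=
  analytic_on_disk 1 f /\ f 0 = RtoC 0 /\ is_derive f (RtoC 0) (RtoC 1).

(* f in U(1): f in A, f(z) <> 0 on D \ {0}, and
   |U_f(z)| = |(z/f(z))^2 f'(z) - 1| < 1 on D.  At z = 0, U_f(0) := 0 by the
   removable singularity, so only z <> 0 is constrained. *)
Definition classU1 (f : C -> C) : Prop :=
  classA f /\
  forall z : C, Cmod z < 1 -> z <> RtoC 0 ->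
    f z <> RtoC 0 /\
    forall f' : C, is_derive f z f' ->
      Cmod (Cminus (Cmult (Cmult (Cdiv z (f z)) (Cdiv z (f z))) f') (RtoC 1)) < 1.

Definition r0_equation (r : R) : R :=
  r * (1 - r ^ 2) ^ 2 / 2 * ln ((1 + r) / (1 - r)) - (4 + r ^ 4 - 7 * r ^ 2).

(* Main.v *)
Require Import Defs.
From Stdlib Require Import Reals.
From Coquelicot Require Import Coquelicot.
From Stdlib Require Import Psatz Lia ClassicalEpsilon.
Open Scope R_scope.

(** Write z / f(z) = sum b_n z^n. Since 2 sum b_(2n) z^(2n) = z / f(z) - z / f(-z), univalence of f
    keeps h(z) = z / F(z) = sum b_(2n) z^n away from 0 on the whole disk, and
    U_F(z) = h(z) - z h'(z) - 1 = - sum (n - 1) b_(2n) z^n. By AM-GM,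
    2 |U_F(z)| <= sum (2n - 1) |b_(2n)|^2 + sum (n - 1)^2 / (2n - 1) |z|^(2n). The first sum is at most
    1 by the area theorem sum (n - 1) |b_n|^2 <= 1; the second has a closed form, equal to 1 at r0.

    The area theorem is proved without areas. The logarithmic energy of a complex charge of total
    mass 0 in the plane is nonnegative, because stereographic projection turns - ln |w - w'| into a
    power series with positive coefficients in the inner product on the sphere. Apply this to the
    charge dw on the curve w = 1 / f(z), |z| = t. There
    ln |w - w'| = ln |z - z'| + ln |q(z, z')| + const, where q(z, v) = (z g(v) - v g(z)) / (z - v)
    with g(z) = z / f(z); univalence makes q zero-free on the bidisk. The first kernel contributes
    1 + sum (n - 1) |b_n|^2 and, by the mean value property, the second one contributes
    - 2 sum (n - 1) |b_n|^2 (for t = 1). Everything is discretized at the N-th roots of unity, which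
    replaces the integrals by finite sums with errors that vanish as N grows. *)

(** * Finite sums *)

(** The logarithmic kernel is infinite on the diagonal, which a finite sum over pairs cannot skip.
    It is regularised by eta (1 + |w|^2) (1 + |w'|^2), a weight that keeps the series on the sphere
    positive. For eta = (1 - s)^2 / s and |z| = |v| = 1 one has |z - v|^2 + eta = |z - s v|^2 / s,
    so up to a constant that a charge of mass 0 does not see, regularising means pulling one point
    into the disk, where the logarithm has a power series. Roots of unity integrate exactly only
    exponents below N; with N = L^2 and s = 1 - 1 / L all errors are of order 1 / L.

    Truncations of z / f need not come from univalent functions, so the polynomial area theorem
    assumes a lower bound for |q| on the closed bidisk instead. Truncations inherit it from the full
    series on |z|, |v| <= t < 1, but this requires q to be zero-free on the diagonal too, where q(z,
    z) = (z / f(z))^2 f'(z) and univalence says nothing directly. A Hurwitz argument fills this gap.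

    The strict inequality for |z| < r0 comes from the lowest power |z|^4 of the second sum. *)

Fixpoint csum (n : nat) (f : nat -> C) : C :=
  match n with O => RtoC 0 | S m => Cplus (csum m f) (f m) end.

Fixpoint rsum (n : nat) (f : nat -> R) : R :=
  match n with O => 0 | S m => rsum m f + f m end.

Lemma csum_ext (n : nat) (f g : nat -> C) :
  (forall j, (j < n)%nat -> f j = g j) -> csum n f = csum n g.
Proof. induction n as [|n IH]; simpl; intros H; [reflexivity|]. rewrite IH, H; auto. Qed.

Lemma rsum_ext (n : nat) (f g : nat -> R) :
  (forall j, (j < n)%nat -> f j = g j) -> rsum n f = rsum n g.
Proof. induction n as [|n IH]; simpl; intros H; [reflexivity|]. rewrite IH, H; auto. Qed.

Lemma csum_plus (n : nat) (f g : nat -> C) :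
  csum n (fun j => f j + g j)%C = (csum n f + csum n g)%C.
Proof. induction n as [|n IH]; simpl; [ring|]. rewrite IH; ring. Qed.

Lemma rsum_plus (n : nat) (f g : nat -> R) :
  rsum n (fun j => f j + g j) = rsum n f + rsum n g.
Proof. induction n as [|n IH]; simpl; [ring|]. rewrite IH; ring. Qed.

Lemma csum_scal (n : nat) (c : C) (f : nat -> C) :
  csum n (fun j => c * f j)%C = (c * csum n f)%C.
Proof. induction n as [|n IH]; simpl; [ring|]. rewrite IH; ring. Qed.

Lemma rsum_scal (n : nat) (c : R) (f : nat -> R) :
  rsum n (fun j => c * f j) = c * rsum n f.
Proof. induction n as [|n IH]; simpl; [ring|]. rewrite IH; ring. Qed.

Lemma csum_const (n : nat) (c : C) : csum n (fun _ => c) = (INR n * c)%C.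
Proof.
  induction n as [|n IH]; [simpl; ring|].
  rewrite S_INR, RtoC_plus; simpl; rewrite IH; ring.
Qed.

Lemma rsum_const (n : nat) (c : R) : rsum n (fun _ => c) = INR n * c.
Proof. induction n as [|n IH]; [simpl; ring|]. rewrite S_INR; simpl; rewrite IH; ring. Qed.

Lemma csum_0 (n : nat) (f : nat -> C) :
  (forall j, (j < n)%nat -> f j = RtoC 0) -> csum n f = RtoC 0.
Proof. intros H. rewrite (csum_ext n f (fun _ => RtoC 0) H), csum_const. ring. Qed.

Lemma rsum_0 (n : nat) (f : nat -> R) :
  (forall j, (j < n)%nat -> f j = 0) -> rsum n f = 0.
Proof. intros H. rewrite (rsum_ext n f (fun _ => 0) H), rsum_const. ring. Qed.

Lemma csum_switch (n m : nat) (f : nat -> nat -> C) :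
  csum n (fun j => csum m (f j)) = csum m (fun k => csum n (fun j => f j k)).
Proof.
  induction n as [|n IH]; simpl.
  - symmetry; apply csum_0; reflexivity.
  - rewrite IH, <- csum_plus. reflexivity.
Qed.

Lemma rsum_switch (n m : nat) (f : nat -> nat -> R) :
  rsum n (fun j => rsum m (f j)) = rsum m (fun k => rsum n (fun j => f j k)).
Proof.
  induction n as [|n IH]; simpl.
  - symmetry; apply rsum_0; reflexivity.
  - rewrite IH, <- rsum_plus. reflexivity.
Qed.

Lemma csum_opp (n : nat) (f : nat -> C) : csum n (fun j => - f j)%C = (- csum n f)%C.
Proof. induction n as [|n IH]; simpl; [ring|]. rewrite IH; ring. Qed.

Lemma csum_minus (n : nat) (f g : nat -> C) :
  csum n (fun j => f j - g j)%C = (csum n f - csum n g)%C.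
Proof. induction n as [|n IH]; simpl; [ring|]. rewrite IH; ring. Qed.

Lemma csum_conj (n : nat) (f : nat -> C) :
  Cconj (csum n f) = csum n (fun j => Cconj (f j)).
Proof.
  induction n as [|n IH]; simpl.
  - apply injective_projections; simpl; ring.
  - rewrite Cplus_conj, IH. reflexivity.
Qed.

Lemma Re_csum (n : nat) (f : nat -> C) : Re (csum n f) = rsum n (fun j => Re (f j)).
Proof. induction n as [|n IH]; simpl; [reflexivity|]. rewrite <- IH. reflexivity. Qed.

Lemma csum_RtoC (n : nat) (f : nat -> R) : csum n (fun j => RtoC (f j)) = RtoC (rsum n f).
Proof. induction n as [|n IH]; simpl; [reflexivity|]. now rewrite IH, RtoC_plus. Qed.

Lemma rsum_le (n : nat) (f g : nat -> R) :
  (forall j, (j < n)%nat -> f j <= g j) -> rsum n f <= rsum n g.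
Proof.
  induction n as [|n IH]; simpl; intros H; [lra|].
  apply Rplus_le_compat; auto.
Qed.

Lemma rsum_nonneg (n : nat) (f : nat -> R) :
  (forall j, (j < n)%nat -> 0 <= f j) -> 0 <= rsum n f.
Proof.
  intros H. replace 0 with (rsum n (fun _ => 0)) by (rewrite rsum_const; ring).
  now apply rsum_le.
Qed.

Lemma rsum_le_const (n : nat) (f : nat -> R) (c : R) :
  (forall j, (j < n)%nat -> f j <= c) -> rsum n f <= INR n * c.
Proof. intros H. rewrite <- rsum_const. now apply rsum_le. Qed.

Lemma Cmod_csum (n : nat) (f : nat -> C) : Cmod (csum n f) <= rsum n (fun j => Cmod (f j)).
Proof.
  induction n as [|n IH]; simpl; [rewrite Cmod_0; lra|].
  eapply Rle_trans; [apply Cmod_triangle|lra].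
Qed.

Lemma Rabs_rsum (n : nat) (f : nat -> R) : Rabs (rsum n f) <= rsum n (fun j => Rabs (f j)).
Proof.
  induction n as [|n IH]; simpl; [rewrite Rabs_R0; lra|].
  eapply Rle_trans; [apply Rabs_triang|lra].
Qed.

Lemma csum_S_l (n : nat) (f : nat -> C) :
  csum (S n) f = (f O + csum n (fun j => f (S j)))%C.
Proof.
  induction n as [|n IH]; [simpl; ring|].
  change (csum (S (S n)) f) with (csum (S n) f + f (S n))%C.
  rewrite IH. simpl. ring.
Qed.

Lemma csum_sum_n (f : nat -> C) (n : nat) : sum_n f n = csum (S n) f.
Proof.
  induction n as [|n IH].
  - rewrite sum_O. simpl. ring.
  - rewrite sum_Sn, IH. reflexivity.
Qed.

Lemma Cmod_minus_sym (x y : C) : Cmod (x - y)%C = Cmod (y - x)%C.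
Proof. rewrite <- Cmod_opp. f_equal. ring. Qed.

Lemma Cmod_sqr (z : C) : Cmod z ^ 2 = Re z ^ 2 + Im z ^ 2.
Proof. apply Cmod2_alt. Qed.

Lemma Cmod_triangle_inv (x y : C) : Cmod x - Cmod y <= Cmod (x + y)%C.
Proof.
  assert (H : Cmod x <= Cmod (x + y)%C + Cmod y).
  { replace x with ((x + y) + - y)%C at 1 by ring.
    eapply Rle_trans; [apply Cmod_triangle|]. rewrite Cmod_opp. lra. }
  lra.
Qed.

Lemma conj_mult_unit (z : C) : Cmod z = 1 -> (Cconj z * z)%C = RtoC 1.
Proof. intros H. rewrite Cmult_comm, <- Cmod2_conj, H. f_equal; ring. Qed.

(** * Roots of unity and the discrete mean value property *)

(** Analyticity in quantitative form on the closed unit disk: one constant [K] bounds the values, a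
    candidate derivative and the quadratic Taylor remainder for all parameters [i] in [U]. The
    notion is stable under sums, products and reciprocals, and its uniformity in [i] makes the mean
    value error independent of the second variable. *)
Definition taylor {I : Type} (U : I -> Prop) (p : I -> C -> C) : Prop :=
  exists (p' : I -> C -> C) (K : R), 0 <= K /\
  forall i x y, U i -> Cmod x <= 1 -> Cmod y <= 1 ->
    Cmod (p i x) <= K /\ Cmod (p' i x) <= K /\
    Cmod (p i y - p i x - p' i x * (y - x))%C <= K * Cmod (y - x)%C ^ 2.

Lemma taylor_const {I : Type} (U : I -> Prop) (a : I -> C) (B : R) :
  (forall i, U i -> Cmod (a i) <= B) -> taylor U (fun i _ => a i).
Proof.
  intros H. exists (fun _ _ => RtoC 0), (Rmax B 0). split; [apply Rmax_r|].
  intros i x y Hi Hx Hy.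
  assert (HB := Rmax_l B 0). assert (H0 := Rmax_r B 0). assert (Hpow := pow2_ge_0 (Cmod (y - x)%C)).
  repeat split.
  - specialize (H i Hi). lra.
  - rewrite Cmod_0. lra.
  - replace (a i - a i - 0 * (y - x))%C with (RtoC 0) by ring. rewrite Cmod_0. nra.
Qed.

Lemma taylor_id {I : Type} (U : I -> Prop) : taylor U (fun _ x => x).
Proof.
  exists (fun _ _ => RtoC 1), 1. split; [lra|].
  intros i x y Hi Hx Hy. repeat split; auto.
  - rewrite Cmod_1. lra.
  - replace (y - x - 1 * (y - x))%C with (RtoC 0) by ring. rewrite Cmod_0.
    assert (Hpow := pow2_ge_0 (Cmod (y - x)%C)). lra.
Qed.

Lemma taylor_plus {I : Type} (U : I -> Prop) (p q : I -> C -> C) :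
  taylor U p -> taylor U q -> taylor U (fun i x => p i x + q i x)%C.
Proof.
  intros (p' & K & HK & Hp) (q' & L & HL & Hq).
  exists (fun i x => p' i x + q' i x)%C, (K + L). split; [lra|].
  intros i x y Hi Hx Hy.
  destruct (Hp i x y Hi Hx Hy) as (P1 & P2 & P3). destruct (Hq i x y Hi Hx Hy) as (Q1 & Q2 & Q3).
  repeat split; try (eapply Rle_trans; [apply Cmod_triangle|lra]).
  replace (p i y + q i y - (p i x + q i x) - (p' i x + q' i x) * (y - x))%C
    with ((p i y - p i x - p' i x * (y - x)) + (q i y - q i x - q' i x * (y - x)))%C by ring.
  eapply Rle_trans; [apply Cmod_triangle|lra].
Qed.

(** Inside the unit disk |y - x| <= 2, so the quadratic remainder costs 2 K |y - x| and the linear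
    term K |y - x|. *)
Lemma taylor_lipschitz_bound (x y a d : C) (K : R) :
  0 <= K -> Cmod x <= 1 -> Cmod y <= 1 -> Cmod d <= K ->
  Cmod (a - d * (y - x))%C <= K * Cmod (y - x)%C ^ 2 ->
  Cmod a <= 3 * K * Cmod (y - x)%C.
Proof.
  intros HK Hx Hy Hd Ha.
  assert (Hh : Cmod (y - x)%C <= 2).
  { unfold Cminus. eapply Rle_trans; [apply Cmod_triangle|]. rewrite Cmod_opp. lra. }
  assert (H0 := Cmod_ge_0 (y - x)%C).
  replace a with ((a - d * (y - x)) + d * (y - x))%C by ring.
  eapply Rle_trans; [apply Cmod_triangle|]. rewrite Cmod_mult.
  assert (Cmod d * Cmod (y - x)%C <= K * Cmod (y - x)%C) by (apply Rmult_le_compat_r; auto).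
  assert (K * Cmod (y - x)%C ^ 2 <= K * (2 * Cmod (y - x)%C)).
  { apply Rmult_le_compat_l; auto. nra. }
  lra.
Qed.

Lemma Cmod_mult_le (x y : C) (a b : R) :
  Cmod x <= a -> Cmod y <= b -> Cmod (x * y)%C <= a * b.
Proof. intros. rewrite Cmod_mult. apply Rmult_le_compat; auto using Cmod_ge_0. Qed.

Lemma taylor_mult {I : Type} (U : I -> Prop) (p q : I -> C -> C) :
  taylor U p -> taylor U q -> taylor U (fun i x => p i x * q i x)%C.
Proof.
  intros (p' & K & HK & Hp) (q' & L & HL & Hq).
  (* The remainders of [p] and [q] contribute K L |y - x|^2 each, the cross term p'(x) (q(y) - q(x))
     (y - x) contributes 3 K L |y - x|^2. *)
  exists (fun i x => p' i x * q i x + p i x * q' i x)%C, (5 * K * L).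
  assert (HKL : 0 <= K * L) by now apply Rmult_le_pos.
  split; [lra|].
  intros i x y Hi Hx Hy.
  destruct (Hp i x y Hi Hx Hy) as (P1 & P2 & P3). destruct (Hq i x y Hi Hx Hy) as (Q1 & Q2 & Q3).
  destruct (Hq i y x Hi Hy Hx) as (Q4 & _ & _).
  repeat split.
  - eapply Rle_trans; [apply Cmod_mult_le; eassumption|lra].
  - eapply Rle_trans; [apply Cmod_triangle|].
    assert (A := Cmod_mult_le _ _ _ _ P2 Q1). assert (B := Cmod_mult_le _ _ _ _ P1 Q2). lra.
  - replace (p i y * q i y - p i x * q i x - (p' i x * q i x + p i x * q' i x) * (y - x))%C
      with ((p i y - p i x - p' i x * (y - x)) * q i y
            + (p' i x * ((q i y - q i x) * (y - x))
            + p i x * (q i y - q i x - q' i x * (y - x))))%C by ring.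
    assert (Hl := taylor_lipschitz_bound x y (q i y - q i x)%C (q' i x) L HL Hx Hy Q2 Q3).
    set (h := Cmod (y - x)%C) in *.
    assert (A1 := Cmod_mult_le _ _ _ _ P3 Q4).
    assert (A2 : Cmod ((q i y - q i x) * (y - x))%C <= 3 * L * h * h)
      by (apply Cmod_mult_le; [exact Hl|apply Rle_refl]).
    assert (A3 := Cmod_mult_le _ _ _ _ P2 A2).
    assert (A4 := Cmod_mult_le _ _ _ _ P1 Q3).
    eapply Rle_trans; [apply Cmod_triangle|].
    eapply Rle_trans; [apply Rplus_le_compat_l, Cmod_triangle|].
    nra.
Qed.

Lemma taylor_inv {I : Type} (U : I -> Prop) (p : I -> C -> C) (d : R) :
  0 < d -> (forall i x, U i -> Cmod x <= 1 -> d <= Cmod (p i x)) ->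
  taylor U p -> taylor U (fun i x => / p i x)%C.
Proof.
  intros Hd Hlow (p' & K & HK & Hp).
  set (e := / d). assert (He : 0 < e) by now apply Rinv_0_lt_compat.
  assert (Hinv : forall i x, U i -> Cmod x <= 1 -> Cmod (/ p i x)%C <= e /\ p i x <> RtoC 0).
  { intros i x Hi Hx. specialize (Hlow i x Hi Hx).
    assert (Hne : p i x <> RtoC 0) by (apply Cmod_gt_0; lra).
    split; auto. rewrite Cmod_inv by auto. now apply Rinv_le_contravar. }
  (* The three summands of the constant bound the value, the derivative and the remainder. The last
     one carries the denominator p(x)^2 p(y), hence e^3; its K^2 stems from p(x) times the remainder
     of [p], its 3 K^2 from p'(x) (p(y) - p(x)) (y - x). *)
  exists (fun i x => - p' i x * (/ p i x * / p i x))%C,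
    (e + K * (e * e) + e * e * e * (K * K + 3 * K * K)).
  assert (0 <= e * e * e) by (apply Rlt_le; repeat apply Rmult_lt_0_compat; auto).
  assert (0 <= e * e) by nra.
  assert (0 <= K * K) by nra.
  assert (HA : 0 <= K * (e * e)) by now apply Rmult_le_pos.
  assert (HB : 0 <= e * e * e * (K * K + 3 * K * K)) by (apply Rmult_le_pos; lra).
  split; [lra|].
  intros i x y Hi Hx Hy.
  destruct (Hp i x y Hi Hx Hy) as (P1 & P2 & P3).
  destruct (Hinv i x Hi Hx) as [Ix Nx]. destruct (Hinv i y Hi Hy) as [Iy Ny].
  repeat split.
  - lra.
  - assert (A := Cmod_mult_le _ _ _ _ Ix Ix). rewrite Cmod_mult, Cmod_opp.
    assert (Cmod (p' i x) * Cmod (/ p i x * / p i x)%C <= K * (e * e)).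
    { apply Rmult_le_compat; auto using Cmod_ge_0. }
    lra.
  - replace (/ p i y - / p i x - - p' i x * (/ p i x * / p i x) * (y - x))%C
      with ((/ p i x * / p i x * / p i y) *
        ((- p i x) * (p i y - p i x - p' i x * (y - x)) + p' i x * ((p i y - p i x) * (y - x))))%C
      by (field; auto).
    assert (Hl := taylor_lipschitz_bound x y (p i y - p i x)%C (p' i x) K HK Hx Hy P2 P3).
    set (h := Cmod (y - x)%C) in *. assert (Hh : 0 <= h) by apply Cmod_ge_0.
    assert (A2 : Cmod ((p i y - p i x) * (y - x))%C <= 3 * K * h * h)
      by (apply Cmod_mult_le; [exact Hl|apply Rle_refl]).
    assert (A3 := Cmod_mult_le _ _ _ _ P2 A2).
    assert (A4 : Cmod (- p i x * (p i y - p i x - p' i x * (y - x)))%C <= K * (K * h ^ 2))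
      by (apply Cmod_mult_le; [rewrite Cmod_opp|]; auto).
    assert (A5 : Cmod (/ p i x * / p i x * / p i y)%C <= e * e * e)
      by (repeat apply Cmod_mult_le; auto).
    eapply Rle_trans.
    { apply Cmod_mult_le; [exact A5|]. eapply Rle_trans; [apply Cmod_triangle|].
      apply Rplus_le_compat; eassumption. }
    assert (0 <= (e + K * (e * e)) * h ^ 2) by (apply Rmult_le_pos; [lra|apply pow2_ge_0]).
    nra.
Qed.

Lemma taylor_pow {I : Type} (U : I -> Prop) (p : I -> C -> C) (n : nat) :
  taylor U p -> taylor U (fun i x => p i x ^ n)%C.
Proof.
  intros H. induction n as [|n IH]; simpl.
  - apply (taylor_const U (fun _ => RtoC 1) 1). intros; rewrite Cmod_1; lra.
  - now apply taylor_mult.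
Qed.

Lemma taylor_csum {I : Type} (U : I -> Prop) (p : nat -> I -> C -> C) (n : nat) :
  (forall j, taylor U (p j)) -> taylor U (fun i x => csum n (fun j => p j i x)).
Proof.
  intros H. induction n as [|n IH]; simpl.
  - apply (taylor_const U (fun _ => RtoC 0) 0). intros; rewrite Cmod_0; lra.
  - now apply taylor_plus.
Qed.

(** Mean value inequality for a path in the plane: cut into n equal steps, each step costs e / n + K
    / n^2, and the total excess K / n tends to 0. *)
Lemma increment_bound (phi d : R -> C) (K e : R) :
  (forall s t, 0 <= s <= 1 -> 0 <= t <= 1 ->
     Cmod (phi t - phi s - d s * RtoC (t - s))%C <= K * (t - s) ^ 2) ->
  (forall s, 0 <= s <= 1 -> Cmod (d s) <= e) ->
  Cmod (phi 1 - phi 0)%C <= e.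
Proof.
  intros H He.
  assert (HK : 0 <= K).
  { assert (A := H 0 1 ltac:(lra) ltac:(lra)).
    assert (B := Cmod_ge_0 (phi 1 - phi 0 - d 0 * RtoC (1 - 0))%C). lra. }
  assert (Hn : forall n, (0 < n)%nat -> Cmod (phi 1 - phi 0)%C <= e + K / INR n).
  { intros n Hn. assert (Hpos : 0 < INR n) by now apply lt_0_INR.
    assert (Hk : forall k, (k <= n)%nat ->
      Cmod (phi (INR k / INR n)%R - phi 0)%C <= INR k * (e / INR n + K / INR n ^ 2)).
    { induction k as [|k IH]; intros Hk.
      - replace (INR 0 / INR n) with 0 by (simpl; field; lra).
        replace (phi 0 - phi 0)%C with (RtoC 0) by ring. rewrite Cmod_0. simpl; lra.
      - assert (Hk1 : INR k + 1 <= INR n) by (rewrite <- S_INR; now apply le_INR).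
        assert (Hk0 := pos_INR k).
        assert (Hr : forall a, 0 <= a <= INR n -> 0 <= a / INR n <= 1).
        { intros a Ha. split; [apply Rdiv_le_0_compat; lra|].
          apply Rmult_le_reg_r with (INR n); auto. unfold Rdiv. rewrite Rmult_assoc, Rinv_l; lra. }
        assert (Hs := Hr (INR k) ltac:(lra)). assert (Ht := Hr (INR (S k)) ltac:(rewrite S_INR; lra)).
        assert (A := H _ _ Hs Ht).
        assert (Hd : INR (S k) / INR n - INR k / INR n = / INR n) by (rewrite S_INR; field; lra).
        rewrite Hd in A.
        replace (phi (INR (S k) / INR n)%R - phi 0)%C with
          ((phi (INR (S k) / INR n)%R - phi (INR k / INR n)%R - d (INR k / INR n)%R * RtoC (/ INR n))
           + (d (INR k / INR n)%R * RtoC (/ INR n) + (phi (INR k / INR n)%R - phi 0)))%C by ring.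
        eapply Rle_trans; [apply Cmod_triangle|].
        eapply Rle_trans; [apply Rplus_le_compat_l, Cmod_triangle|].
        assert (B : Cmod (d (INR k / INR n)%R * RtoC (/ INR n))%C <= e * / INR n).
        { apply Cmod_mult_le; [now apply He|]. rewrite Cmod_R, Rabs_pos_eq; [lra|].
          now apply Rlt_le, Rinv_0_lt_compat. }
        specialize (IH ltac:(lia)).
        replace (INR (S k) * (e / INR n + K / INR n ^ 2)) with
          (K * (/ INR n) ^ 2 + (e * / INR n + INR k * (e / INR n + K / INR n ^ 2)))
          by (rewrite S_INR; field; lra).
        apply Rplus_le_compat; [exact A|]. apply Rplus_le_compat; assumption. }
    assert (A := Hk n (le_n n)).
    replace (INR n / INR n) with 1 in A by (field; lra).
    replace (INR n * (e / INR n + K / INR n ^ 2)) with (e + K / INR n) in A by (field; lra).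
    exact A. }
  apply le_epsilon. intros eps Heps.
  destruct (archimed_cor1 (eps / (K + 1))) as (n & Hn1 & Hn2).
  { apply Rdiv_lt_0_compat; lra. }
  eapply Rle_trans; [apply (Hn n Hn2)|].
  apply Rplus_le_compat_l.
  apply Rle_trans with (K * (eps / (K + 1))).
  - apply Rmult_le_compat_l; lra.
  - apply Rmult_le_reg_r with (K + 1); [lra|].
    replace (K * (eps / (K + 1)) * (K + 1)) with (K * eps) by (field; lra). nra.
Qed.

(** The bound on |w - 1| makes consecutive powers close to each other on the circle; 8 is a crude
    upper bound for 2 pi. *)
Definition primitive_root (N : nat) (w : C) : Prop :=
  (w ^ N)%C = RtoC 1 /\ Cmod w = 1 /\ Cmod (w - 1)%C <= 8 / INR N /\
  forall a, (0 < a < N)%nat -> (w ^ a)%C <> RtoC 1.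

Lemma primitive_root_exists (N : nat) : (0 < N)%nat -> exists w, primitive_root N w.
Proof.
  intros HN. assert (Hpos : 0 < INR N) by now apply lt_0_INR.
  set (x := 2 * PI / INR N).
  assert (Hpow : forall k, (((cos x, sin x) : C) ^ k)%C = (cos (INR k * x), sin (INR k * x))).
  { induction k as [|k IH].
    - simpl. rewrite Rmult_0_l, cos_0, sin_0. reflexivity.
    - rewrite Cpow_S, IH, S_INR. replace ((INR k + 1) * x) with (x + INR k * x) by ring.
      rewrite cos_plus, sin_plus. unfold Cmult; simpl. f_equal; ring. }
  assert (HPI := PI_RGT_0).
  exists (cos x, sin x). repeat split.
  - rewrite Hpow. replace (INR N * x) with (2 * PI) by (unfold x; field; lra).
    now rewrite cos_2PI, sin_2PI.
  - unfold Cmod. simpl fst; simpl snd.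
    assert (A := sin2_cos2 x). unfold Rsqr in A.
    replace (cos x ^ 2 + sin x ^ 2) with 1 by (simpl; lra). apply sqrt_1.
  - assert (Hx0 : 0 <= x / 2) by (unfold x; repeat apply Rdiv_le_0_compat; lra).
    assert (Hs : Rabs (sin (x / 2)) <= x / 2).
    { destruct (Req_dec (x / 2) 0) as [->|Hne].
      - rewrite sin_0, Rabs_R0; lra.
      - destruct (Rle_lt_dec 1 (x / 2)).
        + apply Rabs_le. assert (A := SIN_bound (x / 2)). lra.
        + rewrite Rabs_pos_eq; [apply Rlt_le, sin_lt_x; lra|].
          apply sin_ge_0; [lra|]. assert (A := PI2_1). lra. }
    assert (Hm : Cmod ((cos x, sin x) - 1)%C = 2 * Rabs (sin (x / 2))).
    { unfold Cmod; simpl. replace (2 * Rabs (sin (x / 2))) with (sqrt (Rsqr (2 * sin (x / 2)))).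
      2:{ rewrite sqrt_Rsqr_abs, Rabs_mult. rewrite (Rabs_pos_eq 2); lra. }
      f_equal. replace x with (2 * (x / 2)) at 1 2 3 4 by field.
      rewrite cos_2a_sin, sin_2a. unfold Rsqr.
      assert (A := sin2_cos2 (x / 2)). unfold Rsqr in A.
      set (s := sin (x / 2)) in *. set (c := cos (x / 2)) in *.
      replace ((1 - 2 * s * s + - (1)) * ((1 - 2 * s * s + - (1)) * 1) + (2 * s * c + - 0) * ((2 * s * c + - 0) * 1))
        with (4 * s * s * (s * s + c * c)) by ring. rewrite A. ring. }
    rewrite Hm.
    assert (A := PI_4). apply Rle_trans with x; [lra|]. unfold x, Rdiv.
    apply Rmult_le_compat_r; [now apply Rlt_le, Rinv_0_lt_compat|lra].
  (* The real part suffices: 1 - cos y = 2 sin^2 (y / 2), and here y / 2 = pi a / N lies strictly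
     between 0 and pi. *)
  - intros a Ha. rewrite Hpow. intros E. apply (f_equal fst) in E; simpl in E.
    replace (INR a * x) with (2 * (INR a * x / 2)) in E by field.
    rewrite cos_2a_sin in E.
    assert (H1 : 0 < INR a) by (apply lt_0_INR; lia).
    assert (H2 : INR a < INR N) by (apply lt_INR; lia).
    assert (Hy : 0 < INR a * x / 2 < PI).
    { replace (INR a * x / 2) with (PI * (INR a / INR N)) by (unfold x; field; lra).
      assert (0 < INR a / INR N) by now apply Rdiv_lt_0_compat.
      assert (INR a / INR N < 1).
      { apply Rmult_lt_reg_r with (INR N); auto. unfold Rdiv. rewrite Rmult_assoc, Rinv_l; lra. }
      nra. }
    assert (Hs := sin_gt_0 _ (proj1 Hy) (proj2 Hy)). nra.
Qed.

Lemma geometric_csum (x : C) (n : nat) :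
  ((x - 1) * csum n (fun j => x ^ j))%C = (x ^ n - 1)%C.
Proof.
  induction n as [|n IH]; [simpl; ring|].
  change (csum (S n) (fun j => x ^ j)%C) with (csum n (fun j => x ^ j) + x ^ n)%C.
  rewrite Cmult_plus_distr_l, IH, Cpow_S. ring.
Qed.

Lemma Cmult_integral (x y : C) : (x * y)%C = RtoC 0 -> x = RtoC 0 \/ y = RtoC 0.
Proof.
  intros H. apply (f_equal Cmod) in H. rewrite Cmod_mult, Cmod_0 in H.
  apply Rmult_integral in H. destruct H as [H|H]; apply Cmod_eq_0 in H; auto.
Qed.

Lemma primitive_root_sum (N a : nat) (w : C) :
  primitive_root N w -> (0 < a < N)%nat -> csum N (fun j => ((w ^ j) ^ a)%C) = RtoC 0.
Proof.
  intros (H1 & _ & _ & H2) Ha.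
  assert (G := geometric_csum (w ^ a)%C N).
  replace (((w ^ a) ^ N)%C) with (RtoC 1) in G.
  2:{ now rewrite <- Cpow_mult_r, Nat.mul_comm, Cpow_mult_r, H1, Cpow_1_l. }
  replace (1 - 1)%C with (RtoC 0) in G by ring.
  apply Cmult_integral in G. destruct G as [G|G].
  - exfalso. apply (H2 a Ha). replace (w ^ a)%C with ((w ^ a - 1) + 1)%C by ring. rewrite G. ring.
  - rewrite <- G. apply csum_ext. intros j _. now rewrite <- !Cpow_mult_r, Nat.mul_comm.
Qed.

Lemma csum_telescope (f : nat -> C) (n : nat) :
  csum n (fun j => f (S j) - f j)%C = (f n - f O)%C.
Proof. induction n as [|n IH]; simpl; [ring|]. rewrite IH. ring. Qed.

Lemma Cmod_pow_unit (w : C) (n : nat) : Cmod w = 1 -> Cmod (w ^ n)%C = 1.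
Proof. intros H. now rewrite Cmod_pow, H, pow1. Qed.

(* The derivative in s of the sum of p (s w^j) is, up to the factor s (w - 1) and second-order
   terms, the telescoping sum of the differences p (s w^(j+1)) - p (s w^j). *)
Lemma discrete_mean_value {I : Type} (U : I -> Prop) (p : I -> C -> C) :
  taylor U p -> exists B, 0 <= B /\ forall N w i, (1 < N)%nat -> primitive_root N w -> U i ->
    Cmod (csum N (fun j => p i (w ^ j)%C) - INR N * p i (RtoC 0))%C <= B.
Proof.
  (* The error turns out to be at most K N |w - 1|, and N |w - 1| <= 8. It does not grow with N,
     while the mean value itself carries the factor N. *)
  intros (p' & K & HK & Hp). exists (8 * K). split; [lra|].
  intros N w i HN Hw Hi. generalize Hw; intros (W1 & W2 & W3 & W4).
  assert (Hpos : 0 < INR N) by (apply lt_0_INR; lia).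
  assert (Hw1 : (w - 1)%C <> RtoC 0).
  { intros E. apply (W4 1%nat); [lia|]. rewrite Cpow_1_r.
    replace w with ((w - 1) + 1)%C by ring. rewrite E. ring. }
  assert (Hin : forall s j, 0 <= s <= 1 -> Cmod (RtoC s * w ^ j)%C = s).
  { intros s j Hs. rewrite Cmod_mult, Cmod_pow_unit, Cmod_R, Rabs_pos_eq; lra. }
  set (phi := fun s : R => csum N (fun j => p i (RtoC s * w ^ j)%C)).
  set (d := fun s : R => csum N (fun j => p' i (RtoC s * w ^ j) * w ^ j)%C).
  assert (E1 : phi 1 = csum N (fun j => p i (w ^ j)%C)).
  { apply csum_ext. intros j _. f_equal. ring. }
  assert (E0 : phi 0 = (INR N * p i (RtoC 0))%C).
  { unfold phi. rewrite <- csum_const. apply csum_ext. intros j _. f_equal. ring. }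
  rewrite <- E1, <- E0.
  apply increment_bound with (d := d) (K := INR N * K).
  - intros s t Hs Ht. unfold phi, d.
    replace (csum N (fun j => p i (t * w ^ j)%C) - csum N (fun j => p i (s * w ^ j)%C)
      - csum N (fun j => p' i (s * w ^ j) * w ^ j)%C * RtoC (t - s))%C
      with (csum N (fun j => p i (t * w ^ j) - p i (s * w ^ j)
               - RtoC (t - s) * (p' i (s * w ^ j) * w ^ j))%C).
    2:{ rewrite !csum_minus, csum_scal. ring. }
    eapply Rle_trans; [apply Cmod_csum|]. rewrite Rmult_assoc. apply rsum_le_const.
    intros j _.
    destruct (Hp i (s * w ^ j)%C (t * w ^ j)%C Hi) as (_ & _ & A); try (rewrite Hin; lra).
    replace (t * w ^ j - s * w ^ j)%C with (RtoC (t - s) * w ^ j)%C in A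
      by (rewrite RtoC_minus; ring).
    rewrite Cmod_mult, Cmod_pow_unit, Rmult_1_r, Cmod_R, pow2_abs in A by auto.
    eapply Rle_trans; [|exact A]. right. f_equal. ring.
  - intros s Hs.
    (* The telescoping identity is divided by s below. At s = 0 the derivative is a multiple of the
       sum of all roots, which vanishes. *)
    destruct (Req_dec s 0) as [->|Hs0].
    { unfold d. rewrite (csum_ext _ _ (fun j => p' i (RtoC 0) * w ^ j)%C).
      2:{ intros j _. f_equal. f_equal. ring. }
      rewrite csum_scal. rewrite (csum_ext N _ (fun j => (w ^ j) ^ 1)%C)
        by (intros; now rewrite Cpow_1_r).
      rewrite (primitive_root_sum N 1 w Hw) by lia. rewrite Cmult_0_r, Cmod_0. lra. }
    assert (T := csum_telescope (fun j => p i (s * w ^ j)%C) N). cbv beta in T.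
    rewrite W1 in T. simpl (w ^ 0)%C in T.
    replace (p i (s * 1)%C - p i (s * 1)%C)%C with (RtoC 0) in T by ring.
    assert (Hsw : (RtoC s * (w - 1) * d s)%C =
      (- csum N (fun j => p i (s * w ^ S j) - p i (s * w ^ j)
                         - p' i (s * w ^ j) * (s * w ^ S j - s * w ^ j))%C)%C).
    { rewrite csum_minus, T. unfold d. rewrite <- csum_scal.
      rewrite (csum_ext N (fun j => p' i (s * w ^ j) * (s * w ^ S j - s * w ^ j))%C
        (fun j => s * (w - 1) * (p' i (s * w ^ j) * w ^ j))%C); [ring|].
      intros j _. rewrite Cpow_S. ring. }
    apply (f_equal Cmod) in Hsw. rewrite Cmod_opp, !Cmod_mult, Cmod_R, Rabs_pos_eq in Hsw by lra.
    assert (A : s * Cmod (w - 1)%C * Cmod (d s) <= INR N * (K * (s * Cmod (w - 1)%C) ^ 2)).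
    { rewrite Hsw. eapply Rle_trans; [apply Cmod_csum|]. apply rsum_le_const. intros j _.
      destruct (Hp i (s * w ^ j)%C (s * w ^ S j)%C Hi) as (_ & _ & A); try (rewrite Hin; lra).
      eapply Rle_trans; [exact A|].
      replace (s * w ^ S j - s * w ^ j)%C with ((s * w ^ j) * (w - 1))%C by (rewrite Cpow_S; ring).
      rewrite Cmod_mult, Hin by auto. lra. }
    assert (Hq : 0 < Cmod (w - 1)%C) by now apply Cmod_gt_0.
    set (q := Cmod (w - 1)%C) in *.
    assert (B : Cmod (d s) <= INR N * (K * (s * q))).
    { apply Rmult_le_reg_l with (s * q); [apply Rmult_lt_0_compat; lra|].
      eapply Rle_trans; [exact A|]. right; ring. }
    eapply Rle_trans; [exact B|].
    assert (Nq : INR N * q <= 8).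
    { apply Rmult_le_reg_r with (/ INR N); [now apply Rinv_0_lt_compat|].
      replace (INR N * q * / INR N) with q by (field; lra). exact W3. }
    replace (INR N * (K * (s * q))) with (K * (s * (INR N * q))) by ring.
    rewrite (Rmult_comm 8). apply Rmult_le_compat_l; auto.
    assert (0 <= INR N * q) by (apply Rmult_le_pos; lra). nra.
Qed.

(** * Positivity of the logarithmic energy *)

Lemma Cmod_one_minus_sqr (z : C) (r : R) :
  Cmod (1 - r * z)%C ^ 2 = 1 - 2 * r * Re z + r ^ 2 * Cmod z ^ 2.
Proof. rewrite !Cmod_sqr. destruct z as [a b]. simpl. ring. Qed.

Lemma Cmod_one_minus_lower (z : C) (r : R) :
  0 <= r <= 1 -> 1 - Cmod z <= Cmod (1 - r * z)%C.
Proof.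
  intros Hr. unfold Cminus. assert (A := Cmod_triangle_inv 1 (- (r * z))%C).
  rewrite Cmod_1, Cmod_opp, Cmod_mult, Cmod_R, Rabs_pos_eq in A by lra.
  assert (B := Cmod_ge_0 z). nra.
Qed.

Lemma is_derive_rsum (n : nat) (f df : nat -> R -> R) (x : R) :
  (forall l, is_derive (f l) x (df l x)) ->
  is_derive (fun r : R => rsum n (fun l => f l r)) x (rsum n (fun l => df l x)).
Proof.
  intros H. induction n as [|n IH]; simpl.
  - apply @is_derive_const.
  - apply @is_derive_plus; auto.
Qed.

(** Along the ray the logarithm has derivative -2 Re (z / (1 - r z)); the partial sum differentiates
    to a finite geometric sum, which cancels everything but the tail. *)
Lemma ln_taylor_derivative (z : C) (n : nat) (r : R) :
  Cmod z < 1 -> 0 <= r <= 1 ->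
  is_derive (fun r : R => ln (Cmod (1 - r * z)%C ^ 2)
      + 2 * rsum n (fun l => Re (z ^ S l)%C * (r ^ S l / INR (S l)))) r
    (- 2 * Re (z * (r * z) ^ n / (1 - r * z))%C).
Proof.
  intros Hz Hr.
  assert (Hpos : 0 < Cmod (1 - r * z)%C) by (assert (A := Cmod_one_minus_lower z r Hr); lra).
  assert (Hne : (1 - r * z)%C <> RtoC 0) by now apply Cmod_gt_0.
  apply is_derive_ext with (fun r : R => ln (1 - 2 * r * Re z + r ^ 2 * Cmod z ^ 2)
      + 2 * rsum n (fun l => Re (z ^ S l)%C * (r ^ S l / INR (S l)))).
  { intros t. now rewrite <- Cmod_one_minus_sqr. }
  set (D := Cmod (1 - r * z)%C ^ 2).
  assert (HD : D = 1 - 2 * r * Re z + r ^ 2 * Cmod z ^ 2) by apply Cmod_one_minus_sqr.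
  assert (HD0 : 0 < D) by now apply pow_lt.
  replace (- 2 * Re (z * (r * z) ^ n / (1 - r * z))%C) with
    ((- 2 * Re z + 2 * r * Cmod z ^ 2) / D + 2 * rsum n (fun l => Re (z ^ S l)%C * r ^ l)).
  - apply @is_derive_plus.
    + rewrite HD. rewrite HD in HD0. generalize dependent (Cmod z ^ 2). intros m _ HD0.
      auto_derive; [simpl in HD0 |- *; lra|]. field. simpl in HD0 |- *. lra.
    + apply is_derive_scal.
      apply (is_derive_rsum n (fun l r => Re (z ^ S l)%C * (r ^ S l / INR (S l)))
               (fun l r => Re (z ^ S l)%C * r ^ l)).
      intros l. generalize (Re (z ^ S l)%C). intros a.
      auto_derive; auto. change (match l with O => 1 | S _ => INR l + 1 end) with (INR (S l)).
      assert (INR (S l) <> 0) by (apply not_0_INR; lia). field. auto.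
  - assert (HG : rsum n (fun l => Re (z ^ S l)%C * r ^ l)
       = Re (z / (1 - r * z) - z * (r * z) ^ n / (1 - r * z))%C).
    { assert (G := geometric_csum (r * z)%C n).
      replace (z / (1 - r * z) - z * (r * z) ^ n / (1 - r * z))%C
        with (z * csum n (fun j => (r * z) ^ j))%C.
      2:{ replace (z / (1 - r * z) - z * (r * z) ^ n / (1 - r * z))%C
            with ((- z) * ((r * z) ^ n - 1) / (1 - r * z))%C by (field; auto).
          rewrite <- G. field. auto. }
      rewrite <- csum_scal, Re_csum. apply rsum_ext. intros j _.
      rewrite Cpow_mult_l, Cpow_S, <- RtoC_pow.
      replace (z * (RtoC (r ^ j) * z ^ j))%C with ((z * z ^ j) * RtoC (r ^ j))%C by ring.
      now rewrite re_scal_r. }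
    rewrite HG. unfold Cminus at 1. rewrite re_plus, re_opp.
    assert (HE : (- 2 * Re z + 2 * r * Cmod z ^ 2) / D = - 2 * Re (z / (1 - r * z))%C).
    { replace (z / (1 - r * z))%C with (z * Cconj (1 - r * z) * RtoC (/ D))%C.
      2:{ unfold D. rewrite RtoC_inv by (fold D; lra). rewrite Cmod2_conj. field. split; auto.
          intros E. apply Hne. rewrite <- (Cconj_conj (1 - r * z)%C), E.
          apply injective_projections; simpl; ring. }
      rewrite re_scal_r, Cmod_sqr. destruct z as [a b]. simpl. field. lra. }
    rewrite HE. ring.
Qed.

Lemma derive_nonneg_le (f df : R -> R) (a b : R) : a <= b ->
  (forall x, a <= x <= b -> is_derive f x (df x)) ->
  (forall x, a <= x <= b -> 0 <= df x) -> f a <= f b.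
Proof.
  intros Hab Hd Hp.
  destruct (MVT_gen f a b df) as (c & Hc & E).
  - rewrite Rmin_left, Rmax_right by lra. intros x Hx. apply Hd. lra.
  - rewrite Rmin_left, Rmax_right by lra. intros x Hx.
    apply derivable_continuous_pt. exists (df x). apply is_derive_Reals. now apply Hd.
  - rewrite Rmin_left, Rmax_right in Hc by lra. assert (P := Hp c Hc). nra.
Qed.

(** The derivative along the ray is at most c (n + 1) r^n in modulus, so both c r^(n + 1) + [phi]
    and c r^(n + 1) - [phi] are nondecreasing in r; comparing r = 0 with r = 1 gives the two
    bounds. *)
Lemma ln_taylor (z : C) (n : nat) : Cmod z < 1 ->
  Rabs (ln (Cmod (1 - z)%C ^ 2) + 2 * rsum n (fun l => Re (z ^ S l)%C / INR (S l)))
    <= 2 / (INR (S n) * (1 - Cmod z)) * Cmod z ^ S n.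
Proof.
  intros Hz. set (m := Cmod z) in *. assert (Hm : 0 <= m) by apply Cmod_ge_0.
  set (phi := fun r : R => ln (Cmod (1 - r * z)%C ^ 2)
      + 2 * rsum n (fun l => Re (z ^ S l)%C * (r ^ S l / INR (S l)))).
  set (c := 2 / (INR (S n) * (1 - m)) * m ^ S n).
  assert (HS : 0 < INR (S n)) by (apply lt_0_INR; lia).
  set (dphi := fun r : R => - 2 * Re (z * (r * z) ^ n / (1 - r * z))%C).
  assert (Hd : forall r, 0 <= r <= 1 -> is_derive phi r (dphi r)).
  { intros r Hr. now apply ln_taylor_derivative. }
  assert (Hb : forall r, 0 <= r <= 1 -> Rabs (dphi r) <= c * INR (S n) * r ^ n).
  { intros r Hr. unfold dphi. rewrite Rabs_mult. replace (Rabs (-2)) with 2 by (rewrite Rabs_left; lra).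
    assert (Hl := Cmod_one_minus_lower z r Hr). fold m in Hl.
    assert (Hne : (1 - r * z)%C <> RtoC 0) by (apply Cmod_gt_0; lra).
    apply Rle_trans with (2 * (m * (r * m) ^ n / (1 - m))).
    - apply Rmult_le_compat_l; [lra|].
      eapply Rle_trans; [apply re_le_Cmod|].
      rewrite Cmod_div by auto. rewrite Cmod_mult, Cmod_pow, Cmod_mult, Cmod_R, Rabs_pos_eq by lra.
      fold m. apply Rmult_le_compat_l.
      + apply Rmult_le_pos; auto. apply pow_le. nra.
      + apply Rinv_le_contravar; lra.
    - right. unfold c. rewrite Rpow_mult_distr. change (m ^ S n) with (m * m ^ n).
      field. split; lra. }
  assert (Hc : forall r, is_derive (fun r : R => c * r ^ S n) r (c * INR (S n) * r ^ n)).
  { intros r. auto_derive; auto. change (match n with O => 1 | S _ => INR n + 1 end) with (INR (S n)).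
    ring. }
  assert (E0 : phi 0 = 0).
  { unfold phi. replace (1 - 0 * z)%C with (RtoC 1) by ring.
    rewrite Cmod_1, pow1, ln_1, rsum_0; [ring|]. intros j _. simpl. unfold Rdiv. ring. }
  assert (E1 : phi 1 = ln (Cmod (1 - z)%C ^ 2) + 2 * rsum n (fun l => Re (z ^ S l)%C / INR (S l))).
  { unfold phi. replace (1 - 1 * z)%C with (1 - z)%C by ring.
    do 2 f_equal. apply rsum_ext. intros j _. rewrite pow1. unfold Rdiv. ring. }
  rewrite <- E1. apply Rabs_le.
  split.
  - assert (B : phi 0 + c * 0 ^ S n <= phi 1 + c * 1 ^ S n).
    { apply (derive_nonneg_le (fun r : R => phi r + c * r ^ S n)
               (fun r : R => dphi r + c * INR (S n) * r ^ n) 0 1); [lra| |].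
      - intros r Hr. apply @is_derive_plus; [now apply Hd|apply Hc].
      - intros r Hr. assert (B := Hb r Hr). apply Rabs_le_between in B. lra. }
    rewrite E0, pow1, pow_i in B by lia. lra.
  - assert (B : c * 0 ^ S n - phi 0 <= c * 1 ^ S n - phi 1).
    { apply (derive_nonneg_le (fun r : R => c * r ^ S n - phi r)
               (fun r : R => c * INR (S n) * r ^ n - dphi r) 0 1); [lra| |].
      - intros r Hr. apply @is_derive_minus; [apply Hc|now apply Hd].
      - intros r Hr. assert (B := Hb r Hr). apply Rabs_le_between in B. lra. }
    rewrite E0, pow1, pow_i in B by lia. lra.
Qed.

(** * Double sums and positive kernels *)

Definition dsum (N : nat) (f : nat -> nat -> R) : R := rsum N (fun j => rsum N (f j)).

Lemma dsum_ext (N : nat) (f g : nat -> nat -> R) :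
  (forall j k, (j < N)%nat -> (k < N)%nat -> f j k = g j k) -> dsum N f = dsum N g.
Proof. intros H. apply rsum_ext. intros j Hj. apply rsum_ext. auto. Qed.

Lemma dsum_le (N : nat) (f g : nat -> nat -> R) :
  (forall j k, (j < N)%nat -> (k < N)%nat -> f j k <= g j k) -> dsum N f <= dsum N g.
Proof. intros H. apply rsum_le. intros j Hj. apply rsum_le. auto. Qed.

Lemma dsum_plus (N : nat) (f g : nat -> nat -> R) :
  dsum N (fun j k => f j k + g j k) = dsum N f + dsum N g.
Proof. unfold dsum. rewrite <- rsum_plus. apply rsum_ext. intros j _. apply rsum_plus. Qed.

Lemma dsum_scal (N : nat) (c : R) (f : nat -> nat -> R) :
  dsum N (fun j k => c * f j k) = c * dsum N f.
Proof. unfold dsum. rewrite <- rsum_scal. apply rsum_ext. intros j _. apply rsum_scal. Qed.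

Lemma dsum_rsum (N n : nat) (f : nat -> nat -> nat -> R) :
  dsum N (fun j k => rsum n (fun l => f l j k)) = rsum n (fun l => dsum N (f l)).
Proof.
  unfold dsum. rewrite (rsum_switch n N). apply rsum_ext. intros j _. apply rsum_switch.
Qed.

Lemma Rabs_dsum (N : nat) (f : nat -> nat -> R) :
  Rabs (dsum N f) <= dsum N (fun j k => Rabs (f j k)).
Proof.
  eapply Rle_trans; [apply Rabs_rsum|]. apply rsum_le. intros j _. apply Rabs_rsum.
Qed.

Lemma dsum_hermitian (N : nat) (x y : nat -> C) :
  dsum N (fun j k => Re (x j * Cconj (y k))%C) = Re (csum N x * Cconj (csum N y))%C.
Proof.
  unfold dsum.
  rewrite (rsum_ext N _ (fun j => Re (x j * Cconj (csum N y))%C)).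
  - rewrite <- Re_csum. f_equal.
    rewrite (csum_ext N _ (fun j => Cconj (csum N y) * x j)%C) by (intros; ring).
    rewrite csum_scal. ring.
  - intros j _. now rewrite csum_conj, <- csum_scal, Re_csum.
Qed.

Lemma Re_mult_conj (x : C) : Re (x * Cconj x)%C = Cmod x ^ 2.
Proof. now rewrite <- Cmod2_conj. Qed.

(** Powers of a Gram kernel are positive semidefinite: peeling off one factor splits the form into
    three forms of the same kind, with charges x_j s1_j, x_j s2_j and x_j s3_j. This is why [x]
    stays quantified in the induction. *)
Lemma gram_power_pos (N : nat) (s1 s2 s3 : nat -> R) (n : nat) : forall x : nat -> C,
  0 <= dsum N (fun j k => Re (x j * Cconj (x k))%C
                          * (s1 j * s1 k + s2 j * s2 k + s3 j * s3 k) ^ n).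
Proof.
  induction n as [|n IH]; intros x.
  - rewrite (dsum_ext N _ (fun j k => Re (x j * Cconj (x k))%C)) by (intros; simpl; ring).
    rewrite dsum_hermitian, Re_mult_conj. apply pow2_ge_0.
  - assert (A1 := IH (fun j => x j * s1 j)%C). assert (A2 := IH (fun j => x j * s2 j)%C).
    assert (A3 := IH (fun j => x j * s3 j)%C). cbv beta in *.
    eapply Rle_trans; [apply (Rplus_le_le_0_compat _ _ (Rplus_le_le_0_compat _ _ A1 A2) A3)|].
    rewrite <- !dsum_plus. right. apply dsum_ext. intros j k _ _.
    assert (E : forall a b, Re (x j * RtoC a * Cconj (x k * RtoC b))%C = a * b * Re (x j * Cconj (x k))%C).
    { intros a b. destruct (x j), (x k). simpl. ring. }
    rewrite !E. simpl. ring.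
Qed.

(* Stereographic projection: with s the point of the unit sphere over w and c = 1 + |w|^2,
   |w - w'|^2 = c c' (1 - s.s') / 2, so that up to terms that a zero-sum charge does not see the
   kernel is ln (1 - s.s' / (1 + 2 eta)), a power series in s.s' with negative coefficients. *)
Lemma log_energy_nonpos (N : nat) (w x : nat -> C) (eta : R) :
  0 < eta -> csum N x = RtoC 0 ->
  dsum N (fun j k => Re (x j * Cconj (x k))%C *
    ln (Cmod (w j - w k)%C ^ 2 + eta * ((1 + Cmod (w j) ^ 2) * (1 + Cmod (w k) ^ 2)))) <= 0.
Proof.
  intros Heta Hx.
  set (A := fun j k => Re (x j * Cconj (x k))%C).
  set (c := fun j => 1 + Cmod (w j) ^ 2).
  assert (Hc : forall j, 0 < c j) by (intros j; unfold c; assert (P := pow2_ge_0 (Cmod (w j))); lra).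
  set (s1 := fun j => 2 * Re (w j) / c j). set (s2 := fun j => 2 * Im (w j) / c j).
  set (s3 := fun j => (Cmod (w j) ^ 2 - 1) / c j).
  set (sg := fun j k => s1 j * s1 k + s2 j * s2 k + s3 j * s3 k).
  assert (Hsg : forall j k, Cmod (w j - w k)%C ^ 2 = c j * c k * ((1 - sg j k) / 2)).
  { intros j k. unfold sg, s1, s2, s3. assert (P := Hc j). assert (P' := Hc k).
    rewrite Cmod_sqr. unfold c in *. rewrite !Cmod_sqr in *.
    destruct (w j) as [a b], (w k) as [a' b']. simpl in *. field. simpl. split; lra. }
  assert (Hunit : forall j, s1 j ^ 2 + s2 j ^ 2 + s3 j ^ 2 = 1).
  { intros j. unfold s1, s2, s3. assert (P := Hc j). unfold c in *. rewrite !Cmod_sqr in *.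
    destruct (w j) as [a b]. simpl in *. field. simpl. lra. }
  assert (Hsg1 : forall j k, -1 <= sg j k <= 1).
  { intros j k. assert (U := Hunit j). assert (V := Hunit k). unfold sg.
    assert (P1 := pow2_ge_0 (s1 j - s1 k)). assert (P2 := pow2_ge_0 (s2 j - s2 k)).
    assert (P3 := pow2_ge_0 (s3 j - s3 k)). assert (P4 := pow2_ge_0 (s1 j + s1 k)).
    assert (P5 := pow2_ge_0 (s2 j + s2 k)). assert (P6 := pow2_ge_0 (s3 j + s3 k)). nra. }
  (* From |w - w'|^2 + eta c c' = c c' (1/2 + eta) (1 - q s.s'). As q < 1, the logarithm can be
     expanded even on the diagonal, where s.s' = 1. *)
  set (q := / (1 + 2 * eta)).
  assert (Hq : 0 < q < 1).
  { unfold q. split; [apply Rinv_0_lt_compat; lra|].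
    rewrite <- Rinv_1. apply Rinv_lt_contravar; lra. }
  set (tau := fun j k => q * sg j k).
  assert (Htau : forall j k, Rabs (tau j k) <= q).
  { intros j k. unfold tau. rewrite Rabs_mult, (Rabs_pos_eq q) by lra.
    assert (Rabs (sg j k) <= 1) by (apply Rabs_le, Hsg1). nra. }
  assert (Hker : forall j k, ln (Cmod (w j - w k)%C ^ 2 + eta * (c j * c k))
     = ln (c j) + ln (c k) + ln (1 / 2 + eta) + ln (1 - tau j k)).
  { intros j k. rewrite Hsg. assert (P := Hc j). assert (P' := Hc k).
    assert (T := Htau j k). apply Rabs_le_between in T.
    rewrite <- !ln_mult; try lra; repeat apply Rmult_lt_0_compat; try lra.
    f_equal. unfold tau, q. field. lra. }
  rewrite (dsum_ext N _ (fun j k => (A j k * ln (c j) + A j k * ln (c k)) +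
     (ln (1 / 2 + eta) * A j k + A j k * ln (1 - tau j k)))).
  2:{ intros j k _ _. fold (A j k). fold (c j) (c k). rewrite Hker. ring. }
  assert (Z : forall g : nat -> C, Re (csum N g * Cconj (csum N x))%C = 0).
  { intros g. rewrite Hx. simpl. ring. }
  assert (Z1 : dsum N (fun j k => A j k * ln (c j)) = 0).
  { rewrite (dsum_ext N _ (fun j k => Re ((ln (c j) * x j) * Cconj (x k))%C)).
    - rewrite dsum_hermitian. apply Z.
    - intros j k _ _. unfold A. destruct (x j), (x k). simpl. ring. }
  assert (Z2 : dsum N (fun j k => A j k * ln (c k)) = 0).
  { rewrite (dsum_ext N _ (fun j k => Re (x j * Cconj (ln (c k) * x k))%C)).
    - rewrite dsum_hermitian, Hx. simpl. ring.
    - intros j k _ _. unfold A. destruct (x j), (x k). simpl. ring. }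
  assert (Z3 : dsum N A = 0) by (unfold A; rewrite dsum_hermitian; apply Z).
  rewrite !dsum_plus, dsum_scal, Z1, Z2, Z3.
  replace (0 + 0 + (ln (1 / 2 + eta) * 0 + dsum N (fun j k => A j k * ln (1 - tau j k))))
    with (dsum N (fun j k => A j k * ln (1 - tau j k))) by ring.
  apply le_epsilon. intros eps Heps.
  set (M := dsum N (fun j k => Rabs (A j k))).
  assert (HM : 0 <= M) by (apply rsum_nonneg; intros; apply rsum_nonneg; intros; apply Rabs_pos).
  destruct (archimed_cor1 (eps * (1 - q) / (M + 1))) as (n & Hn1 & Hn2).
  { apply Rdiv_lt_0_compat; [apply Rmult_lt_0_compat|]; lra. }
  (* Partial sum of -ln (1 - tau): each of its terms is a positive kernel, and [n] was chosen so
     that the tail is at most eps / (M + 1) for every pair. *)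
  set (T := fun j k => rsum n (fun l => tau j k ^ S l / INR (S l))).
  assert (HT : dsum N (fun j k => A j k * - T j k) <= 0).
  { rewrite (dsum_ext N _ (fun j k => rsum n (fun l =>
       - (q ^ S l / INR (S l)) * (A j k * sg j k ^ S l)))).
    - rewrite dsum_rsum.
      replace 0 with (rsum n (fun _ => 0)) by (apply rsum_0; auto).
      apply rsum_le. intros l _. rewrite dsum_scal.
      assert (G := gram_power_pos N s1 s2 s3 (S l) x). cbv beta in G.
      change (0 <= dsum N (fun j k => A j k * sg j k ^ S l)) in G.
      assert (0 <= q ^ S l / INR (S l)).
      { apply Rdiv_le_0_compat; [apply pow_le; lra|apply lt_0_INR; lia]. }
      nra.
    - intros j k _ _. unfold T.
      replace (A j k * - rsum n (fun l => tau j k ^ S l / INR (S l))) with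
        (- A j k * rsum n (fun l => tau j k ^ S l / INR (S l))) by ring.
      rewrite <- rsum_scal. apply rsum_ext. intros l _. unfold tau. rewrite Rpow_mult_distr.
      unfold Rdiv. ring. }
  assert (Hrem : forall j k, Rabs (ln (1 - tau j k) + T j k) <= eps / (M + 1)).
  { intros j k. assert (B := Htau j k).
    assert (L := ln_taylor (RtoC (tau j k)) n). rewrite Cmod_R in L. specialize (L ltac:(lra)).
    rewrite <- RtoC_minus, Cmod_R, pow2_abs in L.
    apply Rabs_le_between in B.
    replace (ln ((1 - tau j k) ^ 2)) with (2 * ln (1 - tau j k)) in L.
    2:{ simpl. rewrite Rmult_1_r, ln_mult by lra. ring. }
    rewrite (rsum_ext n _ (fun l => tau j k ^ S l / INR (S l))) in L.
    2:{ intros l _. now rewrite <- RtoC_pow. }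
    fold (T j k) in L. rewrite <- Rmult_plus_distr_l, Rabs_mult, (Rabs_pos_eq 2) in L by lra.
    assert (B2 := Htau j k).
    set (m := Rabs (tau j k)) in *. assert (Hm : 0 <= m) by apply Rabs_pos.
    assert (P : m ^ S n <= 1) by (rewrite <- (pow1 (S n)); apply pow_incr; lra).
    assert (P0 : 0 <= m ^ S n) by now apply pow_le.
    assert (HS : 0 < INR n) by (apply lt_0_INR; lia).
    assert (HSn : INR (S n) = INR n + 1) by apply S_INR.
    assert (Q : / (INR (S n) * (1 - m)) <= / (INR n * (1 - q))).
    { apply Rinv_le_contravar; [apply Rmult_lt_0_compat; lra|].
      apply Rmult_le_compat; lra. }
    assert (Q1 : / (INR n * (1 - q)) <= eps / (M + 1)).
    { rewrite Rinv_mult. apply Rmult_le_reg_r with (1 - q); [lra|].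
      rewrite Rmult_assoc, Rinv_l, Rmult_1_r by lra.
      left. eapply Rlt_le_trans; [exact Hn1|]. right. field. lra. }
    assert (Q0 : 0 < / (INR (S n) * (1 - m))).
    { apply Rinv_0_lt_compat, Rmult_lt_0_compat; lra. }
    unfold Rdiv in L. nra. }
  replace (dsum N (fun j k => A j k * ln (1 - tau j k))) with
    (dsum N (fun j k => A j k * - T j k) + dsum N (fun j k => A j k * (ln (1 - tau j k) + T j k))).
  2:{ rewrite <- dsum_plus. apply dsum_ext. intros; ring. }
  assert (Hfin : dsum N (fun j k => A j k * (ln (1 - tau j k) + T j k)) <= eps).
  { apply Rle_trans with (dsum N (fun j k => eps / (M + 1) * Rabs (A j k))).
    - apply dsum_le. intros j k _ _. eapply Rle_trans; [apply Rle_abs|].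
      rewrite Rabs_mult, Rmult_comm. apply Rmult_le_compat_r; [apply Rabs_pos|auto].
    - rewrite dsum_scal. fold M. apply Rmult_le_reg_r with (M + 1); [lra|].
      replace (eps / (M + 1) * M * (M + 1)) with (eps * M) by (field; lra). nra. }
  lra.
Qed.

(** * The difference kernel of a polynomial *)

(** Truncation of z / f(z) without its linear term, with [a m] standing for b_(m + 2). The
    coefficient b_1 translates the curve w = 1 / f(z) and cancels from z g(v) - v g(z). *)
Definition gpoly (n : nat) (a : nat -> C) (z : C) : C :=
  (1 + csum n (fun m => a m * z ^ (S (S m))))%C.

(* qpoly z v = (z g(v) - v g(z)) / (z - v) for g = gpoly; see [qpoly_spec]. *)
Definition qpoly (n : nat) (a : nat -> C) (z v : C) : C :=
  (1 - csum n (fun m => a m * csum (S m) (fun i => z ^ S i * v ^ S (m - i))))%C.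

(* The partial derivative of qpoly in z is - v * dqpoly z v. *)
Definition dqpoly (n : nat) (a : nat -> C) (z v : C) : C :=
  csum n (fun m => a m * csum (S m) (fun i => RtoC (INR (S i)) * (z ^ i * v ^ (m - i))))%C.

Lemma power_difference (z v : C) (m : nat) :
  ((z - v) * csum (S m) (fun i => z ^ S i * v ^ S (m - i)))%C = (z * v * (z ^ S m - v ^ S m))%C.
Proof.
  induction m as [|m IH]; [simpl; ring|].
  change (csum (S (S m)) (fun i => z ^ S i * v ^ S (S m - i))%C)
    with (csum (S m) (fun i => z ^ S i * v ^ S (S m - i)) + z ^ S (S m) * v ^ S (S m - S m))%C.
  rewrite (csum_ext (S m) _ (fun i => v * (z ^ S i * v ^ S (m - i)))%C).
  - rewrite csum_scal, Cmult_plus_distr_l, Nat.sub_diag.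
    replace ((z - v) * (v * csum (S m) (fun j => z ^ S j * v ^ S (m - j))))%C
      with (v * ((z - v) * csum (S m) (fun j => z ^ S j * v ^ S (m - j))))%C by ring.
    rewrite IH, !Cpow_S. simpl. ring.
  - intros i Hi. replace (S m - i)%nat with (S (m - i)) by lia. rewrite !Cpow_S. ring.
Qed.

Lemma qpoly_spec (n : nat) (a : nat -> C) (z v : C) :
  (z * gpoly n a v - v * gpoly n a z)%C = ((z - v) * qpoly n a z v)%C.
Proof.
  unfold gpoly, qpoly.
  replace (z * (1 + csum n (fun m => a m * v ^ S (S m))) - v * (1 + csum n (fun m => a m * z ^ S (S m))))%C
    with ((z - v) + (z * csum n (fun m => a m * v ^ S (S m)) - v * csum n (fun m => a m * z ^ S (S m))))%C
    by ring.
  rewrite <- !csum_scal, <- csum_minus.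
  rewrite (csum_ext n _ (fun m => (v - z) * (a m * csum (S m) (fun i => z ^ S i * v ^ S (m - i))))%C).
  - rewrite csum_scal. ring.
  - intros m _.
    replace ((v - z) * (a m * csum (S m) (fun i => z ^ S i * v ^ S (m - i))))%C
      with (- (a m * ((z - v) * csum (S m) (fun i => z ^ S i * v ^ S (m - i)))))%C by ring.
    rewrite power_difference, !Cpow_S. ring.
Qed.

Lemma taylor_opp {I : Type} (U : I -> Prop) (p : I -> C -> C) :
  taylor U p -> taylor U (fun i x => - p i x)%C.
Proof.
  intros (p' & K & HK & Hp). exists (fun i x => - p' i x)%C, K. split; auto.
  intros i x y Hi Hx Hy. destruct (Hp i x y Hi Hx Hy) as (A & B & D).
  rewrite !Cmod_opp. repeat split; auto.
  replace (- p i y - - p i x - - p' i x * (y - x))%C with (- (p i y - p i x - p' i x * (y - x)))%C by ring.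
  now rewrite Cmod_opp.
Qed.

Lemma taylor_scal {I : Type} (U : I -> Prop) (c : C) (p : I -> C -> C) :
  taylor U p -> taylor U (fun i x => c * p i x)%C.
Proof.
  intros H. apply (taylor_mult U (fun _ _ => c)); auto.
  apply (taylor_const U (fun _ => c) (Cmod c)). intros; lra.
Qed.

Lemma taylor_one {I : Type} (U : I -> Prop) : taylor U (fun _ _ => RtoC 1).
Proof. apply (taylor_const U (fun _ => RtoC 1) 1). intros; rewrite Cmod_1; lra. Qed.

Lemma taylor_gpoly {I : Type} (U : I -> Prop) (n : nat) (a : nat -> C) (A : I -> C -> C) :
  taylor U A -> taylor U (fun i x => gpoly n a (A i x)).
Proof.
  intros HA. unfold gpoly. apply taylor_plus; [apply taylor_one|].
  apply (taylor_csum U (fun m i x => a m * A i x ^ S (S m))%C).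
  intros m. now apply taylor_scal, taylor_pow.
Qed.

Lemma taylor_qpoly {I : Type} (U : I -> Prop) (n : nat) (a : nat -> C) (A B : I -> C -> C) :
  taylor U A -> taylor U B -> taylor U (fun i x => qpoly n a (A i x) (B i x)).
Proof.
  intros HA HB. unfold qpoly, Cminus. apply taylor_plus; [apply taylor_one|].
  apply taylor_opp.
  apply (taylor_csum U (fun m i x => a m * csum (S m) (fun l => A i x ^ S l * B i x ^ S (m - l)))%C).
  intros m. apply taylor_scal.
  apply (taylor_csum U (fun l i x => A i x ^ S l * B i x ^ S (m - l))%C).
  intros l. now apply taylor_mult; apply taylor_pow.
Qed.

Lemma taylor_dqpoly {I : Type} (U : I -> Prop) (n : nat) (a : nat -> C) (A B : I -> C -> C) :
  taylor U A -> taylor U B -> taylor U (fun i x => dqpoly n a (A i x) (B i x)).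
Proof.
  intros HA HB. unfold dqpoly.
  apply (taylor_csum U (fun m i x => a m * csum (S m) (fun l => RtoC (INR (S l)) * (A i x ^ l * B i x ^ (m - l))))%C).
  intros m. apply taylor_scal.
  apply (taylor_csum U (fun l i x => RtoC (INR (S l)) * (A i x ^ l * B i x ^ (m - l)))%C).
  intros l. apply taylor_scal. now apply taylor_mult; apply taylor_pow.
Qed.

Lemma Cpow_0_S (n : nat) : (RtoC 0 ^ S n)%C = RtoC 0.
Proof. rewrite Cpow_S. ring. Qed.

Lemma qpoly_0_l (n : nat) (a : nat -> C) (v : C) : qpoly n a (RtoC 0) v = RtoC 1.
Proof.
  unfold qpoly. rewrite csum_0; [ring|]. intros m _. rewrite csum_0; [ring|].
  intros i _. rewrite Cpow_0_S. ring.
Qed.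

Lemma qpoly_0_r (n : nat) (a : nat -> C) (z : C) : qpoly n a z (RtoC 0) = RtoC 1.
Proof.
  unfold qpoly. rewrite csum_0; [ring|]. intros m _. rewrite csum_0; [ring|].
  intros i _. rewrite Cpow_0_S. ring.
Qed.

Lemma dqpoly_0_l (n : nat) (a : nat -> C) (v : C) :
  dqpoly n a (RtoC 0) v = csum n (fun m => a m * v ^ m)%C.
Proof.
  apply csum_ext. intros m _. rewrite csum_S_l, (csum_0 m).
  - rewrite Nat.sub_0_r. simpl. ring.
  - intros i _. rewrite Cpow_0_S. ring.
Qed.

(** Only i = m survives, with weight m + 1, whereas at z = 0 only i = 0 survives, with weight 1.
    These are the values at the centre that the mean value property extracts in either variable. *)
Lemma dqpoly_0_r (n : nat) (a : nat -> C) (z : C) :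
  dqpoly n a z (RtoC 0) = csum n (fun m => RtoC (INR (S m)) * a m * z ^ m)%C.
Proof.
  apply csum_ext. intros m _.
  change (csum (S m) (fun i => INR (S i) * (z ^ i * 0 ^ (m - i)))%C)
    with (csum m (fun i => INR (S i) * (z ^ i * 0 ^ (m - i))) + INR (S m) * (z ^ m * 0 ^ (m - m)))%C.
  rewrite (csum_0 m), Nat.sub_diag.
  - simpl (RtoC 0 ^ 0)%C. ring.
  - intros i Hi. replace (m - i)%nat with (S (m - S i)) by lia. rewrite Cpow_0_S. ring.
Qed.

(** Componentwise, so that the calculus of real functions applies. The real parameter will be the
    radius along which q is contracted to its value 1 at the origin. *)
Definition is_cderive (phi : R -> C) (r : R) (l : C) : Prop :=
  is_derive (fun t : R => Re (phi t)) r (Re l) /\ is_derive (fun t : R => Im (phi t)) r (Im l).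

Lemma is_cderive_const (c : C) (r : R) : is_cderive (fun _ => c) r (RtoC 0).
Proof. split; apply @is_derive_const. Qed.

Lemma is_cderive_plus (phi psi : R -> C) (r : R) (l k : C) :
  is_cderive phi r l -> is_cderive psi r k -> is_cderive (fun t => phi t + psi t)%C r (l + k)%C.
Proof. intros (A & B) (D & E). split; now apply @is_derive_plus. Qed.

Lemma is_cderive_opp (phi : R -> C) (r : R) (l : C) :
  is_cderive phi r l -> is_cderive (fun t => - phi t)%C r (- l)%C.
Proof. intros (A & B). split; now apply @is_derive_opp. Qed.

Lemma is_cderive_csum (n : nat) (phi : nat -> R -> C) (r : R) (l : nat -> C) :
  (forall j, is_cderive (phi j) r (l j)) ->
  is_cderive (fun t => csum n (fun j => phi j t)) r (csum n l).
Proof.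
  intros H. induction n as [|n IH]; simpl; [apply is_cderive_const|now apply is_cderive_plus].
Qed.

Lemma is_cderive_monomial (c : C) (i : nat) (r : R) :
  is_cderive (fun t => c * RtoC (t ^ S i))%C r (c * RtoC (INR (S i) * r ^ i))%C.
Proof.
  destruct c as [x y]. split.
  - apply is_derive_ext with (fun t : R => x * t ^ S i); [intros; simpl; ring|].
    replace (Re ((x, y) * RtoC (INR (S i) * r ^ i))%C) with (x * (INR (S i) * r ^ i)) by (now rewrite re_scal_r).
    auto_derive; auto. change (match i with O => 1 | S _ => INR i + 1 end) with (INR (S i)). ring.
  - apply is_derive_ext with (fun t : R => y * t ^ S i); [intros; simpl; ring|].
    replace (Im ((x, y) * RtoC (INR (S i) * r ^ i))%C) with (y * (INR (S i) * r ^ i)) by (now rewrite im_scal_r).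
    auto_derive; auto. change (match i with O => 1 | S _ => INR i + 1 end) with (INR (S i)). ring.
Qed.

Lemma is_cderive_eq (phi : R -> C) (r : R) (l k : C) :
  is_cderive phi r l -> l = k -> is_cderive phi r k.
Proof. now intros H <-. Qed.

Lemma is_cderive_ext (phi psi : R -> C) (r : R) (l : C) :
  (forall t, phi t = psi t) -> is_cderive phi r l -> is_cderive psi r l.
Proof.
  intros E (A & B). split.
  - apply is_derive_ext with (fun t : R => Re (phi t)); auto. intros t. now rewrite E.
  - apply is_derive_ext with (fun t : R => Im (phi t)); auto. intros t. now rewrite E.
Qed.

Lemma is_cderive_qpoly (n : nat) (a : nat -> C) (z v : C) (r : R) :
  is_cderive (fun t => qpoly n a (t * z)%C v) r (- (z * v * dqpoly n a (r * z)%C v))%C.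
Proof.
  unfold qpoly, Cminus. eapply is_cderive_eq.
  - apply is_cderive_plus; [apply is_cderive_const|]. apply is_cderive_opp.
    apply (is_cderive_csum n (fun m t => a m * csum (S m) (fun i => (t * z) ^ S i * v ^ S (m - i)))%C r
      (fun m => csum (S m) (fun i => (a m * (z ^ S i * v ^ S (m - i))) * RtoC (INR (S i) * r ^ i)))%C).
    intros m.
    apply is_cderive_ext with (fun t => csum (S m) (fun i => (a m * (z ^ S i * v ^ S (m - i))) * RtoC (t ^ S i)))%C.
    + intros t. rewrite <- csum_scal. apply csum_ext. intros i _.
      rewrite Cpow_mult_l, RtoC_pow. ring.
    + apply is_cderive_csum. intros i. apply is_cderive_monomial.
  - unfold dqpoly. rewrite Cplus_0_l. f_equal. rewrite <- csum_scal. apply csum_ext. intros m _.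
    rewrite <- !csum_scal. apply csum_ext. intros i _.
    rewrite Cpow_mult_l, RtoC_mult, RtoC_pow, !Cpow_S. ring.
Qed.

Lemma is_derive_ln_Cmod_sqr (phi : R -> C) (r : R) (l : C) :
  is_cderive phi r l -> phi r <> RtoC 0 ->
  is_derive (fun t : R => ln (Cmod (phi t) ^ 2)) r (2 * Re (l / phi r)%C).
Proof.
  intros (A & B) Hne.
  assert (Hpos : 0 < Cmod (phi r)) by now apply Cmod_gt_0.
  assert (Hsq : 0 < Re (phi r) ^ 2 + Im (phi r) ^ 2) by (rewrite <- Cmod_sqr; now apply pow_lt).
  apply is_derive_ext with (fun t : R => ln (Re (phi t) ^ 2 + Im (phi t) ^ 2)).
  { intros t. now rewrite <- Cmod_sqr. }
  replace (2 * Re (l / phi r)%C) with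
    ((2 * Re (phi r) * Re l + 2 * Im (phi r) * Im l) * / (Re (phi r) ^ 2 + Im (phi r) ^ 2)).
  - apply (is_derive_comp ln (fun t : R => Re (phi t) ^ 2 + Im (phi t) ^ 2)).
    + auto_derive; lra.
    + apply @is_derive_plus.
      * replace (2 * Re (phi r) * Re l) with (INR 2 * Re l * Re (phi r) ^ pred 2) by (simpl; ring).
        now apply is_derive_pow.
      * replace (2 * Im (phi r) * Im l) with (INR 2 * Im l * Im (phi r) ^ pred 2) by (simpl; ring).
        now apply is_derive_pow.
  - destruct l as [x y], (phi r) as [u w]. simpl in *. field. nra.
Qed.

(** * Fourier coefficients of the charge at the roots of unity *)

Lemma root_orthogonality (N a b : nat) (w : C) :
  primitive_root N w -> (a < N)%nat -> (b < N)%nat ->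
  csum N (fun j => Cconj (w ^ j) ^ a * (w ^ j) ^ b)%C
  = if Nat.eq_dec a b then RtoC (INR N) else RtoC 0.
Proof.
  intros Hw Ha Hb.
  assert (U : forall j, (Cconj (w ^ j) * w ^ j)%C = RtoC 1).
  { intros j. apply conj_mult_unit, Cmod_pow_unit, Hw. }
  assert (G : forall c d, (c < d)%nat -> (d < N)%nat ->
     csum N (fun j => Cconj (w ^ j) ^ c * (w ^ j) ^ d)%C = RtoC 0).
  { intros c d Hcd Hd. rewrite <- (primitive_root_sum N (d - c) w Hw) by lia.
    apply csum_ext. intros j _. replace d with (c + (d - c))%nat at 1 by lia.
    rewrite Cpow_add_r, Cmult_assoc, <- Cpow_mult_l, U, Cpow_1_l. ring. }
  destruct (Nat.eq_dec a b) as [->|Hne].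
  - rewrite (csum_ext N _ (fun _ => RtoC 1)), csum_const; [ring|].
    intros j _. now rewrite <- Cpow_mult_l, U, Cpow_1_l.
  - destruct (Nat.lt_ge_cases a b) as [H|H]; [now apply G|].
    rewrite <- (Cconj_conj (csum N _)), csum_conj.
    rewrite (csum_ext N _ (fun j => Cconj (w ^ j) ^ b * (w ^ j) ^ a)%C).
    + rewrite G by lia. apply injective_projections; simpl; ring.
    + intros j _. rewrite Cmult_conj, !Cpow_conj, Cconj_conj. ring.
Qed.

(** This is g - z g' for g = [gpoly], and on the unit circle it is z times [charge]. Being a
    polynomial in z, without the conjugate in [charge], it can enter the mean value property. *)
Definition charge_num (n : nat) (a : nat -> C) (z : C) : C :=
  (1 - csum n (fun m => RtoC (INR (S m)) * a m * z ^ S (S m)))%C.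

(* On the unit circle this is z d/dz of -(gpoly z / z): the charge dw on the curve w = gpoly z / z. *)
Definition charge (n : nat) (a : nat -> C) (z : C) : C := (Cconj z * charge_num n a z)%C.

(** The sum of the area theorem: the weight m + 1 is n - 1 for n = m + 2. *)
Definition energy (n : nat) (a : nat -> C) : R := rsum n (fun m => INR (S m) * Cmod (a m) ^ 2).

Lemma csum_single (n l : nat) (f : nat -> C) (c : C) :
  csum n (fun m => f m * (if Nat.eq_dec l m then c else RtoC 0))%C
  = if Compare_dec.lt_dec l n then (f l * c)%C else RtoC 0.
Proof.
  induction n as [|n IH]; [reflexivity|]. simpl. rewrite IH.
  destruct (Compare_dec.lt_dec l n), (Compare_dec.lt_dec l (S n)), (Nat.eq_dec l n); subst; try lia; ring.
Qed.

Lemma charge_unit (n : nat) (a : nat -> C) (z : C) : Cmod z = 1 ->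
  charge n a z = (Cconj z - csum n (fun m => RtoC (INR (S m)) * a m * z ^ S m))%C.
Proof.
  intros Hz. unfold charge, charge_num.
  replace (Cconj z * (1 - csum n (fun m => INR (S m) * a m * z ^ S (S m))))%C with
    (Cconj z - Cconj z * csum n (fun m => INR (S m) * a m * z ^ S (S m)))%C by ring.
  rewrite <- csum_scal. f_equal. apply csum_ext. intros m _.
  rewrite (Cpow_S z (S m)).
  replace (Cconj z * (INR (S m) * a m * (z * z ^ S m)))%C
    with ((Cconj z * z) * (INR (S m) * a m * z ^ S m))%C by ring.
  rewrite conj_mult_unit by auto. ring.
Qed.

(** On the circle the charge is z^-1 - sum (m + 1) a_m z^(m + 1), so pairing it with z^l picks the
    coefficient of z^-l. The bound on l + n keeps all exponents below N, which excludes aliasing. *)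
Lemma charge_fourier_pos (N n l : nat) (a : nat -> C) (w : C) :
  primitive_root N w -> (l + n + 1 < N)%nat ->
  csum N (fun j => charge n a (w ^ j) * (w ^ j) ^ l)%C
  = if Nat.eq_dec 1 l then RtoC (INR N) else RtoC 0.
Proof.
  intros Hw Hl.
  rewrite (csum_ext N _ (fun j => Cconj (w ^ j) ^ 1 * (w ^ j) ^ l -
     csum n (fun m => INR (S m) * a m * (Cconj (w ^ j) ^ 0 * (w ^ j) ^ (S m + l))))%C).
  2:{ intros j _. rewrite charge_unit by apply Cmod_pow_unit, Hw.
      rewrite Cpow_1_r. unfold Cminus. rewrite Cmult_plus_distr_r. f_equal.
      replace (- csum n (fun m => INR (S m) * a m * (w ^ j) ^ S m) * (w ^ j) ^ l)%C
        with (- ((w ^ j) ^ l * csum n (fun m => INR (S m) * a m * (w ^ j) ^ S m)))%C by ring.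
      rewrite <- csum_scal. f_equal. apply csum_ext. intros m _.
      rewrite Cpow_add_r. simpl (Cconj (w ^ j) ^ 0)%C. ring. }
  rewrite csum_minus, csum_switch, root_orthogonality by (auto; lia).
  rewrite (csum_0 n); [ring|].
  intros m Hm. rewrite csum_scal, root_orthogonality by (auto; lia).
  destruct (Nat.eq_dec 0 (S m + l)); [lia|ring].
Qed.

(** Picks the coefficient of z^(l + 1); the term z^-1 would contribute only if N divided l + 2. *)
Lemma charge_fourier_neg (N n l : nat) (a : nat -> C) (w : C) :
  primitive_root N w -> (l + 2 < N)%nat -> (n + 2 < N)%nat ->
  csum N (fun j => charge n a (w ^ j) * Cconj (w ^ j) ^ S l)%C
  = if Compare_dec.lt_dec l n then (- (INR (S l) * a l * INR N))%C else RtoC 0.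
Proof.
  intros Hw Hl Hn.
  rewrite (csum_ext N _ (fun j => Cconj (w ^ j) ^ (S (S l)) * (w ^ j) ^ 0 -
     csum n (fun m => INR (S m) * a m * (Cconj (w ^ j) ^ (S l) * (w ^ j) ^ (S m))))%C).
  2:{ intros j _. rewrite charge_unit by apply Cmod_pow_unit, Hw.
      rewrite (Cpow_S _ (S l)). unfold Cminus. rewrite Cmult_plus_distr_r. f_equal.
      { simpl ((w ^ j) ^ 0)%C. ring. }
      replace (- csum n (fun m => INR (S m) * a m * (w ^ j) ^ S m) * Cconj (w ^ j) ^ S l)%C
        with (- (Cconj (w ^ j) ^ S l * csum n (fun m => INR (S m) * a m * (w ^ j) ^ S m)))%C by ring.
      rewrite <- csum_scal. f_equal. apply csum_ext. intros m _. ring. }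
  rewrite csum_minus, csum_switch, root_orthogonality by (auto; lia).
  destruct (Nat.eq_dec (S (S l)) 0); [lia|].
  rewrite (csum_ext n _ (fun m => (INR (S m) * a m) * (if Nat.eq_dec l m then RtoC (INR N) else RtoC 0))%C).
  - rewrite (csum_single n l (fun m => INR (S m) * a m)%C). destruct (Compare_dec.lt_dec l n); ring.
  - intros m Hm. rewrite csum_scal, root_orthogonality by (auto; lia). f_equal.
    destruct (Nat.eq_dec (S l) (S m)), (Nat.eq_dec l m); auto; lia.
Qed.

(** The Laurent polynomial of the charge has no constant term. This is the discrete form of dw
    having integral 0 over a closed curve, and it holds exactly, as the energy inequality
    requires. *)
Lemma charge_sum (N n : nat) (a : nat -> C) (w : C) :
  primitive_root N w -> (n + 2 < N)%nat -> csum N (fun j => charge n a (w ^ j)%C) = RtoC 0.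
Proof.
  intros Hw Hn. assert (A := charge_fourier_pos N n 0 a w Hw ltac:(lia)).
  simpl (Nat.eq_dec 1 0) in A. rewrite <- A.
  apply csum_ext. intros j _. simpl. ring.
Qed.

(** * Contribution of the difference kernel to the energy *)

Lemma taylor_bounded (p : C -> C) : taylor (fun _ : unit => True) (fun _ => p) ->
  exists B, 0 <= B /\ forall x, Cmod x <= 1 -> Cmod (p x) <= B.
Proof.
  intros (p' & K & HK & Hp). exists K. split; auto. intros x Hx. now apply (Hp tt x x).
Qed.

Lemma taylor_charge_num {I : Type} (U : I -> Prop) (n : nat) (a : nat -> C) :
  taylor U (fun _ x => charge_num n a x).
Proof.
  unfold charge_num, Cminus. apply taylor_plus; [apply taylor_one|]. apply taylor_opp.
  apply (taylor_csum U (fun m i x => INR (S m) * a m * x ^ S (S m))%C).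
  intros m. apply taylor_scal. apply (taylor_pow U (fun _ x => x)), taylor_id.
Qed.

Lemma charge_num_0 (n : nat) (a : nat -> C) : charge_num n a (RtoC 0) = RtoC 1.
Proof.
  unfold charge_num. rewrite csum_0; [ring|]. intros m _. rewrite Cpow_0_S. ring.
Qed.

Lemma Cmod_charge (n : nat) (a : nat -> C) (z : C) :
  Cmod z = 1 -> Cmod (charge n a z) = Cmod (charge_num n a z).
Proof. intros H. unfold charge. rewrite Cmod_mult, Cmod_conj, H. ring. Qed.

(** Times v, this is the logarithmic derivative of q in z. The factor v is kept apart because,
    multiplied by the charge at v, it gives the polynomial [charge_num]. *)
Definition logder (n : nat) (a : nat -> C) (z v : C) : C :=
  (- dqpoly n a z v / qpoly n a z v)%C.

(** For fixed r and v the summand is analytic in the root, since q stays away from 0, and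
    [dqpoly_0_l] gives its value at the centre. The error [B] is uniform in r and v, which permits
    the second summation. *)
Lemma logder_mean_z (n : nat) (a : nat -> C) (d : R) : 0 < d ->
  (forall z v, Cmod z <= 1 -> Cmod v <= 1 -> d <= Cmod (qpoly n a z v)) ->
  exists B, 0 <= B /\ forall N w r v, (1 < N)%nat -> primitive_root N w -> Rabs r <= 1 -> Cmod v <= 1 ->
    Cmod (csum N (fun j => charge_num n a (w ^ j) * logder n a (r * w ^ j) v)
          + INR N * csum n (fun m => a m * v ^ m))%C <= B.
Proof.
  intros Hd Hq. set (U := fun i : R * C => Rabs (fst i) <= 1 /\ Cmod (snd i) <= 1).
  assert (Hin : forall i x, U i -> Cmod x <= 1 -> Cmod (RtoC (fst i) * x)%C <= 1).
  { intros [r v] x [Hr _] Hx; simpl in *. rewrite <- (Rmult_1_r 1).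
    apply Cmod_mult_le; auto. now rewrite Cmod_R. }
  assert (TA : taylor U (fun i x => RtoC (fst i) * x)%C).
  { apply taylor_mult; [|apply taylor_id].
    apply (taylor_const U (fun i => RtoC (fst i)) 1). intros i [Hr _]. now rewrite Cmod_R. }
  assert (TB : taylor U (fun i _ => snd i)).
  { apply (taylor_const U (fun i => snd i) 1). intros i [_ Hv]. exact Hv. }
  destruct (discrete_mean_value U
    (fun i x => charge_num n a x * (- dqpoly n a (RtoC (fst i) * x)%C (snd i)
                                    * / qpoly n a (RtoC (fst i) * x)%C (snd i)))%C) as (B & HB & H).
  { apply taylor_mult; [apply taylor_charge_num|]. apply taylor_mult.
    - apply taylor_opp. now apply taylor_dqpoly.
    - apply (taylor_inv U (fun i x => qpoly n a (RtoC (fst i) * x)%C (snd i)) d Hd).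
      + intros i x Hi Hx. apply Hq; [now apply Hin|apply Hi].
      + now apply taylor_qpoly. }
  exists B. split; auto. intros N w r v HN Hw Hr Hv.
  specialize (H N w (r, v) HN Hw (conj Hr Hv)). simpl in H.
  replace (r * 0)%C with (RtoC 0) in H by ring.
  rewrite qpoly_0_l, charge_num_0, dqpoly_0_l in H.
  eapply Rle_trans; [right|exact H]. f_equal. unfold logder, Cdiv. field.
Qed.

Lemma logder_mean_v (n : nat) (a : nat -> C) (d : R) : 0 < d ->
  (forall z v, Cmod z <= 1 -> Cmod v <= 1 -> d <= Cmod (qpoly n a z v)) ->
  exists B, 0 <= B /\ forall N w z, (1 < N)%nat -> primitive_root N w -> Cmod z <= 1 ->
    Cmod (csum N (fun k => charge_num n a (w ^ k) * logder n a z (w ^ k)%C)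
          + INR N * csum n (fun m => RtoC (INR (S m)) * a m * z ^ m))%C <= B.
Proof.
  intros Hd Hq. set (U := fun z : C => Cmod z <= 1).
  assert (TA : taylor U (fun z _ => z)).
  { apply (taylor_const U (fun z => z) 1). auto. }
  assert (TB : taylor U (fun _ x => x)) by apply taylor_id.
  destruct (discrete_mean_value U
    (fun z x => charge_num n a x * (- dqpoly n a z x * / qpoly n a z x))%C) as (B & HB & H).
  { apply taylor_mult; [apply taylor_charge_num|]. apply taylor_mult.
    - apply taylor_opp. now apply (taylor_dqpoly U n a (fun z _ => z) (fun _ x => x)).
    - apply (taylor_inv U (fun z x => qpoly n a z x) d Hd).
      + intros i x Hi Hx. now apply Hq.
      + now apply (taylor_qpoly U n a (fun z _ => z) (fun _ x => x)). }
  exists B. split; auto. intros N w z HN Hw Hz.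
  specialize (H N w z HN Hw Hz).
  rewrite qpoly_0_r, charge_num_0, dqpoly_0_r in H.
  eapply Rle_trans; [right|exact H]. f_equal. unfold logder, Cdiv. field.
Qed.

(** Trades a product of real parts for two real parts of products. In [potential_derivative] one of
    them is averaged in the first variable and the other, after conjugation, in the second. *)
Lemma two_Re_Re (x y : C) : 2 * (Re x * Re y) = Re (x * y)%C + Re (x * Cconj y)%C.
Proof. destruct x, y. simpl. ring. Qed.

Lemma dsum_Re_l (N : nat) (f : nat -> nat -> C) (g : nat -> C) :
  dsum N (fun j k => Re (f j k * g k)%C) = Re (csum N (fun k => g k * csum N (fun j => f j k)))%C.
Proof.
  unfold dsum. rewrite rsum_switch, Re_csum. apply rsum_ext. intros k _.
  rewrite <- csum_scal, Re_csum. apply rsum_ext. intros j _. f_equal. ring.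
Qed.

Lemma dsum_Re_r (N : nat) (f : nat -> nat -> C) (g : nat -> C) :
  dsum N (fun j k => Re (g j * f j k)%C) = Re (csum N (fun j => g j * csum N (f j)))%C.
Proof.
  unfold dsum. rewrite Re_csum. apply rsum_ext. intros k _.
  now rewrite <- csum_scal, Re_csum.
Qed.

Lemma Cmod_csum_mult (N : nat) (f g : nat -> C) (A B : R) :
  (forall j, (j < N)%nat -> Cmod (f j) <= A) -> (forall j, (j < N)%nat -> Cmod (g j) <= B) ->
  Cmod (csum N (fun j => f j * g j)%C) <= INR N * (A * B).
Proof.
  intros HA HB. eapply Rle_trans; [apply Cmod_csum|]. apply rsum_le_const.
  intros j Hj. apply Cmod_mult_le; auto.
Qed.

(** What remains after averaging in z: the coefficient a_m of the average meets the conjugate of the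
    Fourier coefficient -(m + 1) a_m of the charge, which yields (m + 1) |a_m|^2. *)
Lemma charge_num_pairing_z (N n : nat) (a : nat -> C) (w : C) :
  primitive_root N w -> (n + 2 < N)%nat ->
  Re (csum N (fun k => (Cconj (charge n a (w ^ k)) * w ^ k) *
        (- (INR N * csum n (fun m => a m * (w ^ k) ^ m))))%C) = INR N ^ 2 * energy n a.
Proof.
  intros Hw Hn.
  rewrite (csum_ext N _ (fun k => csum n (fun m => - INR N * a m *
      Cconj (charge n a (w ^ k) * Cconj (w ^ k) ^ S m)))%C).
  - rewrite csum_switch.
    rewrite (csum_ext n _ (fun m => RtoC (INR N ^ 2 * (INR (S m) * Cmod (a m) ^ 2)))).
    + rewrite csum_RtoC, rsum_scal. reflexivity.
    + intros m Hm. rewrite csum_scal, <- csum_conj, charge_fourier_neg by (auto; lia).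
      destruct (Compare_dec.lt_dec m n); [|lia].
      rewrite !RtoC_mult, Cmod2_conj, Copp_conj, !Cmult_conj.
      replace (Cconj (INR (S m))) with (RtoC (INR (S m))) by (apply injective_projections; simpl; ring).
      replace (Cconj (INR N)) with (RtoC (INR N)) by (apply injective_projections; simpl; ring).
      rewrite RtoC_pow. ring.
  - intros k _.
    replace ((Cconj (charge n a (w ^ k)) * w ^ k) * (- (INR N * csum n (fun m => a m * (w ^ k) ^ m))))%C
      with ((- INR N * Cconj (charge n a (w ^ k)) * w ^ k) * csum n (fun m => a m * (w ^ k) ^ m))%C by ring.
    rewrite <- csum_scal. apply csum_ext. intros m _.
    rewrite Cmult_conj, Cpow_conj, Cconj_conj, (Cpow_S (w ^ k)). ring.
Qed.

(** Here the average itself carries the weight m + 1 of [dqpoly_0_r]; integration of r^m over [0, 1]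
    will undo it. *)
Lemma charge_num_pairing_v (N n : nat) (a : nat -> C) (w : C) (r : R) :
  primitive_root N w -> (n + 2 < N)%nat ->
  Re (csum N (fun j => (charge n a (w ^ j) * Cconj (w ^ j)) *
        Cconj (- (INR N * csum n (fun m => INR (S m) * a m * (r * w ^ j) ^ m))))%C)
  = INR N ^ 2 * rsum n (fun m => INR (S m) * Cmod (a m) ^ 2 * (INR (S m) * r ^ m)).
Proof.
  intros Hw Hn.
  assert (HR : forall x : R, Cconj (RtoC x) = RtoC x) by (intros x; apply injective_projections; simpl; ring).
  rewrite (csum_ext N _ (fun j => csum n (fun m => - INR N * (INR (S m) * Cconj (a m) * RtoC (r ^ m)) *
      (charge n a (w ^ j) * Cconj (w ^ j) ^ S m)))%C).
  - rewrite csum_switch.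
    rewrite (csum_ext n _ (fun m => RtoC (INR N ^ 2 * (INR (S m) * Cmod (a m) ^ 2 * (INR (S m) * r ^ m))))).
    + rewrite csum_RtoC, rsum_scal. reflexivity.
    + intros m Hm. rewrite csum_scal, charge_fourier_neg by (auto; lia).
      destruct (Compare_dec.lt_dec m n); [|lia].
      rewrite !RtoC_mult, Cmod2_conj, !RtoC_pow. ring.
  - intros j _. generalize (w ^ j)%C. intros x. rewrite Copp_conj, Cmult_conj, csum_conj, HR.
    replace ((charge n a x * Cconj x) *
        - (INR N * csum n (fun m => Cconj (INR (S m) * a m * (r * x) ^ m))))%C
      with ((- INR N * charge n a x * Cconj x) *
        csum n (fun m => Cconj (INR (S m) * a m * (r * x) ^ m)))%C by ring.
    rewrite <- csum_scal. apply csum_ext. intros m _.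
    rewrite !Cmult_conj, !Cpow_conj, !Cmult_conj, !HR, Cpow_mult_l, (Cpow_S (Cconj x)), RtoC_pow. ring.
Qed.

Lemma unit_disk_scale (r : R) (z : C) : Rabs r <= 1 -> Cmod z <= 1 -> Cmod (r * z)%C <= 1.
Proof. intros Hr Hz. rewrite <- (Rmult_1_r 1). apply Cmod_mult_le; auto. now rewrite Cmod_R. Qed.

(** In each half one inner sum is evaluated by the mean value property up to a constant, and the
    outer sum has N terms with bounded factors. The error is therefore of order N against a main
    term of order N^2. *)
Lemma potential_derivative (n : nat) (a : nat -> C) (d : R) : 0 < d ->
  (forall z v, Cmod z <= 1 -> Cmod v <= 1 -> d <= Cmod (qpoly n a z v)) ->
  exists B, 0 <= B /\ forall N w r, primitive_root N w -> (n + 2 < N)%nat -> Rabs r <= 1 ->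
  Rabs (dsum N (fun j k => Re (charge n a (w ^ j) * Cconj (charge n a (w ^ k)))%C *
           (2 * Re (w ^ j * w ^ k * logder n a (r * w ^ j) (w ^ k))%C))
        - INR N ^ 2 * (energy n a
            + rsum n (fun m => INR (S m) * Cmod (a m) ^ 2 * (INR (S m) * r ^ m)))) <= INR N * B.
Proof.
  intros Hd Hq.
  destruct (logder_mean_z n a d Hd Hq) as (B1 & HB1 & H1).
  destruct (logder_mean_v n a d Hd Hq) as (B2 & HB2 & H2).
  destruct (taylor_bounded (charge_num n a)) as (B0 & HB0 & H0); [apply taylor_charge_num|].
  exists (B0 * B1 + B0 * B2). split.
  { apply Rplus_le_le_0_compat; now apply Rmult_le_pos. }
  intros N w r Hw HN Hr.
  assert (Hu : forall j, Cmod (w ^ j)%C = 1) by (intros; apply Cmod_pow_unit, Hw).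
  assert (Hch : forall j, Cmod (charge n a (w ^ j)%C) <= B0).
  { intros j. rewrite Cmod_charge by auto. apply H0. rewrite Hu. lra. }
  set (Y := fun j => charge n a (w ^ j)%C) in *. set (z := fun j => (w ^ j)%C) in *.
  set (ka := fun j k => logder n a (r * z j) (z k)).
  rewrite (dsum_ext N _ (fun j k => Re ((Y j * z j * ka j k) * (Cconj (Y k) * z k))%C
     + Re ((Y j * Cconj (z j)) * Cconj (Y k * z k * ka j k))%C)).
  2:{ intros j k _ _.
      transitivity (2 * (Re (Y j * Cconj (Y k))%C * Re (z j * z k * ka j k)%C)).
      { unfold Y, ka, z. ring. }
      rewrite two_Re_Re. f_equal; f_equal; [|rewrite !Cmult_conj]; ring. }
  assert (Hcn : forall j, (Y j * z j)%C = charge_num n a (z j)).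
  { intros j. unfold Y, charge. fold (z j).
    replace (Cconj (z j) * charge_num n a (z j) * z j)%C with ((Cconj (z j) * z j) * charge_num n a (z j))%C by ring.
    rewrite conj_mult_unit by apply Hu. ring. }
  rewrite dsum_plus, dsum_Re_l, (dsum_Re_r N (fun j k => Cconj (Y k * z k * ka j k)%C) (fun j => (Y j * Cconj (z j))%C)).
  assert (P1 := charge_num_pairing_z N n a w Hw HN). assert (P2 := charge_num_pairing_v N n a w r Hw HN).
  fold (z) in P1, P2.
  rewrite Rmult_plus_distr_l, <- P1, <- P2.
  set (S1 := csum N (fun k => (Cconj (Y k) * z k * csum N (fun j => Y j * z j * ka j k)))%C).
  set (S2 := csum N (fun j => (Y j * Cconj (z j) * csum N (fun k => Cconj (Y k * z k * ka j k))))%C).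
  match goal with |- Rabs (Re ?x + Re ?y - (Re ?u + Re ?v)) <= _ =>
    replace (Re x + Re y - (Re u + Re v)) with (Re (x - u)%C + Re (y - v)%C)
      by (unfold Cminus; rewrite !re_plus, !re_opp; ring) end.
  unfold S1, S2. rewrite <- !csum_minus.
  eapply Rle_trans; [apply Rabs_triang|]. rewrite Rmult_plus_distr_l.
  apply Rplus_le_compat; (eapply Rle_trans; [apply re_le_Cmod|]).
  - rewrite (csum_ext N _ (fun k => (Cconj (Y k) * z k) *
      (csum N (fun j => charge_num n a (w ^ j) * logder n a (r * w ^ j) (z k))
       + INR N * csum n (fun m => a m * z k ^ m)))%C).
    + apply Cmod_csum_mult.
      * intros k _. rewrite Cmod_mult, Cmod_conj, (Hu k), Rmult_1_r. apply Hch.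
      * intros k _. apply H1; auto; [lia|]. unfold z. rewrite Hu. lra.
    + intros k _. rewrite (csum_ext N (fun j => Y j * z j * ka j k)%C
        (fun j => charge_num n a (w ^ j) * logder n a (r * w ^ j) (z k))%C).
      * unfold Y, z. ring.
      * intros j _. now rewrite Hcn.
  - rewrite (csum_ext N _ (fun j => (Y j * Cconj (z j)) *
      Cconj (csum N (fun k => charge_num n a (w ^ k) * logder n a (r * z j) (w ^ k)%C)
       + INR N * csum n (fun m => INR (S m) * a m * (r * z j) ^ m)))%C).
    + apply Cmod_csum_mult.
      * intros k _. rewrite Cmod_mult, Cmod_conj, (Hu k), Rmult_1_r. apply Hch.
      * intros k _. rewrite Cmod_conj. apply H2; auto; [lia|].
        apply unit_disk_scale; auto. unfold z. rewrite Hu. lra.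
    + intros j _. rewrite <- csum_conj, (csum_ext N (fun k => Y k * z k * ka j k)%C
        (fun k => charge_num n a (w ^ k) * logder n a (r * z j) (w ^ k)%C)%C).
      * rewrite Cplus_conj, Copp_conj. unfold Y, z. ring.
      * intros k _. now rewrite Hcn.
Qed.

Lemma is_derive_dsum (N : nat) (f df : nat -> nat -> R -> R) (x : R) :
  (forall j k, is_derive (f j k) x (df j k x)) ->
  is_derive (fun r => dsum N (fun j k => f j k r)) x (dsum N (fun j k => df j k x)).
Proof.
  intros H. apply (is_derive_rsum N (fun j r => rsum N (fun k => f j k r))
                    (fun j r => rsum N (fun k => df j k r))).
  intros j. now apply is_derive_rsum.
Qed.

(** The first argument of q is contracted to r z. At r = 0 the kernel is ln 1 = 0; integrating the
    derivative up to r = 1, each of its two main terms contributes one [energy]. *)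
Lemma potential_lower_bound (n : nat) (a : nat -> C) (d : R) : 0 < d ->
  (forall z v, Cmod z <= 1 -> Cmod v <= 1 -> d <= Cmod (qpoly n a z v)) ->
  exists B, 0 <= B /\ forall N w, primitive_root N w -> (n + 2 < N)%nat ->
  INR N ^ 2 * (2 * energy n a) - INR N * B <=
  dsum N (fun j k => Re (charge n a (w ^ j) * Cconj (charge n a (w ^ k)))%C *
                     ln (Cmod (qpoly n a (w ^ j)%C (w ^ k)%C) ^ 2)).
Proof.
  intros Hd Hq. destruct (potential_derivative n a d Hd Hq) as (B & HB & HV).
  exists B. split; auto. intros N w Hw HN.
  assert (Hu : forall j, Cmod (w ^ j)%C = 1) by (intros; apply Cmod_pow_unit, Hw).
  set (A := fun j k => Re (charge n a (w ^ j) * Cconj (charge n a (w ^ k)))%C).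
  set (V := fun r : R => dsum N (fun j k => A j k * ln (Cmod (qpoly n a (r * w ^ j)%C (w ^ k)%C) ^ 2))).
  set (W := fun r : R => V r - INR N ^ 2 * (energy n a * r + rsum n (fun m => INR (S m) * Cmod (a m) ^ 2 * r ^ S m))).
  set (dW := fun r : R => dsum N (fun j k => A j k * (2 * Re (w ^ j * w ^ k * logder n a (r * w ^ j) (w ^ k))%C))
     - INR N ^ 2 * (energy n a + rsum n (fun m => INR (S m) * Cmod (a m) ^ 2 * (INR (S m) * r ^ m)))).
  assert (Hbv : Rabs (W 1 - W 0) <= INR N * B * Rabs (1 - 0)).
  (* [W] has the main term subtracted, so its derivative is the error alone. The lemma asks for it
     on the whole interval |r| <= 1, negative r included; hence the form [Rabs r <= 1] of the
     estimates. *)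
  { apply (bounded_variation W dW). intros r Hr.
    rewrite !Rminus_0_r, Rabs_R1 in Hr. split; [|exact (HV N w r Hw HN Hr)].
    apply @is_derive_minus.
    - apply is_derive_dsum with (f := fun j k r => A j k * ln (Cmod (qpoly n a (RtoC r * w ^ j)%C (w ^ k)%C) ^ 2))
        (df := fun j k r => A j k * (2 * Re (w ^ j * w ^ k * logder n a (RtoC r * w ^ j) (w ^ k))%C)).
      intros j k. apply is_derive_scal.
      replace (w ^ j * w ^ k * logder n a (r * w ^ j) (w ^ k))%C with
        (- (w ^ j * w ^ k * dqpoly n a (r * w ^ j)%C (w ^ k)%C) / qpoly n a (r * w ^ j)%C (w ^ k)%C)%C
        by (unfold logder, Cdiv; ring).
      apply (is_derive_ln_Cmod_sqr (fun t => qpoly n a (RtoC t * w ^ j)%C (w ^ k)%C)).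
      + apply is_cderive_qpoly.
      + apply Cmod_gt_0. eapply Rlt_le_trans; [exact Hd|]. apply Hq.
        * apply unit_disk_scale; auto. rewrite Hu. lra.
        * rewrite Hu. lra.
    - apply is_derive_scal. apply @is_derive_plus.
      + auto_derive; auto. ring.
      + apply (is_derive_rsum n (fun m r => INR (S m) * Cmod (a m) ^ 2 * r ^ S m)
          (fun m r => INR (S m) * Cmod (a m) ^ 2 * (INR (S m) * r ^ m))).
        intros m. generalize (INR (S m) * Cmod (a m) ^ 2). intros c. auto_derive; auto.
        change (match m with O => 1 | S _ => INR m + 1 end) with (INR (S m)). ring. }
  rewrite Rminus_0_r, Rabs_R1, Rmult_1_r in Hbv. apply Rabs_le_between in Hbv.
  assert (W0 : W 0 = 0).
  { unfold W, V. rewrite (dsum_ext N _ (fun _ _ => 0 * 0)).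
    - rewrite dsum_scal, (rsum_0 n); [ring|]. intros m _. rewrite pow_i by lia. ring.
    - intros j k _ _. replace (0 * w ^ j)%C with (RtoC 0) by ring.
      rewrite qpoly_0_l, Cmod_1, pow1, ln_1. ring. }
  assert (W1 : W 1 = V 1 - INR N ^ 2 * (2 * energy n a)).
  { unfold W. do 2 f_equal. unfold energy.
    rewrite (rsum_ext n (fun m => INR (S m) * Cmod (a m) ^ 2 * 1 ^ S m) (fun m => INR (S m) * Cmod (a m) ^ 2)).
    - ring.
    - intros m _. rewrite pow1. ring. }
  assert (V1 : V 1 = dsum N (fun j k => A j k * ln (Cmod (qpoly n a (w ^ j)%C (w ^ k)%C) ^ 2))).
  { apply dsum_ext. intros j k _ _. now rewrite Cmult_1_l. }
  unfold A in V1. rewrite <- V1. lra.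
Qed.

(** * The area theorem for polynomials *)

Lemma rsum_geometric_le (q : R) (n : nat) : 0 <= q < 1 -> rsum n (fun i => q ^ i) <= / (1 - q).
Proof.
  intros Hq.
  assert (E : (1 - q) * rsum n (fun i => q ^ i) = 1 - q ^ n).
  { induction n as [|n IH]; simpl; [ring|]. rewrite Rmult_plus_distr_l, IH. ring. }
  assert (P : 0 <= q ^ n) by (apply pow_le; lra).
  apply Rmult_le_reg_l with (1 - q); [lra|]. rewrite E, Rinv_r; lra.
Qed.

Lemma Cmod_rotate (x y : C) (s : R) : Cmod x = 1 ->
  Cmod (x - s * y)%C = Cmod (1 - s * (y * Cconj x))%C.
Proof.
  intros Hx.
  replace (1 - s * (y * Cconj x))%C with ((x - s * y) * Cconj x)%C.
  - rewrite Cmod_mult, Cmod_conj, Hx. ring.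
  - rewrite <- (conj_mult_unit x Hx). ring.
Qed.

(** With x = s w^k conj(w^j) one has x^N = s^N, so 1 / (1 - x) is a finite geometric sum divided by
    1 - s^N. Parseval evaluates the sum of its squares as N times the sum of s^(2 i), at most N / (1
    - s). *)
Lemma poisson_bound (N : nat) (w : C) (s : R) (j : nat) :
  primitive_root N w -> (0 < N)%nat -> 0 < s < 1 ->
  rsum N (fun k => / Cmod (w ^ j - s * w ^ k)%C ^ 2) <= INR N / ((1 - s) * (1 - s ^ N) ^ 2).
Proof.
  intros Hw HN Hs.
  assert (Hu : forall j, Cmod (w ^ j)%C = 1) by (intros; apply Cmod_pow_unit, Hw).
  assert (HsN : 0 < 1 - s ^ N).
  { assert (A := pow_lt_1_compat s N ltac:(lra) HN). lra. }
  set (G := fun k => csum N (fun i => (s * (w ^ k * Cconj (w ^ j))) ^ i)%C).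
  assert (HG : forall k, / Cmod (w ^ j - s * w ^ k)%C ^ 2 = / (1 - s ^ N) ^ 2 * Cmod (G k) ^ 2).
  { intros k. rewrite Cmod_rotate by auto.
    assert (E := geometric_csum (s * (w ^ k * Cconj (w ^ j)))%C N). fold (G k) in E.
    assert (HNk : ((w ^ k) ^ N)%C = RtoC 1).
    { destruct Hw as [H _]. now rewrite <- Cpow_mult_r, Nat.mul_comm, Cpow_mult_r, H, Cpow_1_l. }
    assert (HNj : ((Cconj (w ^ j)) ^ N)%C = RtoC 1).
    { destruct Hw as [H _]. rewrite <- Cpow_conj, <- Cpow_mult_r, Nat.mul_comm, Cpow_mult_r, H, Cpow_1_l.
      apply injective_projections; simpl; ring. }
    rewrite !Cpow_mult_l, HNk, HNj in E.
    set (x := (s * (w ^ k * Cconj (w ^ j)))%C) in *.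
    assert (E2 : (Cmod (1 - x)%C * Cmod (G k)) = 1 - s ^ N).
    { rewrite <- Cmod_mult. replace ((1 - x) * G k)%C with (- ((x - 1) * G k))%C by ring.
      rewrite E. replace (- (s ^ N * (1 * 1) - 1))%C with (RtoC (1 - s ^ N)).
      - rewrite Cmod_R, Rabs_pos_eq; lra.
      - rewrite RtoC_minus, RtoC_pow. ring. }
    rewrite <- E2.
    assert (Cmod (1 - x)%C <> 0) by (intros Z; rewrite Z in E2; lra).
    assert (Cmod (G k) <> 0) by (intros Z; rewrite Z in E2; lra).
    field. split; auto. }
  (* Parseval for [G] as a polynomial in w^k. *)
  assert (HP : RtoC (rsum N (fun k => Cmod (G k) ^ 2)) = RtoC (INR N * rsum N (fun i => (s ^ 2) ^ i))).
  { rewrite <- csum_RtoC, <- rsum_scal, <- csum_RtoC.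
    rewrite (csum_ext N _ (fun k => csum N (fun i => csum N (fun l =>
      (RtoC (s ^ i * s ^ l) * (w ^ j) ^ l * Cconj (w ^ j) ^ i) * (Cconj (w ^ k) ^ l * (w ^ k) ^ i))))%C).
    - rewrite csum_switch. apply csum_ext. intros i Hi. rewrite csum_switch.
      rewrite (csum_ext N _ (fun l => (RtoC (s ^ i * s ^ l) * (w ^ j) ^ l * Cconj (w ^ j) ^ i) *
        (if Nat.eq_dec i l then RtoC (INR N) else RtoC 0))%C).
      + rewrite (csum_single N i (fun l => RtoC (s ^ i * s ^ l) * (w ^ j) ^ l * Cconj (w ^ j) ^ i)%C).
        destruct (Compare_dec.lt_dec i N); [|lia].
        replace (RtoC (s ^ i * s ^ i) * (w ^ j) ^ i * Cconj (w ^ j) ^ i * INR N)%C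
          with (RtoC (s ^ i * s ^ i) * (Cconj (w ^ j) * w ^ j) ^ i * INR N)%C by (rewrite Cpow_mult_l; ring).
        rewrite conj_mult_unit by auto. rewrite Cpow_1_l, <- pow_mult.
        replace (2 * i)%nat with (i + i)%nat by lia. rewrite pow_add, !RtoC_mult. ring.
      + intros l Hl. rewrite csum_scal, root_orthogonality by auto. f_equal.
        destruct (Nat.eq_dec l i), (Nat.eq_dec i l); auto; congruence.
    - intros k _. rewrite Cmod2_conj. unfold G. generalize (w ^ j)%C (w ^ k)%C. intros p q.
      rewrite Cmult_comm, <- csum_scal. apply csum_ext. intros i _.
      rewrite Cmult_comm, csum_conj, <- csum_scal. apply csum_ext. intros l _.
      rewrite !Cpow_conj, !Cmult_conj, Cconj_conj, !Cpow_mult_l, RtoC_mult, !RtoC_pow.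
      replace (Cconj s) with (RtoC s) by (apply injective_projections; simpl; ring). ring. }
  apply (f_equal fst) in HP. simpl in HP.
  rewrite (rsum_ext N _ _ (fun k _ => HG k)), rsum_scal.
  replace (rsum N (fun k => Cmod (G k) ^ 2)) with (INR N * rsum N (fun i => (s ^ 2) ^ i)) by (symmetry; exact HP).
  assert (Q := rsum_geometric_le (s ^ 2) N ltac:(simpl; nra)).
  assert (Q2 : / (1 - s ^ 2) <= / (1 - s)) by (apply Rinv_le_contravar; simpl; nra).
  assert (HN0 : 0 <= INR N) by apply pos_INR.
  assert (H2 : 0 < / (1 - s ^ N) ^ 2) by (apply Rinv_0_lt_compat, pow_lt; lra).
  unfold Rdiv. rewrite Rinv_mult.
  replace (INR N * (/ (1 - s) * / (1 - s ^ N) ^ 2)) with (/ (1 - s ^ N) ^ 2 * (INR N * / (1 - s))) by ring.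
  apply Rmult_le_compat_l; [lra|]. apply Rmult_le_compat_l; lra.
Qed.

Lemma ln_le_minus_one (x : R) : 0 < x -> ln x <= x - 1.
Proof.
  intros Hx. assert (A := exp_ineq1_le (ln x)). rewrite exp_ln in A; lra.
Qed.

Lemma ln_div_bound (x y : R) : 0 < x -> 0 < y -> ln x - ln y <= (x - y) / y.
Proof.
  intros Hx Hy. rewrite <- ln_div by auto. eapply Rle_trans; [apply ln_le_minus_one|].
  - now apply Rdiv_lt_0_compat.
  - right. field. lra.
Qed.

(** Distorting the regularising term [e] by a bounded factor [k] matters only where [x] is not large
    compared with [e]. Both directions follow from ln x - ln y <= (x - y) / y; when k > 1 the lower
    one has a negative right-hand side. *)
Lemma ln_perturbation (x e k K : R) : 0 <= x -> 0 < e -> 1 <= K -> / K <= k <= K ->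
  Rabs (ln (x + e * k) - ln (x + e)) <= K * e / (x + e).
Proof.
  intros Hx He HK Hk.
  assert (HK0 : 0 < / K) by (apply Rinv_0_lt_compat; lra).
  assert (Hek : 0 < e * k) by (apply Rmult_lt_0_compat; lra).
  apply Rabs_le. split.
  - assert (A := ln_div_bound (x + e) (x + e * k) ltac:(lra) ltac:(lra)).
    assert (B : (x + e - (x + e * k)) / (x + e * k) <= K * e / (x + e)).
    { assert (0 < / (x + e * k)) by (apply Rinv_0_lt_compat; lra).
      assert (0 <= K * e / (x + e)) by (apply Rdiv_le_0_compat; nra).
      destruct (Rle_lt_dec k 1) as [H1|H1].
      - apply Rle_trans with (e / (x + e * k)).
        { unfold Rdiv. apply Rmult_le_compat_r; nra. }
        apply Rmult_le_reg_r with ((x + e) * (x + e * k)); [apply Rmult_lt_0_compat; lra|].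
        replace (e / (x + e * k) * ((x + e) * (x + e * k))) with (e * (x + e)) by (field; lra).
        replace (K * e / (x + e) * ((x + e) * (x + e * k))) with (e * (K * (x + e * k))) by (field; lra).
        apply Rmult_le_compat_l; [lra|].
        assert (1 <= K * k).
        { replace 1 with (K * / K) by (apply Rinv_r; lra). apply Rmult_le_compat_l; [lra|apply Hk]. }
        nra.
      - apply Rle_trans with 0; auto. unfold Rdiv.
        assert (0 <= e * (k - 1)) by (apply Rmult_le_pos; lra). nra. }
    lra.
  - assert (A := ln_div_bound (x + e * k) (x + e) ltac:(lra) ltac:(lra)).
    eapply Rle_trans; [exact A|]. unfold Rdiv. apply Rmult_le_compat_r; [apply Rlt_le, Rinv_0_lt_compat; lra|].
    nra.
Qed.

(** For k = 1 the two logarithms agree, because |z - v|^2 + (1 - s)^2 / s = |z - s v|^2 / s on the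
    unit circle; [ln_perturbation] accounts for other values of k. *)
Lemma kernel_compare (z v : C) (s k K : R) : Cmod z = 1 -> Cmod v = 1 -> 0 < s < 1 ->
  1 <= K -> / K <= k <= K ->
  Rabs (ln (Cmod (z - v)%C ^ 2 + (1 - s) ^ 2 / s * k) - (ln (Cmod (z - s * v)%C ^ 2) - ln s))
    <= K * (1 - s) ^ 2 * / Cmod (z - s * v)%C ^ 2.
Proof.
  intros Hz Hv Hs HK Hk.
  assert (Z2 : Re z ^ 2 + Im z ^ 2 = 1) by (rewrite <- Cmod_sqr, Hz; ring).
  assert (V2 : Re v ^ 2 + Im v ^ 2 = 1) by (rewrite <- Cmod_sqr, Hv; ring).
  assert (E : Cmod (z - v)%C ^ 2 + (1 - s) ^ 2 / s = Cmod (z - s * v)%C ^ 2 / s).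
  { rewrite !Cmod_sqr. destruct z as [x y], v as [p q]. simpl in *.
    apply Rmult_eq_reg_r with s; [|lra]. field_simplify; [|lra|lra].
    replace (y ^ 2) with (1 - x ^ 2) by lra. replace (q ^ 2) with (1 - p ^ 2) by lra. ring. }
  set (X := Cmod (z - s * v)%C ^ 2) in *.
  assert (H1s : 0 < (1 - s) ^ 2 / s) by (apply Rdiv_lt_0_compat; [apply pow_lt|]; lra).
  assert (Ha : 0 <= Cmod (z - v)%C ^ 2) by apply pow2_ge_0.
  assert (HX : 0 < X).
  { replace X with ((X / s) * s) by (field; lra). rewrite <- E. apply Rmult_lt_0_compat; lra. }
  rewrite <- ln_div by lra. rewrite <- E.
  eapply Rle_trans; [exact (ln_perturbation _ _ k K Ha H1s HK Hk)|]. rewrite E. right. field. lra.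
Qed.

Lemma rsum_truncate (m n : nat) (e : nat -> R) :
  rsum m (fun l => if Compare_dec.lt_dec l n then e l else 0) = rsum (Nat.min m n) e.
Proof.
  induction m as [|m IH]; [reflexivity|]. cbn [rsum]. rewrite IH.
  destruct (Compare_dec.lt_dec m n).
  - replace (Nat.min (S m) n) with (S m) by lia. replace (Nat.min m n) with m by lia. reflexivity.
  - replace (Nat.min (S m) n) with n by lia. replace (Nat.min m n) with n by lia. ring.
Qed.

Lemma rsum_le_length (m n : nat) (e : nat -> R) :
  (forall l, 0 <= e l) -> (m <= n)%nat -> rsum m e <= rsum n e.
Proof.
  intros He H. induction H as [|n H IH]; [lra|]. simpl. specialize (He n). lra.
Qed.

(** The kernel Re ((z' conj z)^m) is half the sum of two hermitian forms of rank one, each evaluated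
    by a Fourier coefficient of [Y]. *)
Lemma dsum_Re_power (N : nat) (Y z : nat -> C) (m : nat) :
  dsum N (fun j k => Re (Y j * Cconj (Y k))%C * Re ((z k * Cconj (z j)) ^ m)%C)
  = / 2 * (Cmod (csum N (fun j => Y j * z j ^ m)%C) ^ 2
           + Cmod (csum N (fun j => Y j * Cconj (z j) ^ m)%C) ^ 2).
Proof.
  rewrite (dsum_ext N _ (fun j k => / 2 * (Re ((Y j * z j ^ m) * Cconj (Y k * z k ^ m))%C
     + Re ((Y j * Cconj (z j) ^ m) * Cconj (Y k * Cconj (z k) ^ m))%C))).
  - rewrite dsum_scal, dsum_plus.
    rewrite (dsum_hermitian N (fun j => Y j * z j ^ m)%C (fun j => Y j * z j ^ m)%C).
    rewrite (dsum_hermitian N (fun j => Y j * Cconj (z j) ^ m)%C (fun j => Y j * Cconj (z j) ^ m)%C).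
    now rewrite !Re_mult_conj.
  - intros j k _ _.
    apply Rmult_eq_reg_l with 2; [|lra]. rewrite two_Re_Re.
    rewrite <- Rmult_assoc, Rinv_r, Rmult_1_l by lra. rewrite Rplus_comm.
    f_equal; f_equal; rewrite !Cmult_conj, !Cpow_conj, ?Cmult_conj, ?Cconj_conj, !Cpow_mult_l; ring.
Qed.

Lemma energy_nonneg (n : nat) (a : nat -> C) : 0 <= energy n a.
Proof.
  apply rsum_nonneg. intros m _. apply Rmult_le_pos; [apply pos_INR|apply pow2_ge_0].
Qed.

(** Since |z - s v| = |1 - s v conj z|, the kernel expands in powers of v conj z, and the Fourier
    coefficients of the charge give 1 from z^-1 and (l + 1) |a_l|^2 from z^(l + 1); the damping s^(l
    + 1) is estimated by 1. Aliasing forces a truncation at order m, whose tail costs 2 / ((m + 1)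
    (1 - s)). *)
Lemma circle_energy (N n m : nat) (a : nat -> C) (w : C) (s : R) (B : R) :
  primitive_root N w -> (m + n + 2 < N)%nat -> 0 < s < 1 ->
  (forall z, Cmod z = 1 -> Cmod (charge n a z) <= B) ->
  - (INR N ^ 2 * (1 + energy n a)) - INR N ^ 2 * (B ^ 2 * (2 / (INR (S m) * (1 - s)))) <=
  dsum N (fun j k => Re (charge n a (w ^ j) * Cconj (charge n a (w ^ k)))%C *
                     ln (Cmod (w ^ j - s * w ^ k)%C ^ 2)).
Proof.
  intros Hw HN Hs HB.
  assert (Hu : forall j, Cmod (w ^ j)%C = 1) by (intros; apply Cmod_pow_unit, Hw).
  set (Y := fun j => charge n a (w ^ j)%C).
  set (A := fun j k => Re (Y j * Cconj (Y k))%C).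
  set (u := fun j k => (w ^ k * Cconj (w ^ j))%C).
  assert (HA : forall j k, Rabs (A j k) <= B ^ 2).
  { intros j k. eapply Rle_trans; [apply re_le_Cmod|]. simpl. rewrite Rmult_1_r.
    apply Cmod_mult_le; [|rewrite Cmod_conj]; apply HB, Hu. }
  set (T := fun j k => 2 * rsum m (fun l => Re ((s * u j k) ^ S l)%C / INR (S l))).
  set (D := 2 / (INR (S m) * (1 - s))).
  assert (HSm : 0 < INR (S m)) by (apply lt_0_INR; lia).
  assert (HD : 0 < D) by (apply Rdiv_lt_0_compat; [lra|apply Rmult_lt_0_compat; lra]).
  assert (HL : forall j k, Rabs (ln (Cmod (w ^ j - s * w ^ k)%C ^ 2) + T j k) <= D).
  { intros j k. rewrite Cmod_rotate by auto. fold (u j k).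
    assert (Hm : Cmod (s * u j k)%C = s).
    { unfold u. rewrite !Cmod_mult, Cmod_conj, !Hu, Cmod_R, Rabs_pos_eq; lra. }
    assert (L := ln_taylor (s * u j k)%C m). rewrite Hm in L. specialize (L ltac:(lra)).
    eapply Rle_trans; [exact L|]. fold D. rewrite <- (Rmult_1_r D) at 2.
    apply Rmult_le_compat_l; [lra|]. rewrite <- (pow1 (S m)). apply pow_incr. lra. }
  assert (HT : dsum N (fun j k => A j k * T j k) <= INR N ^ 2 * (1 + energy n a)).
  { rewrite (dsum_ext N _ (fun j k => rsum m (fun l => (2 * s ^ S l / INR (S l)) *
       (A j k * Re (u j k ^ S l)%C)))).
    2:{ intros j k _ _. unfold T. rewrite <- rsum_scal, <- rsum_scal. apply rsum_ext. intros l _.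
        rewrite Cpow_mult_l, <- RtoC_pow, re_scal_l. unfold Rdiv. ring. }
    rewrite dsum_rsum.
    apply Rle_trans with (rsum m (fun l => INR N ^ 2 * ((if Compare_dec.lt_dec l 1 then 1 else 0)
       + (if Compare_dec.lt_dec l n then INR (S l) * Cmod (a l) ^ 2 else 0)))).
    - apply rsum_le. intros l Hl. rewrite dsum_scal. unfold A, u, Y.
      rewrite (dsum_Re_power N (fun j => charge n a (w ^ j)%C) (fun j => (w ^ j)%C) (S l)).
      rewrite charge_fourier_pos, charge_fourier_neg by (auto; lia).
      assert (HSl : 0 < INR (S l)) by (apply lt_0_INR; lia).
      assert (HS1 : 1 <= INR (S l)) by (rewrite S_INR; assert (Q := pos_INR l); lra).
      assert (Hsp : 0 < s ^ S l <= 1).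
      { split; [apply pow_lt; lra|]. rewrite <- (pow1 (S l)). apply pow_incr. lra. }
      assert (E1 : Cmod (if Nat.eq_dec 1 (S l) then RtoC (INR N) else RtoC 0) ^ 2
         = INR N ^ 2 * (if Compare_dec.lt_dec l 1 then 1 else 0)).
      { destruct (Nat.eq_dec 1 (S l)), (Compare_dec.lt_dec l 1); try lia.
        - rewrite Cmod_R, pow2_abs. ring.
        - rewrite Cmod_0. ring. }
      assert (E2 : Cmod (if Compare_dec.lt_dec l n then (- (INR (S l) * a l * INR N))%C else RtoC 0) ^ 2
         = INR N ^ 2 * (INR (S l) * (if Compare_dec.lt_dec l n then INR (S l) * Cmod (a l) ^ 2 else 0))).
      { destruct (Compare_dec.lt_dec l n).
        - rewrite Cmod_opp, !Cmod_mult, !Cmod_R, !Rpow_mult_distr, !pow2_abs. ring.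
        - rewrite Cmod_0. ring. }
      rewrite E1, E2.
      set (e1 := if Compare_dec.lt_dec l 1 then 1 else 0).
      set (e2 := if Compare_dec.lt_dec l n then INR (S l) * Cmod (a l) ^ 2 else 0).
      assert (He1 : 0 <= e1) by (unfold e1; destruct (Compare_dec.lt_dec l 1); lra).
      assert (He2 : 0 <= e2).
      { unfold e2. destruct (Compare_dec.lt_dec l n); [|lra]. apply Rmult_le_pos; [lra|apply pow2_ge_0]. }
      replace (2 * s ^ S l / INR (S l) * (/ 2 * (INR N ^ 2 * e1 + INR N ^ 2 * (INR (S l) * e2))))
        with (INR N ^ 2 * (s ^ S l * (e1 * / INR (S l) + e2))) by (field; lra).
      apply Rmult_le_compat_l; [apply pow2_ge_0|].
      assert (/ INR (S l) <= 1) by (rewrite <- Rinv_1; apply Rinv_le_contravar; lra).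
      assert (0 < / INR (S l)) by now apply Rinv_0_lt_compat.
      assert (0 <= e1 * / INR (S l) <= e1) by nra. nra.
    - rewrite rsum_scal, rsum_plus, !rsum_truncate. apply Rmult_le_compat_l; [apply pow2_ge_0|].
      apply Rplus_le_compat.
      + eapply Rle_trans; [apply (rsum_le_length _ 1)|]; [intros; lra|lia|simpl; lra].
      + apply rsum_le_length; [|lia]. intros l. apply Rmult_le_pos; [apply pos_INR|apply pow2_ge_0]. }
  assert (HR : - (INR N ^ 2 * (B ^ 2 * D)) <= dsum N (fun j k => A j k * (ln (Cmod (w ^ j - s * w ^ k)%C ^ 2) + T j k))).
  { assert (Q : Rabs (dsum N (fun j k => A j k * (ln (Cmod (w ^ j - s * w ^ k)%C ^ 2) + T j k)))
       <= INR N ^ 2 * (B ^ 2 * D)).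
    { eapply Rle_trans; [apply Rabs_dsum|]. simpl (INR N ^ 2). rewrite Rmult_1_r, Rmult_assoc.
      unfold dsum. apply rsum_le_const. intros j _. apply rsum_le_const. intros k _.
      rewrite Rabs_mult. apply Rmult_le_compat; auto using Rabs_pos. }
    apply Rabs_le_between in Q. lra. }
  apply Rle_trans with (dsum N (fun j k => A j k * (ln (Cmod (w ^ j - s * w ^ k)%C ^ 2) + T j k)) +
      (-1) * dsum N (fun j k => A j k * T j k)); [fold D; lra|].
  right. rewrite <- dsum_scal, <- dsum_plus. apply dsum_ext. intros. unfold A, Y. ring.
Qed.

(** On the circle conj z g(z) is the curve point g(z) / z, and chords factor as |z - v| |q(z, v)|.
    Pulling |q|^2 out of the regularised logarithm divides the regularising term by |q|^2, which
    produces the factor k of [kernel_compare]. *)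
Lemma chord_kernel (n : nat) (a : nat -> C) (z v : C) (eta c : R) :
  Cmod z = 1 -> Cmod v = 1 -> 0 < eta -> 0 < c -> qpoly n a z v <> RtoC 0 ->
  ln (Cmod (Cconj z * gpoly n a z - Cconj v * gpoly n a v)%C ^ 2 + eta * c)
  = ln (Cmod (qpoly n a z v) ^ 2)
    + ln (Cmod (z - v)%C ^ 2 + eta * (c / Cmod (qpoly n a z v) ^ 2)).
Proof.
  intros Hz Hv He Hc Hq.
  assert (HQ : 0 < Cmod (qpoly n a z v)) by now apply Cmod_gt_0.
  assert (E : Cmod (Cconj z * gpoly n a z - Cconj v * gpoly n a v)%C
              = Cmod (z - v)%C * Cmod (qpoly n a z v)).
  { rewrite <- Cmod_mult, <- qpoly_spec.
    replace (z * gpoly n a v - v * gpoly n a z)%C with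
      (- (z * v) * (Cconj z * gpoly n a z - Cconj v * gpoly n a v))%C.
    - rewrite Cmod_mult, Cmod_opp, Cmod_mult, Hz, Hv. ring.
    - replace (- (z * v) * (Cconj z * gpoly n a z - Cconj v * gpoly n a v))%C with
        (z * (Cconj v * v) * gpoly n a v - v * (Cconj z * z) * gpoly n a z)%C by ring.
      rewrite !conj_mult_unit by auto. ring. }
  assert (HQ2 : 0 < Cmod (qpoly n a z v) ^ 2) by now apply pow_lt.
  assert (HX := pow2_ge_0 (Cmod (z - v)%C)).
  assert (0 < eta * (c / Cmod (qpoly n a z v) ^ 2)).
  { apply Rmult_lt_0_compat; auto. now apply Rdiv_lt_0_compat. }
  rewrite <- ln_mult by lra. f_equal. rewrite E. field. lra.
Qed.

(** 1 - x <= 1 / (1 + x), and by Bernoulli (1 + 1 / L)^(L^2) >= 1 + L. *)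
Lemma half_power (L : nat) : (1 < L)%nat -> (1 - / INR L) ^ (L * L) <= / 2.
Proof.
  intros HL. assert (HL1 : 1 < INR L) by (apply (lt_INR 1); lia).
  set (x := / INR L).
  assert (Hx : 0 < x < 1).
  { unfold x. split; [apply Rinv_0_lt_compat; lra|]. rewrite <- Rinv_1. apply Rinv_lt_contravar; lra. }
  assert (A : (1 - x) <= / (1 + x)).
  { apply Rmult_le_reg_r with (1 + x); [lra|]. rewrite Rinv_l by lra. nra. }
  eapply Rle_trans; [apply pow_incr; split; [lra|exact A]|].
  rewrite pow_inv. apply Rinv_le_contravar; [lra|].
  assert (P := poly (L * L) x ltac:(lra)). rewrite mult_INR in P.
  replace (INR L * INR L * x) with (INR L) in P by (unfold x; field; lra). lra.
Qed.

(** N = L^2 and s = 1 - 1 / L meet three demands: 1 - s tends to 0, so the distortion of the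
    regularising term fades; N (1 - s) tends to infinity, so the Taylor tail disappears; s^N stays
    below 1/2, so the Poisson sums are of order N / (1 - s). After division by N^2 every error is a
    multiple of 1 / L. *)
Lemma polynomial_area_approx (n : nat) (a : nat -> C) (d : R) : 0 < d ->
  (forall z v, Cmod z <= 1 -> Cmod v <= 1 -> d <= Cmod (qpoly n a z v)) ->
  exists M, forall L, (2 * n + 8 <= L)%nat -> energy n a <= 1 + M / INR L.
Proof.
  intros Hd Hq.
  destruct (potential_lower_bound n a d Hd Hq) as (B & HB & HV).
  destruct (taylor_bounded (charge_num n a)) as (BY & HBY & HY); [apply taylor_charge_num|].
  destruct (taylor_bounded (gpoly n a)) as (BG & HBG & HG).
  { apply (taylor_gpoly (fun _ : unit => True) n a (fun _ x => x)), taylor_id. }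
  assert (HQB : exists BQ, forall z v, Cmod z <= 1 -> Cmod v <= 1 -> Cmod (qpoly n a z v) <= BQ).
  { destruct (taylor_qpoly (fun z : C => Cmod z <= 1) n a (fun z _ => z) (fun _ x => x)) as (p' & K & HK & Hp).
    - apply (taylor_const _ (fun z => z) 1). auto.
    - apply taylor_id.
    - exists K. intros z v Hz Hv. now apply (Hp z v v). }
  destruct HQB as (BQ & HBQ).
  (* A single number above c / |q|^2 and above its inverse: c <= (1 + BG^2)^2 and |q| >= d control
     the quotient, c >= 1 and |q| <= BQ its inverse. *)
  set (K := (1 + BQ ^ 2) + (1 + BG ^ 2) * (1 + BG ^ 2) / d ^ 2).
  assert (Hd2 : 0 < d ^ 2) by now apply pow_lt.
  assert (HBQ2 := pow2_ge_0 BQ). assert (HBG2 := pow2_ge_0 BG).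
  assert (HK0 : 0 <= (1 + BG ^ 2) * (1 + BG ^ 2) / d ^ 2) by (apply Rdiv_le_0_compat; nra).
  exists (B + 4 * BY ^ 2 + 4 * (BY ^ 2 * K)). intros L HL.
  set (N := (L * L)%nat). assert (HNL : INR N = INR L * INR L) by apply mult_INR.
  assert (HLN : (L <= N)%nat) by (unfold N; nia).
  assert (HL8 : 8 <= INR L) by (replace 8 with (INR 8) by (simpl; ring); apply le_INR; lia).
  destruct (primitive_root_exists N ltac:(lia)) as (w & Hw).
  assert (Hu : forall j, Cmod (w ^ j)%C = 1) by (intros; apply Cmod_pow_unit, Hw).
  set (s := 1 - / INR L).
  assert (Hs : 0 < s < 1).
  { unfold s. assert (0 < / INR L) by (apply Rinv_0_lt_compat; lra).
    assert (/ INR L < 1) by (rewrite <- Rinv_1; apply Rinv_lt_contravar; lra). lra. }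
  assert (H1s : 1 - s = / INR L) by (unfold s; ring).
  assert (HsN : s ^ N <= / 2) by (apply half_power; lia).
  set (eta := (1 - s) ^ 2 / s).
  assert (Heta : 0 < eta) by (apply Rdiv_lt_0_compat; [apply pow_lt|]; lra).
  set (Y := fun j => charge n a (w ^ j)%C).
  set (A := fun j k => Re (Y j * Cconj (Y k))%C).
  assert (HA : forall j k, Rabs (A j k) <= BY ^ 2).
  { intros j k. eapply Rle_trans; [apply re_le_Cmod|]. simpl. rewrite Rmult_1_r.
    apply Cmod_mult_le; [|rewrite Cmod_conj]; unfold Y; rewrite Cmod_charge by auto;
      apply HY; rewrite Hu; lra. }
  set (G := fun j => (Cconj (w ^ j) * gpoly n a (w ^ j))%C).
  set (c := fun j k => (1 + Cmod (G j) ^ 2) * (1 + Cmod (G k) ^ 2)).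
  set (Q := fun j k => qpoly n a (w ^ j)%C (w ^ k)%C).
  set (X := fun j k => Cmod (w ^ j - s * w ^ k)%C ^ 2).
  assert (HN2 : (n + 2 < N)%nat) by lia.
  assert (Hsum : csum N Y = RtoC 0) by now apply charge_sum.
  assert (HE := log_energy_nonpos N G Y eta Heta Hsum).
  assert (HGb : forall j, 0 <= Cmod (G j) ^ 2 <= BG ^ 2).
  { intros j. split; [apply pow2_ge_0|]. apply pow_incr. split; [apply Cmod_ge_0|].
    unfold G. rewrite Cmod_mult, Cmod_conj, Hu, Rmult_1_l. apply HG. rewrite Hu. lra. }
  assert (Hc : forall j k, 1 <= c j k <= (1 + BG ^ 2) * (1 + BG ^ 2)).
  { intros j k. unfold c. assert (P := HGb j). assert (P' := HGb k). split; nra. }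
  assert (HQ : forall j k, d ^ 2 <= Cmod (Q j k) ^ 2 <= BQ ^ 2).
  { intros j k. assert (P1 := Hq (w ^ j)%C (w ^ k)%C). assert (P2 := HBQ (w ^ j)%C (w ^ k)%C).
    rewrite !Hu in P1, P2. split; apply pow_incr; split; try lra; [apply P1; lra|apply Cmod_ge_0|apply P2; lra]. }
  assert (Hkap : forall j k, / K <= c j k / Cmod (Q j k) ^ 2 <= K).
  { intros j k. assert (P := Hc j k). assert (P' := HQ j k). split.
    - apply Rle_trans with (/ Cmod (Q j k) ^ 2).
      + apply Rinv_le_contravar; [lra|]. unfold K. lra.
      + unfold Rdiv. assert (0 < / Cmod (Q j k) ^ 2) by (apply Rinv_0_lt_compat; lra). nra.
    - apply Rle_trans with ((1 + BG ^ 2) * (1 + BG ^ 2) / d ^ 2); [|unfold K; lra].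
      apply Rmult_le_compat; try lra.
      + apply Rlt_le, Rinv_0_lt_compat; lra.
      + apply Rinv_le_contravar; lra. }
  assert (HK1 : 1 <= K) by (unfold K; lra).
  (* The largest order free of aliasing; as L >= 2 n + 8, m + 1 is at least N / 2. *)
  set (m := (N - n - 3)%nat).
  assert (HC := circle_energy N n m a w s BY Hw ltac:(lia) Hs).
  assert (HVN := HV N w Hw HN2).
  assert (HCB : forall z, Cmod z = 1 -> Cmod (charge n a z) <= BY).
  { intros z Hz. rewrite Cmod_charge by auto. apply HY. lra. }
  specialize (HC HCB).
  assert (HP : dsum N (fun j k => BY ^ 2 * (K * (1 - s) ^ 2 * / X j k))
      <= INR N * (BY ^ 2 * (K * (1 - s) ^ 2 * (INR N / ((1 - s) * (1 - s ^ N) ^ 2))))).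
  { unfold dsum. apply rsum_le_const. intros j _.
    rewrite rsum_scal. apply Rmult_le_compat_l; [apply pow2_ge_0|].
    rewrite rsum_scal. apply Rmult_le_compat_l; [apply Rmult_le_pos; [lra|apply pow2_ge_0]|].
    apply poisson_bound; auto; lia. }
  (* The energy of the curve is nonpositive and the constant -ln s meets the total charge 0; on the
     right remains the error of [kernel_compare] summed over all pairs. *)
  assert (Hmain : dsum N (fun j k => A j k * ln (Cmod (Q j k) ^ 2)) + dsum N (fun j k => A j k * ln (X j k))
      <= dsum N (fun j k => BY ^ 2 * (K * (1 - s) ^ 2 * / X j k))).
  { apply Rle_trans with (dsum N (fun j k => Re (Y j * Cconj (Y k))%C *
       ln (Cmod (G j - G k)%C ^ 2 + eta * ((1 + Cmod (G j) ^ 2) * (1 + Cmod (G k) ^ 2))))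
       + dsum N (fun j k => BY ^ 2 * (K * (1 - s) ^ 2 * / X j k)) + ln s * dsum N A).
    - rewrite <- dsum_scal, <- !dsum_plus. apply dsum_le. intros j k _ _.
      assert (P := chord_kernel n a (w ^ j)%C (w ^ k)%C eta (c j k) (Hu j) (Hu k) Heta).
      assert (Hcjk := Hc j k). assert (HQjk := HQ j k).
      assert (Hne : qpoly n a (w ^ j)%C (w ^ k)%C <> RtoC 0).
      { intros E. unfold Q in HQjk. rewrite E, Cmod_0 in HQjk. simpl in HQjk. nra. }
      specialize (P ltac:(lra) Hne).
      assert (Kc := kernel_compare (w ^ j)%C (w ^ k)%C s (c j k / Cmod (Q j k) ^ 2) K (Hu j) (Hu k) Hs HK1 (Hkap j k)).
      fold eta in Kc. fold (X j k) in Kc. fold (G j) (G k) in P. fold (Q j k) in P. unfold c in P at 1.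
      rewrite P. fold (A j k).
      set (t := ln (Cmod (w ^ j - w ^ k)%C ^ 2 + eta * (c j k / Cmod (Q j k) ^ 2))) in *.
      assert (T : Rabs (A j k * (t - (ln (X j k) - ln s))) <= BY ^ 2 * (K * (1 - s) ^ 2 * / X j k)).
      { rewrite Rabs_mult. apply Rmult_le_compat; auto using Rabs_pos. }
      apply Rabs_le_between in T. lra.
    - assert (Z : dsum N A = 0) by (unfold A; rewrite dsum_hermitian, Hsum; simpl; ring).
      rewrite Z. lra. }
  assert (HVN' : INR N ^ 2 * (2 * energy n a) - INR N * B <= dsum N (fun j k => A j k * ln (Cmod (Q j k) ^ 2))) by exact HVN.
  assert (HC' : - (INR N ^ 2 * (1 + energy n a)) - INR N ^ 2 * (BY ^ 2 * (2 / (INR (S m) * (1 - s)))) <=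
     dsum N (fun j k => A j k * ln (X j k))) by exact HC.
  assert (Hm : 2 / (INR (S m) * (1 - s)) <= 4 * / INR L).
  { rewrite H1s. assert (HmN : INR N <= 2 * INR (S m)).
    { replace 2 with (INR 2) by (simpl; ring). rewrite <- mult_INR. apply le_INR. unfold m. nia. }
    rewrite HNL in HmN.
    apply Rmult_le_reg_r with (INR (S m)); [nra|].
    replace (2 / (INR (S m) * / INR L) * INR (S m)) with (2 * INR L) by (field; split; nra).
    apply Rmult_le_reg_r with (INR L); [lra|].
    replace (4 * / INR L * INR (S m) * INR L) with (4 * INR (S m)) by (field; lra). lra. }
  assert (Hp2 : (1 - s) ^ 2 * (INR N / ((1 - s) * (1 - s ^ N) ^ 2)) <= INR N * (4 * / INR L)).
  { replace ((1 - s) ^ 2 * (INR N / ((1 - s) * (1 - s ^ N) ^ 2))) with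
      (INR N * ((1 - s) * / (1 - s ^ N) ^ 2)) by (field; lra).
    apply Rmult_le_compat_l; [apply pos_INR|]. rewrite H1s, Rmult_comm.
    apply Rmult_le_compat_r; [apply Rlt_le, Rinv_0_lt_compat; lra|].
    replace 4 with (/ (/ 2) ^ 2) by field. apply Rinv_le_contravar; [simpl; lra|].
    apply pow_incr. lra. }
  assert (HBY2 := pow2_ge_0 BY).
  assert (HN0 : 0 < INR N) by (rewrite HNL; nra).
  assert (I1 : INR N ^ 2 * (BY ^ 2 * (2 / (INR (S m) * (1 - s)))) <= INR N ^ 2 * (BY ^ 2 * (4 * / INR L))).
  { apply Rmult_le_compat_l; [apply pow2_ge_0|]. now apply Rmult_le_compat_l. }
  assert (I2 : INR N * (BY ^ 2 * (K * (1 - s) ^ 2 * (INR N / ((1 - s) * (1 - s ^ N) ^ 2))))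
     <= INR N ^ 2 * (BY ^ 2 * K * (4 * / INR L))).
  { replace (INR N ^ 2 * (BY ^ 2 * K * (4 * / INR L))) with
      (INR N * (BY ^ 2 * (K * (INR N * (4 * / INR L))))) by ring.
    apply Rmult_le_compat_l; [lra|]. apply Rmult_le_compat_l; [lra|].
    rewrite Rmult_assoc. apply Rmult_le_compat_l; lra. }
  assert (I3 : INR N * B <= INR N ^ 2 * (B * / INR L)).
  { replace (INR N ^ 2 * (B * / INR L)) with (INR N * (B * (INR N * / INR L))) by ring.
    rewrite HNL. replace (INR L * INR L * / INR L) with (INR L) by (field; lra).
    apply Rmult_le_compat_l; [nra|]. nra. }
  apply Rmult_le_reg_l with (INR N ^ 2); [now apply pow_lt|].
  unfold Rdiv. lra.
Qed.

Lemma polynomial_area (n : nat) (a : nat -> C) (d : R) : 0 < d ->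
  (forall z v, Cmod z <= 1 -> Cmod v <= 1 -> d <= Cmod (qpoly n a z v)) ->
  energy n a <= 1.
Proof.
  intros Hd Hq. destruct (polynomial_area_approx n a d Hd Hq) as (M & HM).
  apply le_epsilon. intros eps Heps.
  destruct (archimed_cor1 (eps / (Rabs M + 1))) as (k & Hk1 & Hk2).
  { apply Rdiv_lt_0_compat; auto. assert (P := Rabs_pos M). lra. }
  set (L := (2 * n + 8 + k)%nat).
  eapply Rle_trans; [apply (HM L); lia|]. apply Rplus_le_compat_l.
  assert (P := Rabs_pos M). assert (P2 := Rle_abs M).
  assert (HL : INR k <= INR L) by (apply le_INR; lia).
  assert (Hk : 0 < INR k) by now apply lt_0_INR.
  assert (HI : / INR L <= / INR k) by now apply Rinv_le_contravar.
  assert (HI0 : 0 < / INR L) by (apply Rinv_0_lt_compat; lra).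
  apply Rle_trans with ((Rabs M + 1) * / INR L); [unfold Rdiv; nra|].
  apply Rle_trans with ((Rabs M + 1) * (eps / (Rabs M + 1))); [|right; field; lra].
  apply Rmult_le_compat_l; lra.
Qed.

(** * Compactness and limits *)

(** Lebesgue number argument on a box of R^4. The local condition is imposed at every point, also
    outside [P], since the gauge must be defined on the whole box. [compactness_value] concludes
    under a double negation, hence the argument by contradiction. *)
Lemma compact_min (q : C -> C -> R) (P : C -> C -> Prop) (M : R) :
  (forall z v, P z v -> Cmod z <= M /\ Cmod v <= M) ->
  (forall z v, exists e, 0 < e /\ forall z' v', Cmod (z' - z)%C < e -> Cmod (v' - v)%C < e ->
      P z' v' -> e <= q z' v') ->
  exists d, 0 < d /\ forall z v, P z v -> d <= q z v.
Proof.
  intros HM Hloc.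
  set (pt := fun t : Compactness.Tn 4 R =>
    let '(x1, (x2, (x3, (x4, _)))) := t in (((x1, x2) : C), ((x3, x4) : C))).
  (* The factor 2 is there because the box measures distance by coordinates: two coordinates below e
     give a modulus below 2 e. *)
  assert (Hg : forall t, exists e : posreal, forall z' v',
     Cmod (z' - fst (pt t))%C < 2 * e -> Cmod (v' - snd (pt t))%C < 2 * e -> P z' v' -> e <= q z' v').
  { intros t. destruct (Hloc (fst (pt t)) (snd (pt t))) as (e & He & H).
    assert (He2 : 0 < e / 2) by lra. exists (mkposreal _ He2). simpl. intros z' v' Hz Hv HP.
    assert (A := H z' v' ltac:(lra) ltac:(lra) HP). lra. }
  set (delta := fun t => proj1_sig (constructive_indefinite_description _ (Hg t))).
  assert (Hdelta : forall t z' v', Cmod (z' - fst (pt t))%C < 2 * delta t ->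
     Cmod (v' - snd (pt t))%C < 2 * delta t -> P z' v' -> delta t <= q z' v').
  { intros t. unfold delta. destruct (constructive_indefinite_description _ (Hg t)); simpl; auto. }
  destruct (compactness_value 4 (- M, (- M, (- M, (- M, tt)))) (M, (M, (M, (M, tt)))) delta) as (d & Hd).
  exists d. split; [apply cond_pos|]. intros z v HP.
  destruct (Rle_lt_dec d (q z v)) as [H|H]; auto. exfalso.
  destruct (HM z v HP) as (Hz & Hv).
  assert (Hc : forall u : C, Cmod u <= M -> - M <= fst u <= M /\ - M <= snd u <= M).
  { intros u Hu. assert (A := Rmax_Cmod u).
    assert (A1 := Rmax_l (Rabs (fst u)) (Rabs (snd u))). assert (A2 := Rmax_r (Rabs (fst u)) (Rabs (snd u))).
    split; apply Rabs_le_between; lra. }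
  apply (Hd (fst z, (snd z, (fst v, (snd v, tt))))).
  - simpl. destruct (Hc z Hz), (Hc v Hv). tauto.
  - intros (t & _ & Hclose & Hdt). specialize (Hdelta t z v).
    destruct t as (t1 & (t2 & (t3 & (t4 & [])))). simpl in Hclose, Hdelta.
    destruct Hclose as (C1 & C2 & C3 & C4 & _).
    assert (Hb : forall x y e, Rabs x < e -> Rabs y < e -> Cmod (x, y) < 2 * e).
    { intros x y e Hx Hy. replace ((x, y) : C) with (RtoC x + Ci * RtoC y)%C
        by (apply injective_projections; simpl; ring).
      eapply Rle_lt_trans; [apply Cmod_triangle|]. rewrite Cmod_mult, Cmod_Ci, !Cmod_R. lra. }
    assert (A := Hdelta (Hb _ _ _ C1 C2) (Hb _ _ _ C3 C4) HP).
    apply (Rlt_irrefl (q z v)). eapply Rlt_le_trans; [exact H|]. eapply Rle_trans; [exact Hdt|exact A].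
Qed.

(** The compact set is coded as a sublevel set of a 1-Lipschitz function. Outside it, the Lipschitz
    bound keeps a whole neighbourhood outside; inside it, the Lipschitz bound on [q] carries |q(z,
    v)| > 0 over to nearby points. *)
Lemma compact_lower (q : C -> C -> C) (phi : C -> C -> R) (La M : R) : 0 <= La ->
  (forall z v z' v', phi z v <= phi z' v' + Cmod (z' - z)%C + Cmod (v' - v)%C) ->
  (forall z v, phi z v <= 0 -> Cmod z <= M /\ Cmod v <= M) ->
  (forall z v z' v', phi z v <= 0 -> phi z' v' <= 0 ->
     Cmod (q z' v' - q z v)%C <= La * (Cmod (z' - z)%C + Cmod (v' - v)%C)) ->
  (forall z v, phi z v <= 0 -> q z v <> RtoC 0) ->
  exists d, 0 < d /\ forall z v, phi z v <= 0 -> d <= Cmod (q z v).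
Proof.
  intros HLa Hphi HM Hlip Hne.
  apply (compact_min (fun z v => Cmod (q z v)) (fun z v => phi z v <= 0) M HM).
  intros z v. destruct (Rle_lt_dec (phi z v) 0) as [H|H].
  - assert (Hm : 0 < Cmod (q z v)) by now apply Cmod_gt_0, Hne.
    set (m := Cmod (q z v)) in *. exists (m / (4 * (La + 1))).
    assert (He : 0 < m / (4 * (La + 1))) by (apply Rdiv_lt_0_compat; lra).
    assert (E : m / (4 * (La + 1)) * (4 * (La + 1)) = m) by (field; lra).
    set (e := m / (4 * (La + 1))) in *.
    split; auto. intros z' v' Hz Hv HP.
    assert (A := Hlip z v z' v' H HP).
    assert (B := Cmod_triangle_inv (q z v) (q z' v' - q z v)%C).
    replace (q z v + (q z' v' - q z v))%C with (q z' v') in B by ring. fold m in B.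
    assert (La * (Cmod (z' - z)%C + Cmod (v' - v)%C) <= La * (2 * e)) by (apply Rmult_le_compat_l; lra).
    nra.
  - exists (phi z v / 2). split; [lra|]. intros z' v' Hz Hv HP.
    assert (A := Hphi z v z' v'). lra.
Qed.

(** A total function, so that limits can be named before convergence is known; [climit_geometric]
    makes the value meaningful. *)
Definition climit (u : nat -> C) : C :=
  (real (Lim_seq (fun n => Re (u n))), real (Lim_seq (fun n => Im (u n)))).

Definition converges (u : nat -> C) (l : C) : Prop :=
  forall eps, 0 < eps -> exists n0, forall n, (n0 <= n)%nat -> Cmod (u n - l)%C < eps.

Lemma converges_unique (u : nat -> C) (l k : C) : converges u l -> converges u k -> l = k.
Proof.
  intros Hl Hk. assert (E : Cmod (l - k)%C = 0).
  { apply Rle_antisym; [|apply Cmod_ge_0]. apply le_epsilon. intros eps Heps.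
    destruct (Hl (eps / 2) ltac:(lra)) as (n & Hn). destruct (Hk (eps / 2) ltac:(lra)) as (m & Hm).
    specialize (Hn (n + m)%nat ltac:(lia)). specialize (Hm (n + m)%nat ltac:(lia)).
    replace (l - k)%C with (- (u (n + m)%nat - l) + (u (n + m)%nat - k))%C by ring.
    eapply Rle_trans; [apply Cmod_triangle|]. rewrite Cmod_opp. lra. }
  apply Cmod_eq_0 in E. replace l with ((l - k) + k)%C by ring. rewrite E. ring.
Qed.

Lemma converges_ext (u v : nat -> C) (l : C) :
  (forall n, u n = v n) -> converges u l -> converges v l.
Proof. intros E H eps He. destruct (H eps He) as (n0 & Hn). exists n0. intros n. rewrite <- E. auto. Qed.

Lemma converges_shift (u : nat -> C) (l : C) (k : nat) :
  converges u l -> converges (fun n => u (n + k)%nat) l.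
Proof. intros H eps He. destruct (H eps He) as (n0 & Hn). exists n0. intros n Hnn. apply Hn. lia. Qed.

Lemma converges_plus (u v : nat -> C) (l k : C) :
  converges u l -> converges v k -> converges (fun n => u n + v n)%C (l + k)%C.
Proof.
  intros Hu Hv eps He.
  destruct (Hu (eps / 2) ltac:(lra)) as (n & Hn). destruct (Hv (eps / 2) ltac:(lra)) as (m & Hm).
  exists (n + m)%nat. intros i Hi. specialize (Hn i ltac:(lia)). specialize (Hm i ltac:(lia)).
  replace (u i + v i - (l + k))%C with ((u i - l) + (v i - k))%C by ring.
  eapply Rle_lt_trans; [apply Cmod_triangle|]. lra.
Qed.

Lemma converges_scal (u : nat -> C) (l c : C) :
  converges u l -> converges (fun n => c * u n)%C (c * l)%C.
Proof.
  intros Hu eps He. assert (Hc := Cmod_ge_0 c).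
  destruct (Hu (eps / (Cmod c + 1))) as (n & Hn); [apply Rdiv_lt_0_compat; lra|].
  exists n. intros i Hi. specialize (Hn i Hi).
  replace (c * u i - c * l)%C with (c * (u i - l))%C by ring. rewrite Cmod_mult.
  assert (E : eps / (Cmod c + 1) * (Cmod c + 1) = eps) by (field; lra).
  assert (H0 := Cmod_ge_0 (u i - l)%C). nra.
Qed.

Lemma converges_bound (u : nat -> C) (l k : C) (B : R) :
  converges u l -> (forall n, Cmod (u n - k)%C <= B) -> Cmod (l - k)%C <= B.
Proof.
  intros H HB. apply le_epsilon. intros eps He. destruct (H eps He) as (n & Hn).
  specialize (Hn n ltac:(lia)). specialize (HB n).
  replace (l - k)%C with (- (u n - l) + (u n - k))%C by ring.
  eapply Rle_trans; [apply Cmod_triangle|]. rewrite Cmod_opp. lra.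
Qed.

Lemma is_lim_seq_component (u : nat -> R) (v : nat -> C) (K rho : R) :
  0 <= rho < 1 -> (forall n m, Rabs (u n - u m) <= Cmod (v n - v m)%C) ->
  (forall n k, Cmod (v (n + k)%nat - v n)%C <= K * rho ^ n) ->
  is_lim_seq u (real (Lim_seq u)).
Proof.
  intros Hrho Huv Hv.
  assert (HK : 0 <= K).
  { assert (A := Hv 0%nat 0%nat). assert (B := Cmod_ge_0 (v (0 + 0)%nat - v 0%nat)%C). simpl in *. lra. }
  apply Lim_seq_correct'. apply ex_lim_seq_cauchy_corr. intros eps.
  assert (G := is_lim_seq_geom rho ltac:(rewrite Rabs_pos_eq; lra)).
  apply is_lim_seq_spec in G.
  assert (He : 0 < eps / 2 / (K + 1)) by (apply Rdiv_lt_0_compat; [apply is_pos_div_2|lra]).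
  destruct (G (mkposreal _ He)) as (n0 & Hn0). simpl in Hn0. exists n0.
  assert (E : forall n, (n0 <= n)%nat -> Cmod (v n - v n0)%C < eps / 2).
  { intros n Hn. replace n with (n0 + (n - n0))%nat by lia.
    eapply Rle_lt_trans; [apply Hv|]. specialize (Hn0 n0 (le_n n0)).
    rewrite Rminus_0_r, Rabs_pos_eq in Hn0 by (apply pow_le; lra).
    assert (P : eps / 2 / (K + 1) * (K + 1) = eps / 2) by (field; lra).
    assert (P0 : 0 <= rho ^ n0) by (apply pow_le; lra). nra. }
  intros n m Hn Hm. eapply Rle_lt_trans; [apply Huv|].
  replace (v n - v m)%C with ((v n - v n0) + - (v m - v n0))%C by ring.
  eapply Rle_lt_trans; [apply Cmod_triangle|]. rewrite Cmod_opp.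
  assert (A := E n Hn). assert (B := E m Hm). lra.
Qed.

Lemma climit_geometric (u : nat -> C) (K rho : R) : 0 <= rho < 1 ->
  (forall n, Cmod (u (S n) - u n)%C <= K * rho ^ n) ->
  converges u (climit u) /\ forall n, Cmod (climit u - u n)%C <= K / (1 - rho) * rho ^ n.
Proof.
  intros Hrho Hu.
  assert (HK : 0 <= K).
  { assert (A := Hu 0%nat). assert (B := Cmod_ge_0 (u 1%nat - u 0%nat)%C). simpl in *. lra. }
  assert (Hnk : forall n k, Cmod (u (n + k)%nat - u n)%C <= K / (1 - rho) * rho ^ n).
  { intros n k.
    assert (A : Cmod (u (n + k)%nat - u n)%C <= K * rho ^ n * rsum k (fun i => rho ^ i)).
    { induction k as [|k IH].
      - rewrite Nat.add_0_r. replace (u n - u n)%C with (RtoC 0) by ring. rewrite Cmod_0. simpl. lra.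
      - replace (u (n + S k)%nat - u n)%C with ((u (S (n + k)) - u (n + k)%nat) + (u (n + k)%nat - u n))%C
          by (replace (n + S k)%nat with (S (n + k)) by lia; ring).
        eapply Rle_trans; [apply Cmod_triangle|]. simpl rsum.
        assert (B := Hu (n + k)%nat). rewrite pow_add in B. lra. }
    eapply Rle_trans; [exact A|].
    assert (B := rsum_geometric_le rho k Hrho).
    assert (P : 0 <= K * rho ^ n) by (apply Rmult_le_pos; [lra|apply pow_le; lra]).
    unfold Rdiv. nra. }
  assert (LR := is_lim_seq_component (fun n => Re (u n)) u (K / (1 - rho)) rho Hrho).
  assert (LI := is_lim_seq_component (fun n => Im (u n)) u (K / (1 - rho)) rho Hrho).
  specialize (LR ltac:(intros n m; unfold Rminus; rewrite <- re_opp, <- re_plus; apply re_le_Cmod) Hnk).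
  assert (HIm : forall x : C, Rabs (Im x) <= Cmod x).
  { intros x. eapply Rle_trans; [apply Rmax_r|apply Rmax_Cmod]. }
  specialize (LI ltac:(intros n m; unfold Rminus; rewrite <- im_opp, <- im_plus; apply HIm) Hnk).
  assert (Hc : converges u (climit u)).
  { intros eps He. apply is_lim_seq_spec in LR. apply is_lim_seq_spec in LI.
    assert (He2 : 0 < eps / 2) by lra.
    destruct (LR (mkposreal _ He2)) as (n1 & H1). destruct (LI (mkposreal _ He2)) as (n2 & H2).
    simpl in H1, H2. exists (n1 + n2)%nat. intros n Hn.
    specialize (H1 n ltac:(lia)). specialize (H2 n ltac:(lia)).
    replace (u n - climit u)%C with (RtoC (Re (u n) - Re (climit u)) + Ci * RtoC (Im (u n) - Im (climit u)))%C
      by (generalize (climit u) (u n); intros p q; apply injective_projections; destruct p, q; simpl; ring).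
    eapply Rle_lt_trans; [apply Cmod_triangle|]. rewrite Cmod_mult, Cmod_Ci, !Cmod_R. simpl. lra. }
  split; auto. intros n.
  apply (converges_bound (fun k => u (n + k)%nat)); [|apply Hnk].
  apply converges_ext with (fun k => u (k + n)%nat); [intros; f_equal; lia|]. now apply converges_shift.
Qed.

(* With tau = t (1 + x)^3 < 1 the weight (n + 1)^2 is absorbed by two factors (1 + x)^-n
   (Bernoulli), and the third one leaves geometric decay. *)
Lemma geometric_domination (a : nat -> C) (t : R) : 0 < t < 1 ->
  (forall s, 0 < s < 1 -> exists B, forall n, Cmod (a n) * s ^ n <= B) ->
  exists K rho, 0 <= K /\ 0 <= rho < 1 /\
    forall n, Cmod (a n) * (INR n + 1) ^ 2 * t ^ n <= K * rho ^ n.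
Proof.
  (* (1 + x)^3 <= 1 + 7 x on [0, 1], and t (1 + 7 (1 - t) / 8) < 1. *)
  intros Ht Ha. set (x := (1 - t) / 8).
  assert (Hx : 0 < x < 1) by (unfold x; lra).
  assert (Htau : 0 < t * (1 + x) ^ 3 < 1).
  { split; [apply Rmult_lt_0_compat; [lra|apply pow_lt; lra]|].
    assert ((1 + x) ^ 3 <= 1 + 7 * x) by (simpl; nra).
    apply Rle_lt_trans with (t * (1 + 7 * x)); [apply Rmult_le_compat_l; lra|]. unfold x. nra. }
  destruct (Ha _ Htau) as (B & HB).
  assert (HB0 : 0 <= B).
  { specialize (HB 0%nat). simpl in HB. assert (P := Cmod_ge_0 (a 0%nat)). lra. }
  assert (Hx2 : 0 < x ^ 2) by (apply pow_lt; lra).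
  exists (B / x ^ 2), (/ (1 + x)). split; [apply Rdiv_le_0_compat; lra|].
  assert (H1x : 0 < / (1 + x) < 1).
  { split; [apply Rinv_0_lt_compat; lra|]. rewrite <- Rinv_1 at 2. apply Rinv_lt_contravar; lra. }
  split; [lra|]. intros n. specialize (HB n).
  assert (Bn := poly n x ltac:(lra)).
  set (y := (1 + x) ^ n) in *.
  assert (Hy : 0 < y) by (unfold y; apply pow_lt; lra).
  assert (Hn := pos_INR n).
  assert (Hxy : x * (INR n + 1) <= y) by nra.
  assert (Hxy2 : x ^ 2 * (INR n + 1) ^ 2 <= y ^ 2).
  { rewrite <- Rpow_mult_distr. apply pow_incr. split; [nra|exact Hxy]. }
  rewrite Rpow_mult_distr, <- pow_mult, Nat.mul_comm, pow_mult in HB. fold y in HB.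
  rewrite pow_inv. fold y.
  assert (HA : 0 <= Cmod (a n) * t ^ n) by (apply Rmult_le_pos; [apply Cmod_ge_0|apply pow_le; lra]).
  apply Rmult_le_reg_r with (x ^ 2 * y); [nra|].
  replace (B / x ^ 2 * / y * (x ^ 2 * y)) with B by (field; lra).
  eapply Rle_trans; [|exact HB].
  replace (Cmod (a n) * (INR n + 1) ^ 2 * t ^ n * (x ^ 2 * y)) with
    ((Cmod (a n) * t ^ n) * (x ^ 2 * (INR n + 1) ^ 2 * y)) by ring.
  replace (Cmod (a n) * (t ^ n * y ^ 3)) with ((Cmod (a n) * t ^ n) * (y ^ 2 * y)) by ring.
  apply Rmult_le_compat_l; auto. apply Rmult_le_compat_r; lra.
Qed.

(** * The area theorem *)

(** Radius of convergence at least 1, expressed through bounded terms. *)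
Definition subexponential (a : nat -> C) : Prop :=
  forall s, 0 < s < 1 -> exists B, forall n, Cmod (a n) * s ^ n <= B.

Definition qlim (a : nat -> C) (z v : C) : C := climit (fun n => qpoly n a z v).

Lemma Cmod_pow_le (z : C) (t : R) (k : nat) : Cmod z <= t -> Cmod (z ^ k)%C <= t ^ k.
Proof. intros H. rewrite Cmod_pow. apply pow_incr. split; [apply Cmod_ge_0|auto]. Qed.

Lemma pow_le_shift (t : R) (i k : nat) : 0 <= t <= 1 -> t ^ (k + i) <= t ^ k.
Proof.
  intros Ht. rewrite pow_add. assert (0 <= t ^ k) by (apply pow_le; lra).
  assert (t ^ i <= 1) by (rewrite <- (pow1 i); apply pow_incr; lra). nra.
Qed.

Lemma csum_S (n : nat) (f : nat -> C) : csum (S n) f = (csum n f + f n)%C.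
Proof. reflexivity. Qed.

(** The new coefficient multiplies n + 1 monomials of degree n + 2. The square of n + 1 matches the
    weight of [qpoly_lipschitz], so that [geometric_domination] serves both. *)
Lemma qpoly_step (n : nat) (a : nat -> C) (z v : C) (t : R) :
  0 <= t <= 1 -> Cmod z <= t -> Cmod v <= t ->
  Cmod (qpoly (S n) a z v - qpoly n a z v)%C <= Cmod (a n) * (INR n + 1) ^ 2 * t ^ n.
Proof.
  intros Ht Hz Hv. unfold qpoly.
  rewrite (csum_S n).
  set (x := csum n _). set (y := (a n * _)%C).
  replace (1 - (x + y) - (1 - x))%C with (- y)%C by ring. unfold y.
  rewrite Cmod_opp, Cmod_mult, Rmult_assoc. apply Rmult_le_compat_l; [apply Cmod_ge_0|].
  assert (P : 0 <= t ^ n) by (apply pow_le; lra). assert (Hn := pos_INR n).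
  apply Rle_trans with (INR (S n) * t ^ n).
  - eapply Rle_trans; [apply Cmod_csum|]. apply rsum_le_const. intros i Hi.
    eapply Rle_trans; [apply (Cmod_mult_le _ _ (t ^ S i) (t ^ S (n - i))); now apply Cmod_pow_le|].
    rewrite <- pow_add. replace (S i + S (n - i))%nat with (n + 2)%nat by lia. now apply pow_le_shift.
  - rewrite S_INR. nra.
Qed.

Lemma power_lipschitz (x y : C) (t : R) (k : nat) : Cmod x <= t -> Cmod y <= t ->
  Cmod (x ^ S k - y ^ S k)%C <= (INR k + 1) * t ^ k * Cmod (x - y)%C.
Proof.
  intros Hx Hy. induction k as [|k IH].
  - rewrite !Cpow_1_r. simpl. lra.
  - rewrite (Cpow_S x), (Cpow_S y (S k)).
    replace (x * x ^ S k - y * y ^ S k)%C with (x * (x ^ S k - y ^ S k) + (x - y) * y ^ S k)%C by ring.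
    eapply Rle_trans; [apply Cmod_triangle|].
    assert (A := Cmod_mult_le _ _ _ _ Hx IH).
    assert (B := Cmod_mult_le _ _ _ _ (Rle_refl (Cmod (x - y)%C)) (Cmod_pow_le y t (S k) Hy)).
    rewrite S_INR. simpl (t ^ S k) in *. lra.
Qed.

Lemma qpoly_lipschitz (n : nat) (a : nat -> C) (z v z' v' : C) (t : R) :
  0 <= t <= 1 -> Cmod z <= t -> Cmod v <= t -> Cmod z' <= t -> Cmod v' <= t ->
  Cmod (qpoly n a z' v' - qpoly n a z v)%C <=
    rsum n (fun m => Cmod (a m) * (INR m + 1) ^ 2 * t ^ m) * (Cmod (z' - z)%C + Cmod (v' - v)%C).
Proof.
  intros Ht Hz Hv Hz' Hv'. unfold qpoly.
  set (x := csum n _). set (y := csum n (fun m => a m * csum (S m) (fun i => z ^ S i * v ^ S (m - i)))%C).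
  replace (1 - x - (1 - y))%C with (- (x - y))%C by ring. unfold x, y.
  rewrite Cmod_opp, <- csum_minus, Rmult_comm, <- rsum_scal.
  eapply Rle_trans; [apply Cmod_csum|]. apply rsum_le. intros m _.
  set (h := Cmod (z' - z)%C). set (k := Cmod (v' - v)%C).
  assert (Hh : 0 <= h) by apply Cmod_ge_0. assert (Hk : 0 <= k) by apply Cmod_ge_0.
  set (p := csum (S m) (fun i => z' ^ S i * v' ^ S (m - i))%C).
  set (q := csum (S m) (fun i => z ^ S i * v ^ S (m - i))%C).
  replace (a m * p - a m * q)%C with (a m * (p - q))%C by ring. unfold p, q.
  rewrite Cmod_mult, <- csum_minus.
  replace ((h + k) * (Cmod (a m) * (INR m + 1) ^ 2 * t ^ m)) with
    (Cmod (a m) * (INR (S m) * ((INR m + 1) * t ^ m * (h + k)))) by (rewrite S_INR; ring).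
  apply Rmult_le_compat_l; [apply Cmod_ge_0|].
  eapply Rle_trans; [apply Cmod_csum|]. apply rsum_le_const. intros i Hi.
  replace (z' ^ S i * v' ^ S (m - i) - z ^ S i * v ^ S (m - i))%C with
    ((z' ^ S i - z ^ S i) * v' ^ S (m - i) + z ^ S i * (v' ^ S (m - i) - v ^ S (m - i)))%C by ring.
  eapply Rle_trans; [apply Cmod_triangle|].
  assert (A := Cmod_mult_le _ _ _ _ (power_lipschitz z' z t i Hz' Hz) (Cmod_pow_le v' t (S (m - i)) Hv')).
  assert (B := Cmod_mult_le _ _ _ _ (Cmod_pow_le z t (S i) Hz) (power_lipschitz v' v t (m - i) Hv' Hv)).
  fold h in A. fold k in B.
  assert (P1 : t ^ i * t ^ S (m - i) <= t ^ m).
  { rewrite <- pow_add. replace (i + S (m - i))%nat with (m + 1)%nat by lia. now apply pow_le_shift. }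
  assert (P2 : t ^ S i * t ^ (m - i) <= t ^ m).
  { rewrite <- pow_add. replace (S i + (m - i))%nat with (m + 1)%nat by lia. now apply pow_le_shift. }
  assert (I1 : INR i + 1 <= INR m + 1) by (apply Rplus_le_compat_r, le_INR; lia).
  assert (I2 : INR (m - i) + 1 <= INR m + 1) by (apply Rplus_le_compat_r, le_INR; lia).
  assert (I3 := pos_INR i). assert (I4 := pos_INR (m - i)).
  assert (Q1 : 0 <= t ^ i * t ^ S (m - i)) by (apply Rmult_le_pos; apply pow_le; lra).
  assert (Q2 : 0 <= t ^ S i * t ^ (m - i)) by (apply Rmult_le_pos; apply pow_le; lra).
  assert (R1 : (INR i + 1) * (t ^ i * t ^ S (m - i)) <= (INR m + 1) * t ^ m) by (apply Rmult_le_compat; lra).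
  assert (R2 : (INR (m - i) + 1) * (t ^ S i * t ^ (m - i)) <= (INR m + 1) * t ^ m) by (apply Rmult_le_compat; lra).
  nra.
Qed.

Lemma qlim_uniform (a : nat -> C) (t : R) : subexponential a -> 0 < t < 1 ->
  (forall z v, Cmod z <= t -> Cmod v <= t -> converges (fun n => qpoly n a z v) (qlim a z v)) /\
  forall e, 0 < e -> exists n0, forall n z v, (n0 <= n)%nat -> Cmod z <= t -> Cmod v <= t ->
    Cmod (qlim a z v - qpoly n a z v)%C <= e.
Proof.
  intros Ha Ht. destruct (geometric_domination a t Ht Ha) as (K & rho & HK & Hrho & Hdom).
  assert (G : forall z v, Cmod z <= t -> Cmod v <= t -> converges (fun n => qpoly n a z v) (qlim a z v) /\
     forall n, Cmod (qlim a z v - qpoly n a z v)%C <= K / (1 - rho) * rho ^ n).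
  { intros z v Hz Hv. apply climit_geometric; auto. intros n.
    eapply Rle_trans; [apply (qpoly_step n a z v t); auto; lra|apply Hdom]. }
  split; [intros; now apply G|]. intros e He.
  assert (L := is_lim_seq_geom rho ltac:(rewrite Rabs_pos_eq; lra)). apply is_lim_seq_spec in L.
  assert (HK1 : 0 <= K / (1 - rho)) by (apply Rdiv_le_0_compat; lra).
  assert (He2 : 0 < e / (K / (1 - rho) + 1)) by (apply Rdiv_lt_0_compat; lra).
  destruct (L (mkposreal _ He2)) as (n0 & H0). simpl in H0. exists n0. intros n z v Hn Hz Hv.
  eapply Rle_trans; [now apply G|]. specialize (H0 n Hn).
  rewrite Rminus_0_r, Rabs_pos_eq in H0 by (apply pow_le; lra).
  assert (P : e / (K / (1 - rho) + 1) * (K / (1 - rho) + 1) = e) by (field; split; lra).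
  assert (P0 : 0 <= rho ^ n) by (apply pow_le; lra). nra.
Qed.

Lemma qlim_lipschitz (a : nat -> C) (t : R) : subexponential a -> 0 < t < 1 ->
  exists La, 0 <= La /\ forall z v z' v', Cmod z <= t -> Cmod v <= t -> Cmod z' <= t -> Cmod v' <= t ->
    Cmod (qlim a z' v' - qlim a z v)%C <= La * (Cmod (z' - z)%C + Cmod (v' - v)%C).
Proof.
  intros Ha Ht. destruct (geometric_domination a t Ht Ha) as (K & rho & HK & Hrho & Hdom).
  destruct (qlim_uniform a t Ha Ht) as (Hc & _).
  exists (K / (1 - rho)). split; [apply Rdiv_le_0_compat; lra|].
  intros z v z' v' Hz Hv Hz' Hv'.
  assert (Hd : converges (fun n => qpoly n a z' v' + - (1) * qpoly n a z v)%C (qlim a z' v' + - (1) * qlim a z v)%C).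
  { apply converges_plus; [now apply Hc|]. now apply converges_scal, Hc. }
  assert (B := converges_bound _ _ (RtoC 0) (K / (1 - rho) * (Cmod (z' - z)%C + Cmod (v' - v)%C)) Hd).
  replace (qlim a z' v' - qlim a z v)%C with (qlim a z' v' + - (1) * qlim a z v - 0)%C by ring.
  apply B. intros n.
  replace (qpoly n a z' v' + - (1) * qpoly n a z v - 0)%C with (qpoly n a z' v' - qpoly n a z v)%C by ring.
  eapply Rle_trans; [apply (qpoly_lipschitz n a z v z' v' t); auto; lra|].
  apply Rmult_le_compat_r; [apply Rplus_le_le_0_compat; apply Cmod_ge_0|].
  apply Rle_trans with (rsum n (fun i => K * rho ^ i)); [apply rsum_le; auto|].
  rewrite rsum_scal. apply Rmult_le_compat_l; auto. now apply rsum_geometric_le.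
Qed.

(* Maximum modulus principle for 1 / qpoly, read off the discrete mean value property. *)
Lemma minimum_modulus (n : nat) (a : nat -> C) (z0 v : C) (r d m : R) : 0 < d -> 0 < m -> 0 <= r ->
  (forall x, Cmod x <= 1 -> d <= Cmod (qpoly n a (z0 + r * x)%C v)) ->
  (forall x, Cmod x = 1 -> m <= Cmod (qpoly n a (z0 + r * x)%C v)) ->
  m <= Cmod (qpoly n a z0 v).
Proof.
  intros Hd Hm Hr Hlow Hcirc.
  set (U := fun _ : unit => True).
  assert (T : taylor U (fun _ x => / qpoly n a (z0 + r * x)%C v)%C).
  { apply (taylor_inv U (fun _ x => qpoly n a (z0 + r * x)%C v) d Hd); [intros; now apply Hlow|].
    apply (taylor_qpoly U n a (fun _ x => z0 + r * x)%C (fun _ _ => v)).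
    - apply taylor_plus; [|apply taylor_scal, taylor_id].
      apply (taylor_const U (fun _ => z0) (Cmod z0)). intros; lra.
    - apply (taylor_const U (fun _ => v) (Cmod v)). intros; lra. }
  destruct (discrete_mean_value U _ T) as (B & HB & H).
  replace (z0 + r * 0)%C with z0 in H by ring.
  assert (Hq0 : 0 < Cmod (qpoly n a z0 v)).
  { specialize (Hlow (RtoC 0)). rewrite Cmod_0 in Hlow. replace (z0 + r * 0)%C with z0 in Hlow by ring.
    assert (d <= Cmod (qpoly n a z0 v)) by (apply Hlow; lra). lra. }
  assert (Hne : qpoly n a z0 v <> RtoC 0) by now apply Cmod_gt_0.
  assert (Hinv : / Cmod (qpoly n a z0 v) <= / m).
  { apply le_epsilon. intros e He.
    destruct (archimed_cor1 (e / (B + 1))) as (k & Hk1 & Hk2); [apply Rdiv_lt_0_compat; lra|].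
    set (N := (k + 2)%nat).
    destruct (primitive_root_exists N ltac:(unfold N; lia)) as (w & Hw).
    specialize (H N w tt ltac:(unfold N; lia) Hw I).
    assert (HN : 0 < INR N) by (apply lt_0_INR; unfold N; lia).
    assert (A : INR N * / Cmod (qpoly n a z0 v) <= INR N * / m + B).
    { rewrite <- Cmod_inv by auto.
      replace (INR N * Cmod (/ qpoly n a z0 v)%C) with (Cmod (INR N * / qpoly n a z0 v)%C)
        by (rewrite Cmod_mult, Cmod_R, Rabs_pos_eq; lra).
      replace (INR N * / qpoly n a z0 v)%C with
        (csum N (fun j => / qpoly n a (z0 + r * w ^ j) v)%C +
         - (csum N (fun j => / qpoly n a (z0 + r * w ^ j) v)%C - INR N * / qpoly n a z0 v))%C by ring.
      eapply Rle_trans; [apply Cmod_triangle|]. rewrite Cmod_opp.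
      apply Rplus_le_compat; [|exact H].
      eapply Rle_trans; [apply Cmod_csum|]. apply rsum_le_const. intros j _.
      assert (Hj : Cmod (w ^ j)%C = 1) by apply Cmod_pow_unit, Hw.
      assert (P := Hcirc _ Hj).
      rewrite Cmod_inv by (apply Cmod_gt_0; lra). now apply Rinv_le_contravar. }
    apply Rmult_le_reg_l with (INR N); auto. rewrite Rmult_plus_distr_l.
    eapply Rle_trans; [exact A|]. apply Rplus_le_compat_l.
    assert (Hk : 0 < INR k) by now apply lt_0_INR.
    assert (HkN : INR k <= INR N) by (apply le_INR; unfold N; lia).
    assert (E : e / (B + 1) * (B + 1) = e) by (field; lra).
    assert (Hk3 : 1 < INR k * (e / (B + 1))).
    { apply Rmult_lt_reg_l with (/ INR k); [now apply Rinv_0_lt_compat|].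
      rewrite <- Rmult_assoc, Rinv_l, Rmult_1_r, Rmult_1_l by lra. exact Hk1. }
    assert (He2 : 0 < e / (B + 1)) by (apply Rdiv_lt_0_compat; lra).
    set (y := e / (B + 1)) in *. rewrite <- E.
    assert (1 <= INR N * y) by nra. nra. }
  apply Rnot_lt_le. intros Hlt. apply (Rlt_irrefl (/ m)).
  eapply Rlt_le_trans; [|exact Hinv]. apply Rinv_lt_contravar; auto. now apply Rmult_lt_0_compat.
Qed.

Lemma Cmod_minus_triangle (x y : C) : Cmod x <= Cmod y + Cmod (x - y)%C.
Proof. replace x with (y + (x - y))%C at 1 by ring. apply Cmod_triangle. Qed.

(* Hurwitz: near a diagonal zero z0 the functions z -> qlim z v keep away from 0 on a small circle
   around z0 but are small at z0, so they vanish inside it, which off the diagonal is excluded. *)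
Lemma diagonal_zero_open (a : nat -> C) (z0 : C) : subexponential a ->
  (forall z v, Cmod z < 1 -> Cmod v < 1 -> z <> v -> qlim a z v <> RtoC 0) ->
  Cmod z0 < 1 -> qlim a z0 z0 = RtoC 0 ->
  exists r, 0 < r /\ forall v, Cmod (v - z0)%C < r -> qlim a v v = RtoC 0.
Proof.
  intros Ha Hoff Hz0 Hzero. assert (H00 := Cmod_ge_0 z0).
  set (r := (1 - Cmod z0) / 2). set (t := (1 + Cmod z0) / 2).
  assert (Hr : 0 < r) by (unfold r; lra).
  assert (Ht : 0 < t < 1) by (unfold t; lra).
  assert (Hrt : Cmod z0 + r <= t) by (unfold r, t; lra).
  destruct (qlim_lipschitz a t Ha Ht) as (La & HLa & Hlip).
  destruct (qlim_uniform a t Ha Ht) as (_ & Hunif).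
  assert (Hball : forall z, Cmod (z - z0)%C <= r -> Cmod z <= t).
  { intros z Hz. assert (A := Cmod_minus_triangle z z0). lra. }
  assert (HP : forall z v, Rmax (Rabs (Cmod (z - z0)%C - r)) (Cmod (v - z0)%C) <= 0 ->
     Cmod (z - z0)%C = r /\ Cmod (v - z0)%C <= 0).
  { intros z v H.
    assert (M1 := Rmax_l (Rabs (Cmod (z - z0)%C - r)) (Cmod (v - z0)%C)).
    assert (M2 := Rmax_r (Rabs (Cmod (z - z0)%C - r)) (Cmod (v - z0)%C)).
    assert (Q : Rabs (Cmod (z - z0)%C - r) <= 0) by lra. apply Rabs_le_between in Q. lra. }
  (* The compact set is the circle |z - z0| = r times the point z0; it misses the diagonal. *)
  destruct (compact_lower (qlim a) (fun z v => Rmax (Rabs (Cmod (z - z0)%C - r)) (Cmod (v - z0)%C)) La t HLa)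
    as (d & Hd & Hcirc).
  - intros z v z' v'.
    assert (A := Cmod_minus_triangle (v - z0)%C (v' - z0)%C).
    replace (v - z0 - (v' - z0))%C with (- (v' - v))%C in A by ring. rewrite Cmod_opp in A.
    assert (B1 := Cmod_minus_triangle (z - z0)%C (z' - z0)%C).
    replace (z - z0 - (z' - z0))%C with (- (z' - z))%C in B1 by ring. rewrite Cmod_opp in B1.
    assert (B2 := Cmod_minus_triangle (z' - z0)%C (z - z0)%C).
    replace (z' - z0 - (z - z0))%C with (z' - z)%C in B2 by ring.
    assert (P1 := Cmod_ge_0 (z' - z)%C). assert (P2 := Cmod_ge_0 (v' - v)%C).
    apply Rmax_lub.
    + assert (M := Rmax_l (Rabs (Cmod (z' - z0)%C - r)) (Cmod (v' - z0)%C)).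
      assert (Q : Rabs (Cmod (z - z0)%C - r) <= Rabs (Cmod (z' - z0)%C - r) + Cmod (z' - z)%C).
      { replace (Cmod (z - z0)%C - r) with ((Cmod (z' - z0)%C - r) + (Cmod (z - z0)%C - Cmod (z' - z0)%C)) by ring.
        eapply Rle_trans; [apply Rabs_triang|]. apply Rplus_le_compat_l, Rabs_le. lra. }
      lra.
    + assert (M := Rmax_r (Rabs (Cmod (z' - z0)%C - r)) (Cmod (v' - z0)%C)). lra.
  - intros z v H. apply HP in H. split; apply Hball; lra.
  - intros z v z' v' H H'. apply HP in H. apply HP in H'. apply Hlip; apply Hball; lra.
  - intros z v H. apply HP in H.
    assert (Bz := Hball z ltac:(lra)). assert (Bv := Hball v ltac:(lra)).
    apply Hoff; [lra|lra|]. intros ->. lra.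
  - assert (E4 : d / (4 * (La + 1)) * (4 * (La + 1)) = d) by (field; lra).
    assert (E0 : 0 < d / (4 * (La + 1))) by (apply Rdiv_lt_0_compat; lra).
    set (e := d / (4 * (La + 1))) in *.
    exists (Rmin r e). split; [now apply Rmin_glb_lt|]. intros v Hv.
    assert (Hvr : Cmod (v - z0)%C < r) by (eapply Rlt_le_trans; [exact Hv|apply Rmin_l]).
    assert (Hve : Cmod (v - z0)%C < e) by (eapply Rlt_le_trans; [exact Hv|apply Rmin_r]).
    assert (Hvt : Cmod v <= t) by (apply Hball; lra).
    assert (Hz0t : Cmod z0 <= t) by lra.
    destruct (classic (qlim a v v = RtoC 0)) as [|Hvv]; auto. exfalso.
    assert (HLe : La * Cmod (v - z0)%C <= d / 4) by nra.
    assert (C1 : forall z, Cmod (z - z0)%C = r -> d - d / 4 <= Cmod (qlim a z v)).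
    { intros z Hz. assert (Hzt : Cmod z <= t) by (apply Hball; lra).
      assert (A : d <= Cmod (qlim a z z0)).
      { apply Hcirc. replace (z0 - z0)%C with (RtoC 0) by ring. rewrite Cmod_0, Hz.
        replace (r - r) with 0 by ring. rewrite Rabs_R0. rewrite Rmax_left; lra. }
      assert (L := Hlip z z0 z v Hzt Hz0t Hzt Hvt).
      replace (z - z)%C with (RtoC 0) in L by ring. rewrite Cmod_0, Rplus_0_l in L.
      assert (B := Cmod_minus_triangle (qlim a z z0) (qlim a z v)).
      rewrite Cmod_minus_sym in B. lra. }
    assert (C2 : Cmod (qlim a z0 v) <= d / 4).
    { assert (L := Hlip z0 z0 z0 v Hz0t Hz0t Hz0t Hvt).
      replace (z0 - z0)%C with (RtoC 0) in L by ring. rewrite Cmod_0, Rplus_0_l, Hzero in L.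
      replace (qlim a z0 v - 0)%C with (qlim a z0 v) in L by ring. lra. }
    (* Assuming q(v, v) is not 0, the function has no zero on the closed disk. The second variable
       [u] is a dummy confined to 0. *)
    destruct (compact_lower (fun z _ => qlim a z v) (fun z u => Rmax (Cmod (z - z0)%C - r) (Cmod u)) La t HLa)
      as (d' & Hd' & Hdisk).
    + intros z u z' u'.
      assert (A := Cmod_minus_triangle u u'). rewrite Cmod_minus_sym in A.
      assert (B1 := Cmod_minus_triangle (z - z0)%C (z' - z0)%C).
      replace (z - z0 - (z' - z0))%C with (- (z' - z))%C in B1 by ring. rewrite Cmod_opp in B1.
      assert (P1 := Cmod_ge_0 (z' - z)%C). assert (P2 := Cmod_ge_0 (u' - u)%C).
      assert (M := Rmax_l (Cmod (z' - z0)%C - r) (Cmod u')).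
      assert (M' := Rmax_r (Cmod (z' - z0)%C - r) (Cmod u')).
      apply Rmax_lub; lra.
    + intros z u H. assert (M := Rmax_l (Cmod (z - z0)%C - r) (Cmod u)).
      assert (M' := Rmax_r (Cmod (z - z0)%C - r) (Cmod u)). split; [apply Hball; lra|lra].
    + intros z u z' u' H H'.
      assert (M := Rmax_l (Cmod (z - z0)%C - r) (Cmod u)).
      assert (M' := Rmax_l (Cmod (z' - z0)%C - r) (Cmod u')).
      assert (P2 := Cmod_ge_0 (u' - u)%C).
      assert (L := Hlip z v z' v ltac:(apply Hball; lra) Hvt ltac:(apply Hball; lra) Hvt).
      replace (v - v)%C with (RtoC 0) in L by ring. rewrite Cmod_0, Rplus_0_r in L.
      eapply Rle_trans; [exact L|]. apply Rmult_le_compat_l; lra.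
    + intros z u H. assert (M := Rmax_l (Cmod (z - z0)%C - r) (Cmod u)).
      destruct (classic (z = v)) as [->|Hne]; auto.
      assert (B := Hball z ltac:(lra)). apply Hoff; auto; lra.
    (* Accuracy d' / 2 keeps the truncation zero-free on the disk, accuracy d / 8 preserves the gap:
       at least 3 d / 4 - d / 8 = 5 d / 8 on the circle, at most d / 4 + d / 8 = 3 d / 8 at the
       centre. *)
    + assert (Heps : 0 < Rmin (d' / 2) (d / 8)) by (apply Rmin_glb_lt; lra).
      destruct (Hunif _ Heps) as (n & Hn). specialize (Hn n).
      assert (R1 := Rmin_l (d' / 2) (d / 8)). assert (R2 := Rmin_r (d' / 2) (d / 8)).
      assert (Happrox : forall z, Cmod z <= t -> Cmod (qlim a z v) - Rmin (d' / 2) (d / 8) <= Cmod (qpoly n a z v)).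
      { intros z Hz. assert (A := Hn z v (le_n n) Hz Hvt).
        assert (B := Cmod_minus_triangle (qlim a z v) (qpoly n a z v)). lra. }
      assert (Hx : forall x, Cmod (z0 + r * x - z0)%C = r * Cmod x).
      { intros x. replace (z0 + r * x - z0)%C with (r * x)%C by ring.
        rewrite Cmod_mult, Cmod_R, Rabs_pos_eq; lra. }
      assert (A := minimum_modulus n a z0 v r (d' / 2) (5 * d / 8) ltac:(lra) ltac:(lra) ltac:(lra)).
      assert (B : 5 * d / 8 <= Cmod (qpoly n a z0 v)).
      { apply A.
        - intros x Hx1. assert (Hzx : Cmod (z0 + r * x - z0)%C <= r) by (rewrite Hx; nra).
          assert (B := Happrox _ (Hball _ Hzx)).
          assert (D := Hdisk (z0 + r * x)%C (RtoC 0)). rewrite Cmod_0 in D.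
          assert (D' : d' <= Cmod (qlim a (z0 + r * x)%C v)) by (apply D; rewrite Rmax_right; lra).
          lra.
        - intros x Hx1. assert (Hzx : Cmod (z0 + r * x - z0)%C = r) by (rewrite Hx, Hx1; ring).
          assert (B := Happrox (z0 + r * x)%C (Hball (z0 + r * x)%C (Req_le _ _ Hzx))).
          assert (D := C1 _ Hzx). lra. }
      assert (D := Hn z0 v (le_n n) Hz0t Hvt).
      assert (D2 := Cmod_minus_triangle (qpoly n a z0 v) (qlim a z0 v)).
      rewrite Cmod_minus_sym in D2. lra.
Qed.

(** On the segment from z to 0 the zeros of q(s z, s z) form a closed set by the Lipschitz bound and
    an open one by [diagonal_zero_open]. A zero at s = 1 would thus spread to s = 0, where q = 1.
    For the series of a univalent f this says that f' has no zero. *)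
Lemma diagonal_nonzero (a : nat -> C) : subexponential a ->
  (forall z v, Cmod z < 1 -> Cmod v < 1 -> z <> v -> qlim a z v <> RtoC 0) ->
  forall z, Cmod z < 1 -> qlim a z z <> RtoC 0.
Proof.
  intros Ha Hoff z Hz Hzero. assert (Hz0 := Cmod_ge_0 z).
  set (E := fun s : R => qlim a (s * z)%C (s * z)%C = RtoC 0).
  assert (Hsz : forall s, 0 <= s <= 1 -> Cmod (s * z)%C <= Cmod z).
  { intros s Hs. rewrite Cmod_mult, Cmod_R, Rabs_pos_eq by lra. nra. }
  assert (Hst : forall s s' : R, Cmod (s * z - s' * z)%C <= Rabs (s - s')).
  { intros s s'. replace (s * z - s' * z)%C with (RtoC (s - s') * z)%C by (rewrite RtoC_minus; ring).
    rewrite Cmod_mult, Cmod_R. assert (P := Rabs_pos (s - s')). nra. }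
  assert (HE0 : ~ E 0).
  { unfold E. replace (0 * z)%C with (RtoC 0) by ring. intros H.
    destruct (qlim_uniform a (/ 2) Ha ltac:(lra)) as (_ & Hu).
    destruct (Hu (/ 2) ltac:(lra)) as (n & Hn).
    specialize (Hn n (RtoC 0) (RtoC 0) (le_n n)). rewrite Cmod_0, H, qpoly_0_l in Hn.
    replace (0 - 1)%C with (- (1))%C in Hn by ring. rewrite Cmod_opp, Cmod_1 in Hn.
    assert (1 <= / 2) by (apply Hn; lra). lra. }
  assert (HE1 : E 1) by (unfold E; now rewrite Cmult_1_l).
  (* Lengths u for which the zeros fill [1 - u, 1]; the supremum is shown to be attained and then
     exceeded. *)
  set (A := fun u => 0 <= u <= 1 /\ forall s, 1 - u <= s <= 1 -> E s).
  destruct (completeness A) as (u & Hub & Hlub).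
  { exists 1. intros x (Hx & _). lra. }
  { exists 0. split; [lra|]. intros s Hs. replace s with 1 by lra. exact HE1. }
  assert (HA0 : A 0).
  { split; [lra|]. intros s Hs. replace s with 1 by lra. exact HE1. }
  assert (Hu01 : 0 <= u <= 1).
  { split; [now apply Hub|]. apply Hlub. intros x (Hx & _). lra. }
  assert (Hclose : forall e, 0 < e -> exists x, A x /\ u - e < x).
  { intros e He. destruct (classic (exists x, A x /\ u - e < x)) as [|Hn]; auto. exfalso.
    assert (u <= u - e); [|lra]. apply Hlub. intros x Hx. apply Rnot_lt_le. intros Hlt. apply Hn. eauto. }
  assert (HEu : E (1 - u)).
  { destruct (classic (E (1 - u))) as [|Hne]; auto. exfalso.
    set (t := (1 + Cmod z) / 2). assert (Ht : 0 < t < 1) by (unfold t; lra).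
    assert (Hzt : Cmod z <= t) by (unfold t; lra).
    destruct (qlim_lipschitz a t Ha Ht) as (La & HLa & Hlip).
    assert (Hm : 0 < Cmod (qlim a ((1 - u)%R * z)%C ((1 - u)%R * z)%C)) by now apply Cmod_gt_0.
    set (m := Cmod (qlim a ((1 - u)%R * z)%C ((1 - u)%R * z)%C)) in *.
    destruct (Hclose (m / (4 * (La + 1)))) as (x & (Hx & HxE) & Hxu); [apply Rdiv_lt_0_compat; lra|].
    assert (Hxle : x <= u) by (apply Hub; split; auto).
    assert (Ex := HxE (1 - x) ltac:(lra)). unfold E in Ex.
    assert (S1 := Hsz (1 - x) ltac:(lra)). assert (S2 := Hsz (1 - u) ltac:(lra)).
    assert (L := Hlip ((1 - x)%R * z)%C ((1 - x)%R * z)%C ((1 - u)%R * z)%C ((1 - u)%R * z)%C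
      ltac:(lra) ltac:(lra) ltac:(lra) ltac:(lra)).
    rewrite Ex in L. replace (qlim a ((1 - u)%R * z) ((1 - u)%R * z) - 0)%C with (qlim a ((1 - u)%R * z)%C ((1 - u)%R * z)%C) in L by ring.
    fold m in L. assert (D := Hst (1 - u) (1 - x)). rewrite Rabs_left1 in D by lra.
    assert (F : m / (4 * (La + 1)) * (4 * (La + 1)) = m) by (field; lra).
    set (e := m / (4 * (La + 1))) in *.
    set (h := Cmod ((1 - u)%R * z - (1 - x)%R * z)%C) in *.
    assert (Hh : h <= e) by lra. assert (La * (h + h) <= La * (2 * e)) by (apply Rmult_le_compat_l; lra).
    nra. }
  destruct (diagonal_zero_open a ((1 - u)%R * z)%C Ha Hoff) as (r & Hr & Hopen).
  { assert (S2 := Hsz (1 - u) ltac:(lra)). lra. }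
  { exact HEu. }
  destruct (Rle_lt_dec 1 u) as [H1|H1].
  { apply HE0. replace 0 with (1 - u) by lra. exact HEu. }
  assert (HA : A (Rmin 1 (u + r / 2))).
  { assert (M1 := Rmin_l 1 (u + r / 2)). assert (M2 := Rmin_r 1 (u + r / 2)).
    assert (M3 : u <= Rmin 1 (u + r / 2)) by (apply Rmin_glb; lra).
    split; [lra|]. intros s Hs.
    destruct (Rle_lt_dec s (1 - u)) as [Hsu|Hsu].
    - refine (Hopen (s * z)%C _). eapply Rle_lt_trans; [apply Hst|]. rewrite Rabs_left1; lra.
    - destruct (Hclose (s - (1 - u)) ltac:(lra)) as (x & (Hx & HxE) & Hxu). apply HxE. lra. }
  assert (Q := Hub _ HA).
  assert (u < Rmin 1 (u + r / 2)) by (apply Rmin_glb_lt; lra). lra.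
Qed.

(** Compactness bounds the limit kernel below on the bidisk of radius t, and uniform convergence
    leaves half of that bound to all long truncations. *)
Lemma qpoly_lower_bound (a : nat -> C) (t : R) : subexponential a ->
  (forall z v, Cmod z < 1 -> Cmod v < 1 -> z <> v -> qlim a z v <> RtoC 0) -> 0 < t < 1 ->
  exists d n0, 0 < d /\ forall n z v, (n0 <= n)%nat -> Cmod z <= t -> Cmod v <= t ->
    d <= Cmod (qpoly n a z v).
Proof.
  intros Ha Hoff Ht.
  destruct (qlim_lipschitz a t Ha Ht) as (La & HLa & Hlip).
  destruct (qlim_uniform a t Ha Ht) as (_ & Hunif).
  assert (HM : forall z v, Rmax (Cmod z) (Cmod v) - t <= 0 -> Cmod z <= t /\ Cmod v <= t).
  { intros z v H. assert (A := Rmax_l (Cmod z) (Cmod v)). assert (B := Rmax_r (Cmod z) (Cmod v)). lra. }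
  destruct (compact_lower (qlim a) (fun z v => Rmax (Cmod z) (Cmod v) - t) La t HLa) as (d & Hd & Hlow); auto.
  - intros z v z' v'.
    assert (A := Cmod_minus_triangle z z'). rewrite Cmod_minus_sym in A.
    assert (B := Cmod_minus_triangle v v'). rewrite Cmod_minus_sym in B.
    assert (M := Rmax_l (Cmod z') (Cmod v')). assert (M' := Rmax_r (Cmod z') (Cmod v')).
    assert (P1 := Cmod_ge_0 (z' - z)%C). assert (P2 := Cmod_ge_0 (v' - v)%C).
    assert (Rmax (Cmod z) (Cmod v) <= Rmax (Cmod z') (Cmod v') + Cmod (z' - z)%C + Cmod (v' - v)%C)
      by (apply Rmax_lub; lra). lra.
  - intros z v z' v' H H'. apply HM in H. apply HM in H'. now apply Hlip.
  - intros z v H. apply HM in H.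
    destruct (classic (z = v)) as [->|Hne]; [apply diagonal_nonzero; auto; lra|apply Hoff; auto; lra].
  - destruct (Hunif (d / 2) ltac:(lra)) as (n0 & Hn0). exists (d / 2), n0. split; [lra|].
    intros n z v Hn Hz Hv.
    assert (A := Hn0 n z v Hn Hz Hv). assert (B := Cmod_minus_triangle (qlim a z v) (qpoly n a z v)).
    assert (D : d <= Cmod (qlim a z v)).
    { apply Hlow. assert (Rmax (Cmod z) (Cmod v) <= t) by now apply Rmax_lub. lra. }
    lra.
Qed.

Lemma bernoulli_one_minus (x : R) (k : nat) : 0 <= x <= 1 -> 1 - INR k * x <= (1 - x) ^ k.
Proof.
  intros Hx. induction k as [|k IH]; [simpl; lra|].
  rewrite S_INR. simpl. assert (0 <= INR k) by apply pos_INR. nra.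
Qed.

(** The dilation z -> t z turns a_m into a_m t^(m + 2) and the closed unit bidisk into the bidisk of
    radius t, where long truncations satisfy the polynomial hypothesis. For m < n the loss is at
    most the factor t^(2 n + 4), which tends to 1 with t. *)
Lemma area_inequality (a : nat -> C) : subexponential a ->
  (forall z v, Cmod z < 1 -> Cmod v < 1 -> z <> v -> qlim a z v <> RtoC 0) ->
  forall n, energy n a <= 1.
Proof.
  intros Ha Hoff n.
  assert (Ht : forall t, 0 < t < 1 -> t ^ (2 * n + 4) * energy n a <= 1).
  { intros t Ht. destruct (qpoly_lower_bound a t Ha Hoff Ht) as (d & n0 & Hd & Hlow).
    set (a' := fun m => (a m * t ^ (m + 2))%C). set (n1 := (n + n0)%nat).
    assert (HE : energy n1 a' <= 1).
    { apply (polynomial_area n1 a' d Hd). intros z v Hz Hv.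
      replace (qpoly n1 a' z v) with (qpoly n1 a (t * z)%C (t * v)%C).
      - assert (Hs : forall x, Cmod x <= 1 -> Cmod (t * x)%C <= t).
        { intros x Hx. rewrite Cmod_mult, Cmod_R, Rabs_pos_eq by lra. nra. }
        apply Hlow; auto. unfold n1. lia.
      - unfold qpoly. f_equal. apply csum_ext. intros m _. unfold a'.
        rewrite (csum_ext (S m) _ (fun i => t ^ (m + 2) * (z ^ S i * v ^ S (m - i)))%C).
        + rewrite csum_scal. ring.
        + intros i Hi. rewrite !Cpow_mult_l. replace (m + 2)%nat with (S i + S (m - i))%nat by lia.
          rewrite Cpow_add_r. ring. }
    eapply Rle_trans; [|exact HE].
    apply Rle_trans with (energy n a').
    - unfold energy. rewrite <- rsum_scal. apply rsum_le. intros m Hm. unfold a'.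
      rewrite Cmod_mult, Rpow_mult_distr, <- RtoC_pow, Cmod_R, pow2_abs, <- pow_mult.
      assert (P : t ^ (2 * n + 4) <= t ^ ((m + 2) * 2)).
      { replace (2 * n + 4)%nat with ((m + 2) * 2 + 2 * (n - m))%nat by lia. apply pow_le_shift. lra. }
      assert (Q : 0 <= INR (S m) * Cmod (a m) ^ 2) by (apply Rmult_le_pos; [apply pos_INR|apply pow2_ge_0]).
      nra.
    - apply rsum_le_length; [|unfold n1; lia].
      intros l. apply Rmult_le_pos; [apply pos_INR|apply pow2_ge_0]. }
  set (k := (2 * n + 4)%nat) in *. set (e := energy n a) in *.
  assert (He : 0 <= e) by apply energy_nonneg.
  apply le_epsilon. intros eps Heps.
  assert (Hk := pos_INR k).
  set (D := INR k * e + eps + 1). assert (HD : 0 < D) by (unfold D; nra).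
  (* With t = 1 - x, Bernoulli gives t^k >= 1 - k x, and this x makes k x e <= eps / 2. *)
  set (x := eps / (2 * D)).
  assert (HxD : x * (2 * D) = eps) by (unfold x; field; lra).
  assert (Hx : 0 < x < 1).
  { assert (0 < x) by (apply Rdiv_lt_0_compat; lra). split; auto. unfold D in *. nra. }
  assert (A := Ht (1 - x) ltac:(lra)).
  assert (B := bernoulli_one_minus x k ltac:(lra)).
  assert ((1 - INR k * x) * e <= 1) by nra.
  assert (x * (INR k * e) <= eps / 2) by (unfold D in HxD; nra).
  lra.
Qed.

(** * Power series and the constant r0 *)

Lemma pow_n_Cpow (z : C) (k : nat) : @pow_n C_AbsRing z k = (z ^ k)%C.
Proof. induction k as [|k IH]; [reflexivity|]. simpl. rewrite IH. reflexivity. Qed.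

Lemma is_pseries_converges (b : nat -> C) (z l : C) :
  is_pseries b z l -> converges (fun n => csum n (fun k => b k * z ^ k)%C) l.
Proof.
  intros H eps He.
  assert (A := proj1 (filterlim_locally_ball_norm _ _) H (mkposreal eps He)).
  destruct A as (n0 & Hn0). exists (S n0). intros n Hn.
  destruct n as [|n]; [lia|]. specialize (Hn0 n ltac:(lia)).
  unfold ball_norm in Hn0. rewrite csum_sum_n in Hn0.
  rewrite (csum_ext _ _ (fun k => b k * z ^ k)%C) in Hn0.
  - exact Hn0.
  - intros k _. rewrite pow_n_Cpow. apply Cmult_comm.
Qed.

Lemma converges_terms_bounded (f : nat -> C) (l : C) :
  converges (fun n => csum n f) l -> exists B, forall n, Cmod (f n) <= B.
Proof.
  intros H. destruct (H 1 Rlt_0_1) as (n0 & Hn0).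
  assert (Hpos : forall m, 0 <= rsum m (fun k => Cmod (f k))).
  { intros m. apply rsum_nonneg. intros; apply Cmod_ge_0. }
  exists (rsum n0 (fun k => Cmod (f k)) + 2). intros n.
  destruct (Nat.lt_ge_cases n n0) as [Hn|Hn].
  - assert (A := rsum_le_length (S n) n0 (fun k => Cmod (f k)) (fun k => Cmod_ge_0 _) Hn).
    simpl in A. assert (B := Hpos n). lra.
  - assert (A := Hn0 n Hn). assert (B := Hn0 (S n) ltac:(lia)). simpl in B.
    replace (f n) with ((csum n f + f n - l) + - (csum n f - l))%C by ring.
    eapply Rle_trans; [apply Cmod_triangle|]. rewrite Cmod_opp. assert (P := Hpos n0). lra.
Qed.

Lemma subexponential_shift (a : nat -> C) : subexponential a -> subexponential (fun n => a (S n)).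
Proof.
  intros H s Hs. destruct (H s Hs) as (B & HB). exists (B / s). intros n.
  specialize (HB (S n)). simpl in HB. apply Rmult_le_reg_r with s; [lra|].
  replace (B / s * s) with B by (field; lra). lra.
Qed.

Lemma quadratic_is_derive (f : C -> C) (z l : C) (K r : R) : 0 < r -> 0 <= K ->
  (forall y, Cmod (y - z)%C < r -> Cmod (f y - f z - l * (y - z))%C <= K * Cmod (y - z)%C ^ 2) ->
  is_derive f z l.
Proof.
  intros Hr HK H. split; [apply is_linear_scal_l|].
  intros x Hx.
  assert (E : z = x) by exact (@is_filter_lim_locally_unique C_AbsRing (AbsRing_NormedModule C_AbsRing) z x Hx).
  subst x.
  intros eps.
  assert (Hd : 0 < Rmin r (eps / (K + 1))).
  { apply Rmin_glb_lt; auto. apply Rdiv_lt_0_compat; [apply cond_pos|lra]. }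
  exists (mkposreal _ Hd). intros y Hy. change (Cmod (y - z)%C < Rmin r (eps / (K + 1))) in Hy.
  change (Cmod (f y - f z - (y - z) * l)%C <= eps * Cmod (y - z)%C).
  assert (H1 := Rmin_l r (eps / (K + 1))). assert (H2 := Rmin_r r (eps / (K + 1))).
  rewrite (Cmult_comm (y - z)). eapply Rle_trans; [apply H; lra|].
  assert (E : eps / (K + 1) * (K + 1) = eps) by (field; lra).
  assert (P := Cmod_ge_0 (y - z)%C). assert (Q := cond_pos eps).
  simpl. rewrite Rmult_1_r, <- Rmult_assoc. apply Rmult_le_compat_r; auto.
  set (h := Cmod (y - z)%C) in *. set (d := eps / (K + 1)) in *. nra.
Qed.

Lemma complex_sqrt (w : C) : exists u : C, (u * u)%C = w.
Proof.
  destruct w as [x y]. set (m := Cmod (x, y)).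
  assert (Hm : m ^ 2 = x ^ 2 + y ^ 2) by apply Cmod_sqr.
  assert (Hx : Rabs x <= m) by apply (re_le_Cmod (x, y)). apply Rabs_le_between in Hx.
  set (p := sqrt ((m + x) / 2)). set (q := sqrt ((m - x) / 2)).
  assert (Hp : p * p = (m + x) / 2) by (apply sqrt_sqrt; lra).
  assert (Hq : q * q = (m - x) / 2) by (apply sqrt_sqrt; lra).
  assert (Hpq : 2 * (p * q) = Rabs y).
  { unfold p, q. rewrite <- sqrt_mult by lra.
    replace ((m + x) / 2 * ((m - x) / 2)) with ((m ^ 2 - x ^ 2) / 4) by field. rewrite Hm.
    replace ((x ^ 2 + y ^ 2 - x ^ 2) / 4) with (Rsqr (y / 2)) by (unfold Rsqr; field).
    rewrite sqrt_Rsqr_abs. unfold Rdiv. rewrite Rabs_mult, (Rabs_pos_eq (/ 2)); lra. }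
  destruct (Rle_lt_dec 0 y) as [Hy|Hy].
  - exists (p, q). rewrite Rabs_pos_eq in Hpq by auto. unfold Cmult; simpl. f_equal; lra.
  - exists (p, - q). rewrite Rabs_left in Hpq by auto. unfold Cmult; simpl. f_equal; lra.
Qed.

(** Partial sums of artanh r: its derivative 1 / (1 - r^2) dominates every partial sum of the
    geometric series in r^2. *)
Lemma odd_power_sum (r : R) (M : nat) : 0 <= r < 1 ->
  rsum M (fun k => r ^ (2 * k + 1) / INR (2 * k + 1)) <= / 2 * ln ((1 + r) / (1 - r)).
Proof.
  intros Hr.
  set (phi := fun r : R => / 2 * (ln (1 + r) - ln (1 - r)) - rsum M (fun k => r ^ (2 * k + 1) / INR (2 * k + 1))).
  assert (H : phi 0 <= phi r).
  { apply (derive_nonneg_le phi (fun r : R => / (1 - r ^ 2) - rsum M (fun k => (r ^ 2) ^ k))); [lra| |].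
    - intros x Hx. apply @is_derive_minus.
      + auto_derive; [split; lra|]. field. split; nra.
      + apply (is_derive_rsum M (fun k x => x ^ (2 * k + 1) / INR (2 * k + 1)) (fun k x => (x ^ 2) ^ k)).
        intros k. rewrite <- pow_mult. replace (2 * k + 1)%nat with (S (2 * k)) by lia.
        generalize (2 * k)%nat. intros n. assert (Hn : INR (S n) <> 0) by (apply not_0_INR; lia).
        auto_derive; auto. change (match n with O => 1 | S _ => INR n + 1 end) with (INR (S n)).
        field. auto.
    - intros x Hx. assert (A := rsum_geometric_le (x ^ 2) M ltac:(simpl; nra)). lra. }
  assert (P0 : phi 0 = 0).
  { unfold phi. rewrite Rplus_0_r, Rminus_0_r, ln_1, rsum_0; [ring|].
    intros k _. rewrite pow_i by lia. unfold Rdiv; ring. }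
  rewrite P0 in H. unfold phi in H. rewrite ln_div by lra. lra.
Qed.

(** The partial sum equals the right-hand side, the sum of the whole series, minus an explicit
    nonnegative remainder. The term k = 0 contributes -1. *)
Lemma arithmetic_geometric_sum (q : R) (M : nat) : 0 <= q < 1 ->
  rsum (S M) (fun k => (2 * INR k - 1) * q ^ k) <= (1 + q) / (1 - q) ^ 2 - 2 / (1 - q).
Proof.
  intros Hq.
  assert (E : rsum (S M) (fun k => (2 * INR k - 1) * q ^ k)
     = (1 + q) / (1 - q) ^ 2 - 2 / (1 - q)
       - q ^ S M * ((2 * INR M + 1) - (2 * INR M - 1) * q) / (1 - q) ^ 2).
  { induction M as [|M IH].
    - simpl. field. lra.
    - change (rsum (S (S M)) ?f) with (rsum (S M) f + f (S M)). cbv beta. rewrite IH, S_INR. simpl. field. lra. }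
  rewrite E. assert (HM := pos_INR M).
  assert (0 <= q ^ S M * ((2 * INR M + 1) - (2 * INR M - 1) * q) / (1 - q) ^ 2); [|lra].
  apply Rdiv_le_0_compat; [|apply pow_lt; lra].
  apply Rmult_le_pos; [apply pow_le; lra|]. nra.
Qed.

(** Partial fractions k^2 / (2 k + 1) = (2 k - 1) / 4 + 1 / (4 (2 k + 1)), with k = i + 1, split the
    sum into an arithmetic-geometric one and an artanh one. Multiplied by 4 (1 - r0^2)^2, the
    statement that their closed forms add up to 1 is the equation of r0. *)
Lemma r0_sum_le_one (r0 : R) (M : nat) : 0 < r0 < 1 -> r0_equation r0 = 0 ->
  rsum M (fun i => (INR i + 1) ^ 2 / (2 * INR i + 3) * r0 ^ (2 * i + 4)) <= 1.
Proof.
  intros Hr Heq. unfold r0_equation in Heq.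
  assert (A := arithmetic_geometric_sum (r0 ^ 2) M ltac:(simpl; nra)).
  assert (B := odd_power_sum r0 (S M) ltac:(lra)).
  set (f := fun k : nat => INR k ^ 2 / (2 * INR k + 1) * r0 ^ (2 * k + 2)).
  assert (E1 : rsum (S M) f = rsum M (fun i => (INR i + 1) ^ 2 / (2 * INR i + 3) * r0 ^ (2 * i + 4))).
  { generalize M. induction M0 as [|m IH].
    - unfold f. simpl. unfold Rdiv. ring.
    - change (rsum (S (S m)) f) with (rsum (S m) f + f (S m)). rewrite IH.
      cbn [rsum]. f_equal. unfold f. rewrite S_INR.
      replace (2 * S m + 2)%nat with (2 * m + 4)%nat by lia. f_equal. f_equal. ring. }
  assert (E2 : rsum (S M) f = r0 ^ 2 / 4 * rsum (S M) (fun k => (2 * INR k - 1) * (r0 ^ 2) ^ k)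
      + r0 / 4 * rsum (S M) (fun k => r0 ^ (2 * k + 1) / INR (2 * k + 1))).
  { rewrite <- !rsum_scal, <- rsum_plus. apply rsum_ext. intros k _. unfold f.
    rewrite <- pow_mult, plus_INR, mult_INR, !pow_add. simpl (INR 2). simpl (INR 1).
    assert (Hk := pos_INR k). field. lra. }
  rewrite <- E1, E2.
  set (Lg := ln ((1 + r0) / (1 - r0))) in *.
  apply Rle_trans with (r0 ^ 2 / 4 * ((1 + r0 ^ 2) / (1 - r0 ^ 2) ^ 2 - 2 / (1 - r0 ^ 2)) + r0 / 4 * (/ 2 * Lg)).
  - apply Rplus_le_compat; apply Rmult_le_compat_l; auto; [simpl; nra|lra].
  - right. assert (Hne : 0 < 1 - r0 ^ 2) by (simpl; nra).
    apply Rmult_eq_reg_r with (4 * (1 - r0 ^ 2) ^ 2); [|assert (0 < (1 - r0 ^ 2) ^ 2) by (now apply pow_lt); lra].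
    replace (1 * (4 * (1 - r0 ^ 2) ^ 2)) with
      (r0 ^ 2 * (1 + r0 ^ 2) - 2 * r0 ^ 2 * (1 - r0 ^ 2) + r0 * (1 - r0 ^ 2) ^ 2 / 2 * Lg).
    + field. lra.
    + replace (r0 * (1 - r0 ^ 2) ^ 2 / 2 * Lg) with (4 + r0 ^ 4 - 7 * r0 ^ 2) by lra. ring.
Qed.

Lemma rsum_even_le (M : nat) (e : nat -> R) : (forall l, 0 <= e l) ->
  rsum M (fun i => e (2 * i + 2)%nat) <= rsum (2 * M + 2) e.
Proof.
  intros He. induction M as [|M IH].
  - simpl. assert (A := He 0%nat). assert (B := He 1%nat). lra.
  - replace (2 * S M + 2)%nat with (S (S (2 * M + 2))) by lia. cbn [rsum].
    assert (B := He (S (2 * M + 2))). lra.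
Qed.

(** With n = i + 2, AM-GM appears as the square A (x - B y / A)^2 >= 0 for A = 2 n - 1 and B = n -
    1. The powers of rho start at rho^4, so replacing r0 by rho gains at least (rho / r0)^4, and
    this makes the bound strict inside the disk. *)
Lemma coefficient_bound (a : nat -> C) (r0 rho : R) (M : nat) :
  0 < r0 < 1 -> r0_equation r0 = 0 -> (forall n, energy n a <= 1) -> 0 <= rho <= r0 ->
  rsum M (fun i => (INR i + 1) * Cmod (a (2 * i + 2)%nat) * rho ^ (i + 2)) <= / 2 * (1 + (rho / r0) ^ 4).
Proof.
  intros Hr Heq HE Hrho.
  set (th := (rho / r0) ^ 4).
  assert (Hq : 0 <= rho / r0 <= 1).
  { split; [apply Rdiv_le_0_compat; lra|]. apply Rmult_le_reg_r with r0; [lra|].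
    replace (rho / r0 * r0) with rho by (field; lra). lra. }
  assert (Hth : 0 <= th) by (apply pow_le; lra).
  apply Rle_trans with (rsum M (fun i => / 2 * (INR (S (2 * i + 2)) * Cmod (a (2 * i + 2)%nat) ^ 2)
     + / 2 * (th * ((INR i + 1) ^ 2 / (2 * INR i + 3) * r0 ^ (2 * i + 4))))).
  - apply rsum_le. intros i _. set (x := Cmod (a (2 * i + 2)%nat)).
    assert (Hi := pos_INR i).
    assert (HS : INR (S (2 * i + 2)) = 2 * INR i + 3).
    { rewrite S_INR, plus_INR, mult_INR. simpl. ring. }
    rewrite HS.
    assert (Hpow : (rho ^ (i + 2)) ^ 2 <= th * r0 ^ (2 * i + 4)).
    { replace rho with (rho / r0 * r0) at 1 by (field; lra).
      rewrite <- pow_mult, Rpow_mult_distr. replace ((i + 2) * 2)%nat with (2 * i + 4)%nat by lia.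
      apply Rmult_le_compat_r; [apply pow_le; lra|]. unfold th.
      replace (2 * i + 4)%nat with (4 + 2 * i)%nat by lia. now apply pow_le_shift. }
    set (y := rho ^ (i + 2)) in *. set (A := 2 * INR i + 3) in *. set (B := INR i + 1) in *.
    assert (HA : 0 < A) by (unfold A; lra). assert (HB : 0 <= B) by (unfold B; lra).
    assert (H1 : B ^ 2 / A * y ^ 2 <= th * (B ^ 2 / A * r0 ^ (2 * i + 4))).
    { replace (th * (B ^ 2 / A * r0 ^ (2 * i + 4))) with (B ^ 2 / A * (th * r0 ^ (2 * i + 4))) by ring.
      apply Rmult_le_compat_l; auto. apply Rdiv_le_0_compat; [apply pow2_ge_0|lra]. }
    assert (H2 : 0 <= A * (x - B * y / A) ^ 2) by (apply Rmult_le_pos; [lra|apply pow2_ge_0]).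
    replace (A * (x - B * y / A) ^ 2) with (A * x ^ 2 - 2 * (B * x * y) + B ^ 2 / A * y ^ 2) in H2 by (field; lra).
    lra.
  - rewrite rsum_plus, !rsum_scal.
    assert (P1 := rsum_even_le M (fun m => INR (S m) * Cmod (a m) ^ 2)
      (fun l => Rmult_le_pos _ _ (pos_INR (S l)) (pow2_ge_0 _))). cbv beta in P1.
    assert (P2 := HE (2 * M + 2)%nat). unfold energy in P2.
    assert (P3 := r0_sum_le_one r0 M Hr Heq).
    set (T := rsum M (fun i => (INR i + 1) ^ 2 / (2 * INR i + 3) * r0 ^ (2 * i + 4))) in *.
    assert (th * T <= th * 1) by (apply Rmult_le_compat_l; auto). lra.
Qed.

(** * Sums of power series and their derivatives *)

Definition psum (e : nat -> C) (n : nat) (x : C) : C := csum n (fun k => e k * x ^ k)%C.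

(** The derivative of [psum e (S n)], reindexed so that no exponent k - 1 occurs. *)
Definition dpsum (e : nat -> C) (n : nat) (x : C) : C :=
  csum n (fun j => RtoC (INR (S j)) * e (S j) * x ^ j)%C.

Definition plim (e : nat -> C) (x : C) : C := climit (fun n => psum e n x).

Definition dplim (e : nat -> C) (x : C) : C := climit (fun n => dpsum e n x).

(** The quotient t^j / t stands for t^(j - 1) and is harmless at j = 0, where its coefficient
    vanishes. The step peels off one factor x and uses [power_lipschitz] for the rest. *)
Lemma power_taylor (x y : C) (t : R) (j : nat) : 0 < t -> Cmod x <= t -> Cmod y <= t ->
  Cmod (y ^ S j - x ^ S j - RtoC (INR (S j)) * x ^ j * (y - x))%C
    <= INR j ^ 2 * (t ^ j / t) * Cmod (y - x)%C ^ 2.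
Proof.
  intros Ht Hx Hy. induction j as [|j IH].
  - replace (y ^ 1 - x ^ 1 - RtoC (INR 1) * x ^ 0 * (y - x))%C with (RtoC 0) by (simpl; ring).
    rewrite Cmod_0. simpl. lra.
  - replace (y ^ S (S j) - x ^ S (S j) - RtoC (INR (S (S j))) * x ^ S j * (y - x))%C with
      (x * (y ^ S j - x ^ S j - RtoC (INR (S j)) * x ^ j * (y - x)) + (y - x) * (y ^ S j - x ^ S j))%C.
    2:{ rewrite (S_INR (S j)), RtoC_plus, (Cpow_S y (S j)), (Cpow_S x (S j)), (Cpow_S x j). ring. }
    eapply Rle_trans; [apply Cmod_triangle|].
    assert (A := Cmod_mult_le _ _ _ _ Hx IH).
    assert (B := Cmod_mult_le _ _ _ _ (Rle_refl (Cmod (y - x)%C)) (power_lipschitz y x t j Hy Hx)).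
    set (u := Cmod (y - x)%C) in *. assert (Hj := pos_INR j).
    replace (t * (INR j ^ 2 * (t ^ j / t) * u ^ 2)) with (INR j ^ 2 * (t ^ j * u ^ 2)) in A by (field; lra).
    replace (u * ((INR j + 1) * t ^ j * u)) with ((INR j + 1) * (t ^ j * u ^ 2)) in B by ring.
    replace (INR (S j) ^ 2 * (t ^ S j / t) * u ^ 2) with ((INR j + 1) ^ 2 * (t ^ j * u ^ 2))
      by (rewrite S_INR; simpl; field; lra).
    assert (0 <= t ^ j * u ^ 2) by (apply Rmult_le_pos; [apply pow_le; lra|apply pow2_ge_0]).
    nra.
Qed.

(** Termwise differentiation with a uniform quadratic remainder: the remainders of the monomials are
    summed by [geometric_domination] for the shifted coefficients. *)
Lemma plim_taylor (e : nat -> C) (t : R) : subexponential e -> 0 < t < 1 ->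
  exists K, 0 <= K /\ forall x y, Cmod x <= t -> Cmod y <= t ->
    converges (fun n => psum e n x) (plim e x) /\ converges (fun n => dpsum e n x) (dplim e x) /\
    Cmod (plim e y - plim e x - dplim e x * (y - x))%C <= K * Cmod (y - x)%C ^ 2.
Proof.
  intros He Ht.
  destruct (geometric_domination e t Ht He) as (K1 & rho1 & HK1 & Hrho1 & Hdom1).
  destruct (geometric_domination (fun n => e (S n)) t Ht (subexponential_shift e He))
    as (K2 & rho2 & HK2 & Hrho2 & Hdom2).
  assert (Hc : forall x, Cmod x <= t -> converges (fun n => psum e n x) (plim e x)).
  { intros x Hx. apply (climit_geometric (fun n => psum e n x) K1 rho1 Hrho1). intros n.
    unfold psum. rewrite csum_S.
    replace (csum n (fun k => e k * x ^ k) + e n * x ^ n - csum n (fun k => e k * x ^ k))%C with (e n * x ^ n)%C by ring.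
    eapply Rle_trans; [|apply Hdom1]. rewrite Cmod_mult, Rmult_assoc.
    apply Rmult_le_compat_l; [apply Cmod_ge_0|].
    assert (A := Cmod_pow_le x t n Hx). assert (Hn := pos_INR n).
    assert (P : 0 <= t ^ n) by (apply pow_le; lra). nra. }
  assert (Hd : forall x, Cmod x <= t -> converges (fun n => dpsum e n x) (dplim e x)).
  { intros x Hx. apply (climit_geometric (fun n => dpsum e n x) K2 rho2 Hrho2). intros n.
    unfold dpsum. rewrite csum_S.
    replace (csum n (fun j => INR (S j) * e (S j) * x ^ j) + INR (S n) * e (S n) * x ^ n
      - csum n (fun j => INR (S j) * e (S j) * x ^ j))%C with (e (S n) * (INR (S n) * x ^ n))%C by ring.
    eapply Rle_trans; [|apply Hdom2]. rewrite Cmod_mult, Rmult_assoc.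
    apply Rmult_le_compat_l; [apply Cmod_ge_0|].
    rewrite Cmod_mult, Cmod_R, Rabs_pos_eq, S_INR by apply pos_INR.
    assert (A := Cmod_pow_le x t n Hx). assert (Hn := pos_INR n).
    assert (P : 0 <= t ^ n) by (apply pow_le; lra).
    assert (P' := Cmod_ge_0 (x ^ n)%C). nra. }
  exists (K2 / (1 - rho2) / t). split; [repeat apply Rdiv_le_0_compat; lra|].
  intros x y Hx Hy. repeat split; auto.
  assert (Hlim : converges (fun n => psum e (n + 1)%nat y + (- (1) * psum e (n + 1)%nat x + - (y - x) * dpsum e n x))%C
     (plim e y + (- (1) * plim e x + - (y - x) * dplim e x))%C).
  { apply converges_plus; [now apply (converges_shift (fun n => psum e n y)), Hc|].
    apply converges_plus; apply converges_scal; [now apply (converges_shift (fun n => psum e n x)), Hc|auto]. }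
  replace (plim e y - plim e x - dplim e x * (y - x))%C
    with (plim e y + (- (1) * plim e x + - (y - x) * dplim e x) - 0)%C by ring.
  apply (converges_bound _ _ _ _ Hlim). intros n. rewrite Nat.add_1_r. unfold psum, dpsum.
  rewrite !csum_S_l.
  replace (e 0%nat * y ^ 0 + csum n (fun j => e (S j) * y ^ S j) +
    (- (1) * (e 0%nat * x ^ 0 + csum n (fun j => e (S j) * x ^ S j)) +
      - (y - x) * csum n (fun j => INR (S j) * e (S j) * x ^ j)) - 0)%C
    with (csum n (fun j => e (S j) * (y ^ S j - x ^ S j - RtoC (INR (S j)) * x ^ j * (y - x))))%C.
  - eapply Rle_trans; [apply Cmod_csum|].
    apply Rle_trans with (rsum n (fun j => (K2 / t * Cmod (y - x)%C ^ 2) * rho2 ^ j)).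
    + apply rsum_le. intros j _. rewrite Cmod_mult.
      assert (A := power_taylor x y t j ltac:(lra) Hx Hy). assert (D := Hdom2 j). cbv beta in D.
      set (u2 := Cmod (y - x)%C ^ 2) in *. assert (Hu2 : 0 <= u2) by apply pow2_ge_0.
      assert (Hej := Cmod_ge_0 (e (S j))).
      eapply Rle_trans; [apply Rmult_le_compat_l; [exact Hej|exact A]|].
      assert (Hj := pos_INR j). assert (P : 0 <= t ^ j) by (apply pow_le; lra).
      replace (Cmod (e (S j)) * (INR j ^ 2 * (t ^ j / t) * u2)) with
        ((Cmod (e (S j)) * INR j ^ 2 * t ^ j) * (u2 / t)) by (field; lra).
      replace (K2 / t * u2 * rho2 ^ j) with ((K2 * rho2 ^ j) * (u2 / t)) by (field; lra).
      apply Rmult_le_compat_r; [apply Rdiv_le_0_compat; lra|].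
      eapply Rle_trans; [|exact D]. apply Rmult_le_compat_r; auto.
      apply Rmult_le_compat_l; auto. simpl. nra.
    + rewrite rsum_scal. assert (A := rsum_geometric_le rho2 n Hrho2).
      replace (K2 / (1 - rho2) / t * Cmod (y - x)%C ^ 2) with (K2 / t * Cmod (y - x)%C ^ 2 * / (1 - rho2)) by (field; lra).
      apply Rmult_le_compat_l; auto. apply Rmult_le_pos; [apply Rdiv_le_0_compat; lra|apply pow2_ge_0].
  - rewrite (csum_ext n _ (fun j => e (S j) * y ^ S j - e (S j) * x ^ S j - (y - x) * (INR (S j) * e (S j) * x ^ j))%C)
      by (intros; ring).
    rewrite !csum_minus, csum_scal. simpl (x ^ 0)%C. simpl (y ^ 0)%C. ring.
Qed.

(** Isolates the remainder of (z + u) / k(z + u): both terms of the numerator are of second order in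
    u as soon as D is. *)
Lemma quotient_expansion (z u H k' D ky : C) : H <> RtoC 0 -> ky <> RtoC 0 ->
  ky = (H + k' * u + D)%C ->
  ((z + u) / ky - z / H - (H - z * k') / (H * H) * u)%C
  = ((- (z * H * D) - (H - z * k') * (u * (k' * u + D))) * (/ H * / H * / ky))%C.
Proof.
  intros HH Hk E.
  replace ((z + u) / ky - z / H - (H - z * k') / (H * H) * u)%C with
    ((((z + u) * (H * H)) - z * H * ky - (H - z * k') * u * ky) * (/ H * / H * / ky))%C by (field; auto).
  f_equal. rewrite E. ring.
Qed.

Lemma quotient_is_derive (G k : C -> C) (z k' : C) (K : R) :
  Cmod z < 1 -> k z <> RtoC 0 -> 0 <= K ->
  (forall y, Cmod y < 1 -> k y <> RtoC 0) ->
  (forall y, Cmod y < 1 -> G y = (y / k y)%C) ->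
  (forall y, Cmod y < 1 -> Cmod (k y - k z - k' * (y - z))%C <= K * Cmod (y - z)%C ^ 2) ->
  is_derive G z ((k z - z * k') / (k z * k z))%C.
Proof.
  intros Hz Hkz HK Hk HG HT.
  set (m := Cmod (k z)). assert (Hm : 0 < m) by now apply Cmod_gt_0.
  set (c := Cmod k'). assert (Hc : 0 <= c) by apply Cmod_ge_0.
  set (L := c + 2 * K). assert (HL : 0 <= L) by (unfold L; lra).
  assert (HmL : 0 < m / (2 * (L + 1))) by (apply Rdiv_lt_0_compat; lra).
  assert (EL : m / (2 * (L + 1)) * (2 * (L + 1)) = m) by (field; lra).
  (* Within this radius y stays in the disk and k changes by at most m / 2, so |k(y)| >= m / 2. *)
  set (r := Rmin (1 - Cmod z) (m / (2 * (L + 1)))).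
  assert (Hr : 0 < r) by (apply Rmin_glb_lt; lra).
  assert (Hr1 : r <= 1 - Cmod z) by apply Rmin_l.
  assert (Hr2 : r <= m / (2 * (L + 1))) by apply Rmin_r.
  assert (Hi : 0 < / m) by now apply Rinv_0_lt_compat.
  set (B := (m * K + (m + c) * (c + K)) * (/ m * / m * (2 * / m))).
  assert (HB : 0 <= B).
  { unfold B. apply Rmult_le_pos; [apply Rplus_le_le_0_compat; apply Rmult_le_pos; lra|].
    repeat apply Rmult_le_pos; lra. }
  apply (quadratic_is_derive G z _ B r Hr HB).
  intros y Hy. assert (Hz0 := Cmod_ge_0 z).
  assert (Hy1 : Cmod y < 1) by (assert (A := Cmod_minus_triangle y z); lra).
  set (u := (y - z)%C) in *. set (h := Cmod u) in *. assert (Hh : 0 <= h) by apply Cmod_ge_0.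
  assert (Hh1 : h <= 1) by lra.
  set (D := (k y - k z - k' * u)%C). assert (HD : Cmod D <= K * h ^ 2) by now apply HT.
  assert (Eky : k y = (k z + k' * u + D)%C) by (unfold D; ring).
  assert (Hku : Cmod (k' * u + D)%C <= (c + K) * h).
  { eapply Rle_trans; [apply Cmod_triangle|]. rewrite Cmod_mult. fold c h.
    assert (K * h ^ 2 <= K * h) by (apply Rmult_le_compat_l; [lra|simpl; nra]). lra. }
  assert (Hlow : m / 2 <= Cmod (k y)).
  { assert (A := Cmod_triangle_inv (k z) (k' * u + D)%C). rewrite Cplus_assoc, <- Eky in A. fold m in A.
    set (q := m / (2 * (L + 1))) in *.
    assert ((c + K) * h <= L * q) by (apply Rmult_le_compat; unfold L; lra). lra. }
  rewrite !HG by auto. replace y with (z + u)%C at 1 by (unfold u; ring).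
  rewrite (quotient_expansion z u (k z) k' D (k y) Hkz (Hk y Hy1) Eky).
  replace (B * h ^ 2) with (((m * K + (m + c) * (c + K)) * h ^ 2) * (/ m * / m * (2 * / m))) by (unfold B; ring).
  apply Cmod_mult_le.
  - unfold Cminus at 1. eapply Rle_trans; [apply Cmod_triangle|]. rewrite !Cmod_opp.
    replace ((m * K + (m + c) * (c + K)) * h ^ 2) with (1 * m * (K * h ^ 2) + (m + c) * (h * ((c + K) * h))) by ring.
    apply Rplus_le_compat.
    + apply Cmod_mult_le; auto. apply Cmod_mult_le; [lra|apply Rle_refl].
    + apply Cmod_mult_le; [|apply Cmod_mult_le; [apply Rle_refl|exact Hku]].
      unfold Cminus. eapply Rle_trans; [apply Cmod_triangle|]. rewrite Cmod_opp, Cmod_mult. fold m c.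
      assert (Cmod z * c <= 1 * c) by (apply Rmult_le_compat_r; lra). lra.
  - apply Cmod_mult_le; [apply Cmod_mult_le|]; rewrite Cmod_inv by auto; try apply Rle_refl.
    replace (2 * / m) with (/ (m / 2)) by (field; lra). apply Rinv_le_contravar; lra.
Qed.

Lemma psum_gpoly (b : nat -> C) (n : nat) (x : C) : b O = RtoC 1 ->
  psum b (S (S n)) x = (gpoly n (fun m => b (S (S m))) x + b 1%nat * x)%C.
Proof. intros H. unfold psum, gpoly. rewrite !csum_S_l, H, Cpow_1_r. simpl (x ^ 0)%C. ring. Qed.

Lemma qpoly_converges (b : nat -> C) (z v gz gv : C) : b O = RtoC 1 ->
  converges (fun n => psum b n z) gz -> converges (fun n => psum b n v) gv ->
  converges (fun n => (z - v) * qpoly n (fun m => b (S (S m))) z v)%C (z * gv + - v * gz)%C.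
Proof.
  intros H0 Hz Hv.
  apply converges_ext with (fun n => z * psum b (n + 2)%nat v + - v * psum b (n + 2)%nat z)%C.
  - intros n. rewrite <- qpoly_spec. replace (n + 2)%nat with (S (S n)) by lia.
    rewrite !psum_gpoly by auto. ring.
  - apply converges_plus; apply converges_scal.
    + now apply (converges_shift (fun n => psum b n v)).
    + now apply (converges_shift (fun n => psum b n z)).
Qed.

Lemma Cinv_0 : (/ RtoC 0)%C = RtoC 0.
Proof. apply injective_projections; simpl; unfold Rdiv; ring. Qed.

Lemma psum_even_part (b : nat -> C) (n : nat) (x : C) :
  (psum b (2 * n) x + psum b (2 * n) (- x))%C = (2 * psum (fun k => b (2 * k)%nat) n (x * x))%C.
Proof.
  unfold psum. induction n as [|n IH]; [simpl; ring|].
  replace (2 * S n)%nat with (S (S (2 * n))) by lia. cbn [csum].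
  transitivity ((csum (2 * n) (fun k => b k * x ^ k) + csum (2 * n) (fun k => b k * (- x) ^ k))
     + (b (2 * n)%nat * (x ^ (2 * n) + (- x) ^ (2 * n)) + b (S (2 * n)) * (x ^ S (2 * n) + (- x) ^ S (2 * n))))%C;
    [ring|].
  rewrite IH, !(Cpow_S _ (2 * n)), !Cpow_mult_r.
  replace (((- x) ^ 2)%C) with ((x * x)%C) by (simpl; ring). replace ((x ^ 2)%C) with ((x * x)%C) by (simpl; ring).
  ring.
Qed.

(** In h - w h' the coefficient of w^n is multiplied by 1 - n: the constant term is the 1 that is
    subtracted, the linear term drops out, and n = i + 2 gives -(i + 1) b_(2 i + 4). The shifts n +
    2 and n + 1 align the two partial sums. *)
Lemma derivative_defect_bound (b : nat -> C) (w : C) (B : R) : b O = RtoC 1 ->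
  converges (fun n => psum (fun k => b (2 * k)%nat) n w) (plim (fun k => b (2 * k)%nat) w) ->
  converges (fun n => dpsum (fun k => b (2 * k)%nat) n w) (dplim (fun k => b (2 * k)%nat) w) ->
  (forall M, rsum M (fun i => (INR i + 1) * Cmod (b (S (S (2 * i + 2)))) * Cmod w ^ (i + 2)) <= B) ->
  Cmod (plim (fun k => b (2 * k)%nat) w - w * dplim (fun k => b (2 * k)%nat) w - 1)%C <= B.
Proof.
  intros H0 Hp Hd HB. set (e := fun k => b (2 * k)%nat) in *.
  assert (Hlim : converges (fun n => psum e (n + 2)%nat w + - w * dpsum e (n + 1)%nat w)%C
     (plim e w + - w * dplim e w)%C).
  { apply converges_plus; [now apply (converges_shift (fun n => psum e n w))|].
    now apply converges_scal, (converges_shift (fun n => dpsum e n w)). }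
  replace (plim e w - w * dplim e w - 1)%C with (plim e w + - w * dplim e w - 1)%C by ring.
  apply (converges_bound _ _ _ _ Hlim). intros n. eapply Rle_trans; [|apply (HB n)].
  replace (psum e (n + 2)%nat w + - w * dpsum e (n + 1)%nat w - 1)%C
    with (csum n (fun i => - (RtoC (INR i + 1) * b (S (S (2 * i + 2))) * w ^ (i + 2))))%C.
  - eapply Rle_trans; [apply Cmod_csum|]. apply rsum_le. intros i _.
    rewrite Cmod_opp, !Cmod_mult, Cmod_pow, Cmod_R, Rabs_pos_eq by (assert (Hi := pos_INR i); lra). lra.
  - unfold psum, dpsum. replace (n + 2)%nat with (S (S n)) by lia. rewrite Nat.add_1_r, !csum_S_l.
    rewrite csum_opp.
    transitivity (csum n (fun j => e (S (S j)) * w ^ S (S j) - w * (INR (S (S j)) * e (S (S j)) * w ^ S j)))%C.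
    + rewrite <- csum_opp. apply csum_ext. intros i _. unfold e.
      replace (2 * S (S i))%nat with (S (S (2 * i + 2))) by lia.
      replace (i + 2)%nat with (S (S i)) by lia. rewrite !S_INR, !RtoC_plus, (Cpow_S w (S i)). ring.
    + rewrite csum_minus, csum_scal. unfold e at 3. simpl (2 * 0)%nat. rewrite H0. simpl (INR 1).
      simpl (w ^ 0)%C. rewrite Cpow_1_r. ring.
Qed.

(** * The theorem *)

Lemma Cdiv_nonzero (x y : C) : x <> RtoC 0 -> y <> RtoC 0 -> (x / y)%C <> RtoC 0.
Proof.
  intros Hx Hy E. apply Hx. replace x with (x / y * y)%C by (field; auto). rewrite E. ring.
Qed.

Lemma converges_const (c : C) : converges (fun _ => c) c.
Proof.
  intros eps He. exists O. intros n _. replace (c - c)%C with (RtoC 0) by ring. now rewrite Cmod_0.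
Qed.

Lemma converges_even (u : nat -> C) (l : C) :
  converges u l -> converges (fun n => u (2 * n)%nat) l.
Proof. intros H eps He. destruct (H eps He) as (n0 & Hn). exists n0. intros n Hnn. apply Hn. lia. Qed.

Lemma psum_converges_subexponential (b : nat -> C) :
  (forall z, Cmod z < 1 -> z <> RtoC 0 -> exists l, converges (fun n => psum b n z) l) ->
  subexponential b.
Proof.
  intros H s Hs. destruct (H (RtoC s)) as (l & Hl).
  - rewrite Cmod_R, Rabs_pos_eq; lra.
  - intros E. apply RtoC_inj in E. lra.
  - destruct (converges_terms_bounded _ _ Hl) as (B & HB). exists B. intros n.
    eapply Rle_trans; [right|apply (HB n)].
    rewrite Cmod_mult, Cmod_pow, Cmod_R, Rabs_pos_eq; lra.
Qed.

Lemma subexponential_even (b : nat -> C) : subexponential b -> subexponential (fun n => b (2 * n)%nat).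
Proof.
  intros H s Hs.
  assert (Hq : sqrt s * sqrt s = s) by (apply sqrt_sqrt; lra).
  assert (Hq0 : 0 < sqrt s) by (apply sqrt_lt_R0; lra).
  destruct (H (sqrt s)) as (B & HB); [split; nra|].
  exists B. intros n. eapply Rle_trans; [right|apply (HB (2 * n)%nat)].
  rewrite pow_mult. simpl (sqrt s ^ 2). rewrite Rmult_1_r, Hq. reflexivity.
Qed.

(** A zero of q off the diagonal means z (v / f(v)) = v (z / f(z)), that is f(z) = f(v). The cases z
    = 0 and v = 0 are separate, since the expansion of z / f(z) is given only away from 0; there q =
    1. *)
Lemma reciprocal_difference_nonzero (f : C -> C) (b : nat -> C) :
  f (RtoC 0) = RtoC 0 -> univalent_on_disk 1 f -> b O = RtoC 1 -> subexponential b ->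
  (forall z, Cmod z < 1 -> z <> RtoC 0 -> converges (fun n => psum b n z) (z / f z)%C) ->
  forall z v, Cmod z < 1 -> Cmod v < 1 -> z <> v -> qlim (fun m => b (S (S m))) z v <> RtoC 0.
Proof.
  intros Hf0 Huniv Hb0 Hsub Hconv z v Hz Hv Hzv Hq.
  set (a := fun m => b (S (S m))) in *.
  assert (Ha : subexponential a) by (apply (subexponential_shift (fun n => b (S n))), subexponential_shift, Hsub).
  set (t := (1 + Rmax (Cmod z) (Cmod v)) / 2).
  assert (HM1 := Rmax_l (Cmod z) (Cmod v)). assert (HM2 := Rmax_r (Cmod z) (Cmod v)).
  assert (HM3 : Rmax (Cmod z) (Cmod v) < 1) by now apply Rmax_lub_lt.
  assert (HM4 := Cmod_ge_0 z).
  assert (Ht : 0 < t < 1) by (unfold t; lra).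
  assert (Hzt : Cmod z <= t) by (unfold t; lra). assert (Hvt : Cmod v <= t) by (unfold t; lra).
  destruct (qlim_uniform a t Ha Ht) as (Hc & _). specialize (Hc z v Hzt Hvt). rewrite Hq in Hc.
  assert (H10 : RtoC 1 <> RtoC 0) by (intros E; apply RtoC_inj in E; lra).
  destruct (classic (z = RtoC 0)) as [Ez|Nz].
  { subst z. apply H10. apply (converges_unique (fun n => qpoly n a (RtoC 0) v)); auto.
    apply converges_ext with (fun _ => RtoC 1); [intros; now rewrite qpoly_0_l|apply converges_const]. }
  destruct (classic (v = RtoC 0)) as [Ev|Nv].
  { subst v. apply H10. apply (converges_unique (fun n => qpoly n a z (RtoC 0))); auto.
    apply converges_ext with (fun _ => RtoC 1); [intros; now rewrite qpoly_0_r|apply converges_const]. }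
  assert (Hf : forall x, Cmod x < 1 -> x <> RtoC 0 -> f x <> RtoC 0).
  { intros x Hx Nx E. apply Nx. apply Huniv; auto; [rewrite Cmod_0; lra|]. now rewrite E. }
  assert (E := converges_unique _ _ _ (qpoly_converges b z v _ _ Hb0 (Hconv z Hz Nz) (Hconv v Hv Nv))
    (converges_scal _ _ (z - v)%C Hc)).
  apply Hzv, Huniv; auto.
  assert (Fz := Hf z Hz Nz). assert (Fv := Hf v Hv Nv).
  assert (E2 : (z * v * (f z - f v))%C = RtoC 0).
  { replace (z * v * (f z - f v))%C with ((z * (v / f v) + - v * (z / f z)) * (f z * f v))%C by (field; auto).
    rewrite E. ring. }
  apply Cmult_integral in E2. destruct E2 as [E2|E2].
  - apply Cmult_integral in E2. tauto.
  - replace (f z) with ((f z - f v) + f v)%C by ring. rewrite E2. ring.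
Qed.

(* With u^2 = w one has 2 h(w) = u / f(u) + (-u) / f(-u), so a zero of h would give f(u) = f(-u). *)
Lemma even_part_nonzero (f : C -> C) (b : nat -> C) (w l : C) :
  f (RtoC 0) = RtoC 0 -> univalent_on_disk 1 f ->
  (forall z, Cmod z < 1 -> z <> RtoC 0 -> converges (fun n => psum b n z) (z / f z)%C) ->
  Cmod w < 1 -> w <> RtoC 0 ->
  converges (fun n => psum (fun k => b (2 * k)%nat) n w) l -> l <> RtoC 0.
Proof.
  intros Hf0 Huniv Hconv Hw Nw Hl El. subst l.
  destruct (complex_sqrt w) as (u & Hu).
  assert (Nu : u <> RtoC 0) by (intros ->; apply Nw; rewrite <- Hu; ring).
  assert (Hu1 : Cmod u < 1).
  { assert (A : Cmod u * Cmod u < 1) by (rewrite <- Cmod_mult, Hu; exact Hw).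
    assert (B := Cmod_ge_0 u). nra. }
  assert (Nu' : (- u)%C <> RtoC 0).
  { intros E. apply Nu. replace u with (- - u)%C by ring. rewrite E. ring. }
  assert (Hu1' : Cmod (- u)%C < 1) by now rewrite Cmod_opp.
  assert (Hf : forall x, Cmod x < 1 -> x <> RtoC 0 -> f x <> RtoC 0).
  { intros x Hx Nx E. apply Nx. apply Huniv; auto; [rewrite Cmod_0; lra|]. now rewrite E. }
  assert (E := converges_unique _ _ _
    (converges_ext _ _ _ (fun n => psum_even_part b n u)
      (converges_plus _ _ _ _ (converges_even _ _ (Hconv u Hu1 Nu)) (converges_even _ _ (Hconv _ Hu1' Nu'))))
    (converges_scal _ _ 2%C (eq_ind_r (fun x => converges (fun n => psum (fun k => b (2 * k)%nat) n x) (RtoC 0)) Hl Hu))).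
  assert (F1 := Hf u Hu1 Nu). assert (F2 := Hf _ Hu1' Nu').
  assert (E2 : (u * (f (- u) - f u))%C = RtoC 0).
  { replace (u * (f (- u) - f u))%C with ((u / f u + - u / f (- u)) * (f u * f (- u)))%C by (field; auto).
    rewrite E. ring. }
  apply Cmult_integral in E2. destruct E2 as [E2|E2]; [tauto|].
  assert (E3 : (- u)%C = u).
  { apply Huniv; auto. replace (f (- u)%C) with ((f (- u) - f u) + f u)%C by ring. rewrite E2. ring. }
  apply Nu. replace u with ((u - (- u)) / 2)%C by field.
  rewrite E3. field.
Qed.

(** The difference kernel of the series differs from 1 by at most the weighted coefficient sum [ka]
    < 1. Hence (z - w) q(z, w), which tends to z h(w) - w h(z) for h the sum of the series, can tend
    to 0 only if z = w. *)
Lemma reciprocal_series_injective (e : nat -> C) (z w gz gw : C) (rho ka : R) :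
  e O = RtoC 1 -> Cmod z <= rho -> Cmod w <= rho -> ka < 1 ->
  (forall M, rsum M (fun m => (INR m + 1) * Cmod (e (S (S m))) * rho ^ (m + 2)) <= ka) ->
  converges (fun n => psum e n z) gz -> converges (fun n => psum e n w) gw ->
  (z * gw)%C = (w * gz)%C -> z = w.
Proof.
  intros He0 Hz Hw Hka Hb Cz Cw E.
  assert (Cq := qpoly_converges e z w gz gw He0 Cz Cw).
  assert (Hq : forall n, 1 - ka <= Cmod (qpoly n (fun m => e (S (S m))) z w)).
  { intros n. unfold qpoly, Cminus.
    eapply Rle_trans; [|apply Cmod_triangle_inv]. rewrite Cmod_1, Cmod_opp.
    assert (A : Cmod (csum n (fun m => e (S (S m)) * csum (S m) (fun i => z ^ S i * w ^ S (m - i))))%C <= ka); [|lra].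
    eapply Rle_trans; [apply Cmod_csum|]. eapply Rle_trans; [|apply (Hb n)].
    apply rsum_le. intros m _. rewrite Cmod_mult.
    replace ((INR m + 1) * Cmod (e (S (S m))) * rho ^ (m + 2)) with
      (Cmod (e (S (S m))) * (INR (S m) * rho ^ (m + 2))) by (rewrite S_INR; ring).
    apply Rmult_le_compat_l; [apply Cmod_ge_0|].
    eapply Rle_trans; [apply Cmod_csum|]. apply rsum_le_const. intros i Hi.
    replace (m + 2)%nat with (S i + S (m - i))%nat by lia. rewrite pow_add.
    apply Cmod_mult_le; now apply Cmod_pow_le. }
  replace (z * gw + - w * gz)%C with (RtoC 0) in Cq by (rewrite E; ring).
  destruct (classic (z = w)) as [|Nzw]; auto. exfalso.
  assert (Hd : 0 < Cmod (z - w)%C).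
  { apply Cmod_gt_0. intros E0. apply Nzw. replace z with ((z - w) + w)%C by ring. rewrite E0. ring. }
  assert (Hpos : 0 < Cmod (z - w)%C * (1 - ka)) by (apply Rmult_lt_0_compat; lra).
  destruct (Cq _ Hpos) as (n & Hn). specialize (Hn n (le_n n)).
  replace ((z - w) * qpoly n (fun m => e (S (S m))) z w - 0)%C
    with ((z - w) * qpoly n (fun m => e (S (S m))) z w)%C in Hn by ring.
  rewrite Cmod_mult in Hn. specialize (Hq n). nra.
Qed.

Theorem theorem6p1 (f F : C -> C) (b : nat -> C) (r0 : R) :
  classA f ->
  univalent_on_disk 1 f ->
  (* z / f(z) = 1 + sum_{n>=1} b_n z^n in D *)
  b O = RtoC 1 ->
  (forall z : C, Cmod z < 1 -> z <> RtoC 0 -> is_pseries b z (Cdiv z (f z))) ->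
  (* z / F(z) = 1 + sum_{n>=1} b_{2n} z^n in D, F(0) = 0 *)
  F (RtoC 0) = RtoC 0 ->
  (forall z : C, Cmod z < 1 -> z <> RtoC 0 ->
     is_pseries (fun n => b (2 * n)%nat) z (Cdiv z (F z))) ->
  (* r0 is the root in (0,1) of the transcendental equation *)
  0 < r0 < 1 -> r0_equation r0 = 0 ->
  (forall r : R, 0 < r <= r0 ->
     classU1 (fun z => Cdiv (F (Cmult (RtoC r) z)) (RtoC r))) /\
  univalent_on_disk r0 F.
Proof.
  intros (_ & Hf0 & _) Huniv Hb0 Hg HF0 HFs Hr0 Heq.
  assert (Hconv : forall z, Cmod z < 1 -> z <> RtoC 0 -> converges (fun n => psum b n z) (z / f z)%C)
    by (intros; now apply is_pseries_converges, Hg).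
  assert (Hsub : subexponential b) by (apply psum_converges_subexponential; eauto).
  assert (HE := area_inequality (fun m => b (S (S m)))
    (subexponential_shift _ (subexponential_shift _ Hsub))
    (reciprocal_difference_nonzero f b Hf0 Huniv Hb0 Hsub Hconv)).
  set (e := fun n => b (2 * n)%nat).
  assert (He : subexponential e) by now apply subexponential_even.
  assert (Hpe : forall w, Cmod w < 1 -> converges (fun n => psum e n w) (plim e w) /\
      converges (fun n => dpsum e n w) (dplim e w)).
  { intros w Hw. assert (P := Cmod_ge_0 w).
    destruct (plim_taylor e ((1 + Cmod w) / 2) He ltac:(lra)) as (K & _ & HK).
    destruct (HK w w ltac:(lra) ltac:(lra)) as (A & B & _). auto. }
  assert (H0 : plim e (RtoC 0) = RtoC 1).
  { apply (converges_unique (fun n => psum e (n + 1)%nat (RtoC 0))).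
    - apply (converges_shift (fun n => psum e n (RtoC 0))), Hpe. rewrite Cmod_0. lra.
    - apply converges_ext with (fun _ => RtoC 1); [|apply converges_const].
      intros n. unfold psum. rewrite Nat.add_1_r, csum_S_l, csum_0.
      + unfold e. simpl. rewrite Hb0. ring.
      + intros k _. rewrite Cpow_0_S. ring. }
  assert (Hne : forall w, Cmod w < 1 -> plim e w <> RtoC 0).
  { intros w Hw. destruct (classic (w = RtoC 0)) as [->|Nw]; [rewrite H0; intros E; apply RtoC_inj in E; lra|].
    apply (even_part_nonzero f b w _ Hf0 Huniv Hconv Hw Nw). now apply Hpe. }
  assert (HF : forall w, Cmod w < 1 -> F w = (w / plim e w)%C).
  { intros w Hw. destruct (classic (w = RtoC 0)) as [->|Nw].
    - rewrite HF0, H0. field.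
    - assert (E : plim e w = (w / F w)%C).
      { apply (converges_unique (fun n => psum e n w)); [now apply Hpe|].
        now apply is_pseries_converges, HFs. }
      (* Division by 0 yields 0 here, so F(w) = 0 would force the sum of the series to vanish at
         w. *)
      assert (NF : F w <> RtoC 0).
      { intros EF. apply (Hne w Hw). rewrite E, EF. unfold Cdiv. rewrite Cinv_0. ring. }
      rewrite E. field. auto. }
  assert (Hbound : forall rho M, 0 <= rho <= r0 ->
     rsum M (fun i => (INR i + 1) * Cmod (b (S (S (2 * i + 2)))) * rho ^ (i + 2)) <= / 2 * (1 + (rho / r0) ^ 4)).
  { intros rho M Hrho. exact (coefficient_bound (fun m => b (S (S m))) r0 rho M Hr0 Heq HE Hrho). }
  (* At rho = r0 the bound equals 1; points of the open disk have smaller modulus and get a strict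
     inequality. *)
  assert (Hlt1 : forall rho, 0 <= rho < r0 -> / 2 * (1 + (rho / r0) ^ 4) < 1).
  { intros rho Hrho. assert (A : 0 <= rho / r0 < 1).
    { split; [apply Rdiv_le_0_compat; lra|]. apply Rmult_lt_reg_r with r0; [lra|].
      replace (rho / r0 * r0) with rho by (field; lra). lra. }
    assert (B := pow_lt_1_compat (rho / r0) 4 A ltac:(lia)). lra. }
  split.
  - intros r Hr.
    set (G := fun z => (F (RtoC r * z) / RtoC r)%C). set (k := fun z => plim e (RtoC r * z)%C).
    assert (Nr : RtoC r <> RtoC 0) by (intros E; apply RtoC_inj in E; lra).
    assert (Hrz : forall z, Cmod (RtoC r * z)%C = r * Cmod z).
    { intros z. rewrite Cmod_mult, Cmod_R, Rabs_pos_eq; lra. }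
    assert (Hr1 : forall z, Cmod z < 1 -> Cmod (RtoC r * z)%C <= r).
    { intros z Hz. rewrite Hrz. assert (P := Cmod_ge_0 z). nra. }
    assert (Hk : forall z, Cmod z < 1 -> k z <> RtoC 0).
    { intros z Hz. apply Hne. assert (A := Hr1 z Hz). lra. }
    assert (HG : forall z, Cmod z < 1 -> G z = (z / k z)%C).
    { intros z Hz. unfold G. rewrite HF by (assert (A := Hr1 z Hz); lra). fold (k z).
      field. split; auto. }
    destruct (plim_taylor e r He ltac:(lra)) as (K & HK & HT).
    assert (HD : forall z, Cmod z < 1 ->
       is_derive G z ((k z - z * (RtoC r * dplim e (RtoC r * z))) / (k z * k z))%C).
    { intros z Hz. apply (quotient_is_derive G k z (RtoC r * dplim e (RtoC r * z))%C K); auto.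
      intros y Hy. destruct (HT (RtoC r * z)%C (RtoC r * y)%C (Hr1 z Hz) (Hr1 y Hy)) as (_ & _ & A).
      fold (k y) (k z) in A.
      replace (RtoC r * y - RtoC r * z)%C with (RtoC r * (y - z))%C in A by ring.
      rewrite Hrz in A.
      replace (k y - k z - RtoC r * dplim e (RtoC r * z) * (y - z))%C
        with (k y - k z - dplim e (RtoC r * z) * (RtoC r * (y - z)))%C by ring.
      eapply Rle_trans; [exact A|]. apply Rmult_le_compat_l; auto. apply pow_incr.
      assert (P := Cmod_ge_0 (y - z)%C). split; nra. }
    assert (Hk0 : k (RtoC 0) = RtoC 1).
    { unfold k. replace (RtoC r * 0)%C with (RtoC 0) by ring. exact H0. }
    split; [split; [|split]|].
    + intros z Hz. eexists. exact (HD z Hz).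
    + change (G (RtoC 0) = RtoC 0). rewrite HG, Hk0 by (rewrite Cmod_0; lra). field.
    + assert (A := HD (RtoC 0) ltac:(rewrite Cmod_0; lra)). rewrite Hk0 in A.
      replace ((1 - 0 * (RtoC r * dplim e (RtoC r * 0))) / (1 * 1))%C with (RtoC 1) in A by field.
      exact A.
    + intros z Hz Nz. change (F (RtoC r * z)%C / RtoC r)%C with (G z).
      assert (Nk := Hk z Hz). rewrite (HG z Hz). split; [now apply Cdiv_nonzero|].
      intros f' Hf'.
      assert (Ef : f' = ((k z - z * (RtoC r * dplim e (RtoC r * z))) / (k z * k z))%C).
      { rewrite <- (is_C_derive_unique G z f' Hf'). now apply is_C_derive_unique, HD. }
      rewrite Ef.
      (* From z / G = k and the quotient rule, (z / G)^2 G' - 1 = k - z k' - 1, which is U_F at r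
         z. *)
      replace (z / (z / k z) * (z / (z / k z)) *
        ((k z - z * (RtoC r * dplim e (RtoC r * z))) / (k z * k z)) - 1)%C
        with (plim e (RtoC r * z) - (RtoC r * z) * dplim e (RtoC r * z) - 1)%C
        by (fold (k z); field; auto).
      set (w := (RtoC r * z)%C).
      (* Strict even for r = r0, because |z| < 1. *)
      assert (Hw : 0 <= Cmod w < r0).
      { split; [apply Cmod_ge_0|]. unfold w. rewrite Hrz. assert (P := Cmod_ge_0 z). nra. }
      eapply Rle_lt_trans; [|apply (Hlt1 _ Hw)].
      destruct (Hpe w ltac:(lra)) as (C1 & C2).
      apply (derivative_defect_bound b w _ Hb0 C1 C2).
      intros M. apply Hbound. lra.
  - intros z w Hz Hw E.
    assert (Nz := Hne z ltac:(lra)). assert (Nw := Hne w ltac:(lra)).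
    rewrite !HF in E by lra.
    set (rho := Rmax (Cmod z) (Cmod w)).
    assert (Hrho : 0 <= rho < r0).
    { split; [|now apply Rmax_lub_lt]. eapply Rle_trans; [apply (Cmod_ge_0 z)|apply Rmax_l]. }
    apply (reciprocal_series_injective e z w (plim e z) (plim e w) rho (/ 2 * (1 + (rho / r0) ^ 4))).
    + exact Hb0.
    + apply Rmax_l.
    + apply Rmax_r.
    + now apply Hlt1.
    (* The injectivity criterion involves the same series as the bound for U_F: e_(i + 2) is b_(2 i
       + 4). *)
    + intros M. eapply Rle_trans; [right|apply (Hbound rho M); lra].
      apply rsum_ext. intros i _. unfold e. replace (2 * S (S i))%nat with (S (S (2 * i + 2))) by lia. reflexivity.
    + apply Hpe. lra.
    + apply Hpe. lra.
    + replace (z * plim e w)%C with ((z / plim e z) * (plim e z * plim e w))%C by (field; auto).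
      rewrite E. field. auto.
Qed.
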